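(* Let $l>0$ and let $a=\{a_n\}_{n\ge1}\in\mathcal F(l)$, that is, $a_n\sim n^{l-1}L(n)$ as $n\to\infty$, with $a_n>0$, $L$ slowly varying (subject to the standing assumptions in the context) and $d=\lim_{n\to\infty}L(n)\in[0,\infty]$. Let $\Omega_n$, $\mu_n$, $K_p=K_p^{(n)}$ and $\bar q_n$ be as in the context, and let $Pr$ denote probability under $\mu_n$. Then: (i) For every $\epsilon>0$, $$\lim_{n\to\infty}Pr\big(n^{\frac1{l+1}-\epsilon}<\bar q_n<n^{\frac1{l+1}+\epsilon}\big)=1.$$ (ii) For all $p=p(n)$ such that $n^\epsilon\le p\le n^\beta$, with $\beta<\frac1{l+1}$ and $\epsilon>0$, $$\lim_{n\to\infty}Pr(K_p=0)=\begin{cases}1,&\text{if }0<l<1,\\ e^{-d},&\text{if } l=1,\\ 0,&\text{if } l>1.\end{cases}$$ (iii) For any $s$-tuple of distinct integers $p_1,\dots,p_s\ge1$ and any $s$-tuple of integers $k_1,\dots,k_s\ge 0$ (all independent of $n$), $$\lim_{n\to\infty}Pr(K_{p_1}=k_1,\dots,K_{p_s}=k_s)=\prod_{j=1}^s\frac{a_{p_j}^{k_j}}{k_j!}\,e^{-a_{p_j}}.$$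
   Context: For $n\ge1$, $\Omega_n$ is the finite set of all partitions $\eta=(k_1,\dots,k_n)$ of $n$, where the integers $k_i\ge0$ (the number of groups of size $i$) satisfy $\sum_{i=1}^n ik_i=n$. The probability measure $\mu_n$ on $\Omega_n$ is $$\mu_n(\eta)=\frac1{c_n}\,\frac{a_1^{k_1}a_2^{k_2}\cdots a_n^{k_n}}{k_1!\,k_2!\cdots k_n!},\qquad c_n=\sum_{\eta\in\Omega_n}\frac{a_1^{k_1}\cdots a_n^{k_n}}{k_1!\cdots k_n!}.$$ (This is the invariant measure of a reversible coagulation-fragmentation process with parameter function $a$.) The random variable $K_i=K_i^{(n)}$ on $(\Omega_n,\mu_n)$ is $K_i(\eta)=k_i$, the number of groups of size $i$, and $\bar q_n(\eta)=\max\{i: k_i>0\}$ is the size of the largest group. Slowly varying function: $L$ is defined on $[0,\infty)$, positive for large arguments, with $\lim_{x\to\infty}L(\lambda x)/L(x)=1$ for every $\lambda>0$. Standing assumptions on $L$: $L$ is differentiable on $[0,\infty)$; for every $\delta>0$ the function $x^{-\delta}L(x)$ is locally bounded on $[0,\infty)$ (in particular bounded near $0$); the limit $d=\lim_{n\to\infty}L(n)$ exists in $[0,\infty]$. Convention: $e^{-\infty}=0$. *)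

(* Defs.v *)
From mathcomp Require Import all_boot all_order all_algebra.
From mathcomp Require Import all_classical all_reals all_analysis.

Set Implicit Arguments.
Unset Strict Implicit.
Unset Printing Implicit Defensive.

Import Order.TTheory GRing.Theory Num.Theory.
Import numFieldTopology.Exports numFieldNormedType.Exports.

Local Open Scope classical_set_scope.
Local Open Scope ring_scope.

(* The index i : 'I_n stands for the group size i.+1; the bound k_i <= n is
   automatic for a partition of n. *)
Definition Omega (n : nat) : finType :=
  {eta : {ffun 'I_n -> 'I_n.+1} | (\sum_(i < n) i.+1 * eta i == n)%N}.

(* The number of groups of size i; it is 0 when i = 0 or i > n. *)
Definition K (n i : nat) (eta : Omega n) : nat :=
  (\sum_(j < n | j.+1 == i) val eta j)%N.

Definition qbar (n : nat) (eta : Omega n) : nat :=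
  (\max_(1 <= i < n.+1 | 0 < K i eta) i)%N.

(* The value a 0 is never used. *)
Definition weight (R : realType) (a : nat -> R) (n : nat) (eta : Omega n) :
    R :=
  \prod_(1 <= i < n.+1) (a i ^+ K i eta / (K i eta)`!%:R).

Definition partition_function (R : realType) (a : nat -> R) (n : nat) : R :=
  \sum_(eta : Omega n) weight a eta.

Definition mu (R : realType) (a : nat -> R) (n : nat) (eta : Omega n) :
    R :=
  weight a eta / partition_function a n.

Definition Pr (R : realType) (a : nat -> R) (n : nat) (E : pred (Omega n)) :
    R :=
  \sum_(eta : Omega n | E eta) mu a eta.

(* Functions on [0, +oo[ are represented by total functions R -> R, of which
   only the values on [0, +oo[ are ever constrained. *)
Definition slowly_varying (R : realType) (L : R -> R) : Prop :=
  (\forall x \near +oo, 0 < L x) /\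
  (forall lambda : R, 0 < lambda -> L (lambda * x) / L x @[x --> +oo] --> (1 : R)).

(* One-sided at 0. *)
Definition differentiable_on_nonneg (R : realType) (L : R -> R) : Prop :=
  (forall x : R, 0 < x -> derivable L x 1) /\
  cvg (h^-1 * (L h - L 0) @[h --> 0^'+]).

(* Since 0 `^ (- delta) = 0 for delta != 0, the point 0, where x^(-delta) is
   undefined, imposes nothing itself: near 0 this is boundedness on some
   ]0, r[. *)
Definition locally_bounded_scaled (R : realType) (L : R -> R) : Prop :=
  forall delta : R, 0 < delta ->
    [locally [bounded x `^ (- delta) * L x | x in `[0, +oo[ ]].

(* a is in F(l), with slowly varying function L and d = lim L(n). *)
Record in_F (R : realType) (l : R) (a : nat -> R) (L : R -> R) (d : \bar R) :
    Prop := InF {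
  F_pos : forall n, (0 < n)%N -> 0 < a n;
  F_slow : slowly_varying L;
  F_diff : differentiable_on_nonneg L;
  F_bounded : locally_bounded_scaled L;
  F_lim_ge0 : (0 <= d)%E;
  F_lim : (L n%:R)%:E @[n --> \oo] --> d;
  F_equiv : a ~_\oo (fun n : nat => n%:R `^ (l - 1) * L n%:R)
}.

(* Main.v *)
Require Import Defs.
From mathcomp Require Import all_boot all_order all_algebra.
From mathcomp Require Import all_classical all_reals all_analysis.
From mathcomp Require Import ring lra zify.

Import Order.TTheory GRing.Theory Num.Theory.
Import numFieldTopology.Exports numFieldNormedType.Exports.

(** The argument is probabilistic.  The number [partition_function a n], written
    c_n here, is the coefficient of index n of exp (sum_j a_j X^j).  So for each
    tilt d the quantity c_n e^(-dn) exp (- sum_j a_j e^(-dj)) is the probability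
    that sum_j j K_j = n, where the K_j are independent Poisson variables with
    means a_j e^(-dj), and [mu] is the law of these variables given that event.
    The parameters enter through their growth a_j = j^(l-1+o(1))
    ([power_growth]), which comes from Potter's bounds for slowly varying
    functions ([slow_potter]), and in the second claim through the limit of
    a_(p(n)).

    The central estimate is [saddle_lower].  If d makes the mean of
    sum_j j K_j equal to n, then d = n^(-1/(l+1)+o(1)) and the conditioning event
    has probability at least exp (- n^s), for every s > 0 and n large.  This crude
    local bound comes from [partition_function_lower].  The recursion
    n c_n = sum_j j a_j c_(n-j) reduces it to hitting a window of length 2M below
    n.  The groups with size in [M, 2M) contribute the position of a random walk
    after a Poisson number of steps.  Such a walk visits every window of length
    2M ([renewal_window]), Chernoff's bound makes it unlikely to do so at a time
    far from the Poisson mean, and for the other times the Poisson weight is at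
    least exp (- n^s) ([poisson_lower]).

    Hence an event of unconditional probability exp (- n^c), with c > 0, is
    negligible under [mu].  This gives the first claim.  The largest group is not
    larger than n^(1/(l+1)+eps) as the mean number of such groups decays in this
    way ([Pr_qbar_high]), and it is not smaller than n^(1/(l+1)-eps) as a
    whole block of sizes would have to be absent ([Pr_qbar_low]).

    By Jensen's inequality the same estimate shows that linear statistics
    sum_j f_j K_j have almost the same mean with and without conditioning
    ([mean_le_cumulant]).  For f_j = 1/a_j on an interval the conditional mean is
    the sum over that interval of c_(n-j)/c_n, which is therefore close to the
    length of the interval ([interval_mean]).  An interval for n - p is an
    interval for n shifted by p, so c_(n-p)/c_n tends to 1 uniformly for
    p <= n^beta, beta < 1/(l+1) ([ratio_limit]).

    Since the factorial moments of K_p are a_p^m c_(n-mp)/c_n, Bonferroni's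
    inequalities give Pr (K_p = 0) -> e^(-b) when a_p tends to b
    ([Pr_count0_cvg]), and Chebyshev's inequality gives the limit 0 when a_p
    tends to infinity ([Pr_count0_cvg0]).  This is the second claim.  For the
    third one, removing the prescribed groups turns the probability into
    an explicit product times c'_(n-q)/c_n, where c' is computed with the sizes
    p_1, ..., p_s forbidden ([Pr_counts]).  Here c'_(n-q)/c'_n tends to 1, and
    c'_n/c_n tends to the product of the e^(-a_p) by forbidding one size at a
    time ([forbid_ratio_cvg]). *)

Set Implicit Arguments.
Unset Strict Implicit.
Unset Printing Implicit Defensive.

Local Open Scope classical_set_scope.
Local Open Scope ring_scope.

(** * Polynomials modulo a power of the variable *)

Definition eqmodX (R : nzRingType) N (p q : {poly R}) :=
  forall i, (i <= N)%N -> p`_i = q`_i.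

Lemma eqmodX_mul (R : nzRingType) N (p p' q q' : {poly R}) :
  eqmodX N p p' -> eqmodX N q q' -> eqmodX N (p * q) (p' * q').
Proof.
move=> hp hq i iN; rewrite !coefM; apply: eq_bigr => j _.
by rewrite hp ?hq //; [apply: leq_trans (leq_subr _ _) _ | apply: leq_trans iN; rewrite -ltnS].
Qed.

Lemma eqmodX_exp (R : nzRingType) N (p q : {poly R}) k :
  eqmodX N p q -> eqmodX N (p ^+ k) (q ^+ k).
Proof.
move=> h; elim: k => [|k IH]; first by rewrite !expr0.
by rewrite !exprS; apply: eqmodX_mul.
Qed.

Lemma coef_mul_low (R : nzRingType) (p q : {poly R}) u v m :
  (forall i, (i < u)%N -> p`_i = 0) -> (forall i, (i < v)%N -> q`_i = 0) ->
  (m < u + v)%N -> (p * q)`_m = 0.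
Proof.
move=> hp hq muv; rewrite coefM big1 // => i _.
have [iu|ui] := ltnP i u; first by rewrite hp // mul0r.
rewrite hq ?mulr0 //; have := ltn_ord i; lia.
Qed.

Lemma coef_exp_low (R : nzRingType) (f : {poly R}) k m :
  f`_0 = 0 -> (m < k)%N -> (f ^+ k)`_m = 0.
Proof.
move=> f0; elim: k m => [//|k IH] m mk.
rewrite exprS (@coef_mul_low _ _ _ 1%N k) //.
by case.
Qed.

(** Cutting the exponential series after [N] terms changes no coefficient of
    index at most [N] when the constant term of [f] vanishes. *)
Definition exp_trunc (R : numFieldType) N (f : {poly R}) : {poly R} :=
  \sum_(k < N.+1) (k`!%:R^-1 : R) *: f ^+ k.

Lemma exp_trunc_stable (R : numFieldType) n N (f g : {poly R}) :
  (n <= N)%N -> f`_0 = 0 -> eqmodX n f g ->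
  eqmodX n (exp_trunc N f) (exp_trunc n g).
Proof.
move=> nN f0 fg i iN; rewrite !coef_sum.
rewrite -(big_mkord xpredT (fun k => (k`!%:R^-1 *: f ^+ k)`_i)).
rewrite -(big_mkord xpredT (fun k => (k`!%:R^-1 *: g ^+ k)`_i)).
rewrite (big_cat_nat (n := n.+1)) //= [X in _ + X]big_nat_cond.
rewrite [X in _ + X]big1 ?addr0 => [|k]; last first.
  rewrite andbT => /andP[nk _]; rewrite coefZ coef_exp_low ?mulr0 //; lia.
by apply: eq_bigr => k _; rewrite !coefZ (eqmodX_exp k fg).
Qed.

Lemma sum_antidiagonal (V : nmodType) (F : nat -> nat -> V) N :
  \sum_(0 <= k < N.+1) \sum_(0 <= j < k.+1) F (k - j)%N j =
  \sum_(0 <= j < N.+1) \sum_(0 <= i < N.+1 - j) F i j.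
Proof.
elim: N => [|N IH]; first by rewrite !big_nat1.
rewrite big_nat_recr //= {}IH [RHS]big_nat_recr //= subSnn.
rewrite [X in _ + X]big_nat_recr //= subnn big_nat1 addrA; congr (_ + _).
rewrite -big_split /=; apply: eq_big_nat => j /andP[_ jN].
have -> : (N.+2 - j = (N.+1 - j).+1)%N by lia.
by rewrite big_nat_recr.
Qed.

(** The products [f ^+ i * g ^+ j] with [i + j > N], which separate the two
    sides, have no coefficient of index at most [N]. *)
Lemma exp_truncD (R : numFieldType) N (f g : {poly R}) :
  f`_0 = 0 -> g`_0 = 0 ->
  eqmodX N (exp_trunc N (f + g)) (exp_trunc N f * exp_trunc N g).
Proof.
move=> f0 g0 m mN.
pose T i j := (i`!%:R^-1 * j`!%:R^-1) *: (f ^+ i * g ^+ j).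
have T0 i j : (m < i + j)%N -> (T i j)`_m = 0.
  move=> mij; rewrite coefZ (@coef_mul_low _ _ _ i j) ?mulr0 //.
  - by move=> k ki; apply: coef_exp_low.
  - by move=> k ki; apply: coef_exp_low.
have -> : exp_trunc N (f + g) =
    \sum_(0 <= j < N.+1) \sum_(0 <= i < N.+1 - j) T i j.
  rewrite -sum_antidiagonal /exp_trunc big_mkord; apply: eq_bigr => k _.
  rewrite exprDn scaler_sumr big_mkord; apply: eq_bigr => j _.
  rewrite /T -[(_ * _) *+ _]scaler_nat scalerA; congr (_ *: _).
  have jk : (j <= k)%N by rewrite -ltnS.
  have := bin_fact jk => /(congr1 (fun x : nat => x%:R : R)).
  rewrite !natrM => <-.
  have fn0 x : (x`!%:R : R) != 0 by rewrite pnatr_eq0 -lt0n fact_gt0.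
  have b0 : ('C(k, j)%:R : R) != 0 by rewrite pnatr_eq0 -lt0n bin_gt0.
  by field; rewrite !fn0 b0.
have -> : exp_trunc N f * exp_trunc N g =
    \sum_(0 <= j < N.+1) \sum_(0 <= i < N.+1) T i j.
  rewrite /exp_trunc mulr_sumr big_mkord; apply: eq_bigr => j _.
  rewrite mulr_suml big_mkord; apply: eq_bigr => i _.
  by rewrite /T -scalerAl -scalerAr scalerA.
rewrite !coef_sum; apply: eq_big_nat => j /andP[_ jN].
rewrite (big_cat_nat (n := (N.+1 - j)%N) (p := N.+1)) ?leq_subr //= coefD !coef_sum.
rewrite [X in _ = _ + X]big_nat_cond [X in _ = _ + X]big1 ?addr0 // => i.
by rewrite andbT => /andP[ij _]; apply: T0; lia.
Qed.

(** * Generating functions of weighted partitions *)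

(** The generating function of the product weights [g i (k_i)]; only its
    coefficients of index at most [N] are meaningful. *)
Definition weight_poly (R : numFieldType) N (g : nat -> nat -> R) : {poly R} :=
  \prod_(1 <= i < N.+1) \sum_(k < N.+1) g i k *: 'X^(i * k).

Lemma K_S n (eta : Omega n) (j : 'I_n) : K j.+1 eta = val eta j.
Proof. by rewrite /K (big_pred1 j). Qed.

Lemma sum_sizes n (eta : Omega n) :
  (\sum_(1 <= i < n.+1) i * K i eta)%N = n.
Proof.
rewrite big_add1 big_mkord; apply: etrans (eqP (valP eta)).
by apply: eq_bigr => i _; rewrite K_S.
Qed.

Lemma sum_Omega (R : numFieldType) n (g : nat -> nat -> R) :
  \sum_(eta : Omega n) \prod_(1 <= i < n.+1) g i (K i eta) =
  (weight_poly n g)`_n.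
Proof.
pose S (f : {ffun 'I_n -> 'I_n.+1}) := (\sum_(i < n) i.+1 * f i)%N.
rewrite /weight_poly big_add1 big_mkord /= bigA_distr_bigA coef_sum /=.
transitivity (\sum_(f : {ffun 'I_n -> 'I_n.+1} | S f == n)
    \prod_(i < n) g i.+1 (f i)).
  rewrite (reindex_omap (val : Omega n -> _) insub) /=; last first.
    by move=> f Sf; rewrite insubT.
  apply: eq_big => [[f Sf] /=|eta _]; first by rewrite Sf insubT /= eqxx.
  by rewrite big_add1 big_mkord; apply: eq_bigr => i _; rewrite K_S.
rewrite big_mkcond; apply: eq_bigr => f _.
have -> : \prod_(i < n) (g i.+1 (f i) *: 'X^(i.+1 * f i)) =
    (\prod_(i < n) g i.+1 (f i)) *: 'X^(S f) :> {poly R}.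
  rewrite scaler_prod; congr (_ *: _).
  by rewrite /S; elim/big_rec2: _ => [|i y1 y2 _ ->]; rewrite ?expr0 // exprD.
by rewrite coefZ coefXn eq_sym; case: eqP; rewrite ?mulr1 ?mulr0.
Qed.

Definition poisson_weight (R : numFieldType) (a : nat -> R) i k : R :=
  a i ^+ k / k`!%:R.

Definition size_gf (R : numFieldType) N (a : nat -> R) : {poly R} :=
  \sum_(1 <= i < N.+1) a i *: 'X^i.

Lemma coef_size_gf (R : numFieldType) N (a : nat -> R) j :
  (size_gf N a)`_j = if (0 < j <= N)%N then a j else 0.
Proof.
rewrite coef_sum.
transitivity (\sum_(1 <= i < N.+1 | i == j) a i).
  rewrite [RHS]big_mkcond; apply: eq_bigr => i _.
  by rewrite coefZ coefXn eq_sym; case: eqP; rewrite ?mulr1 ?mulr0.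
by rewrite big_nat1_eq ltnS.
Qed.

Lemma horner_size_gf (R : numFieldType) N (a : nat -> R) x :
  (size_gf N a).[x] = \sum_(1 <= i < N.+1) a i * x ^+ i.
Proof. by rewrite horner_sum; apply: eq_bigr => i _; rewrite hornerZ hornerXn. Qed.

Lemma weight_poly_exp (R : numFieldType) N (a : nat -> R) :
  eqmodX N (weight_poly N (poisson_weight a)) (exp_trunc N (size_gf N a)).
Proof.
suff H n : eqmodX N
    (\prod_(1 <= i < n.+1) \sum_(k < N.+1) poisson_weight a i k *: 'X^(i * k))
    (exp_trunc N (size_gf n a)) by exact: H.
rewrite /size_gf; elim: n => [|n IH].
  rewrite !big_geq //; move=> i iN; rewrite /exp_trunc big_ord_recl expr0.
  rewrite fact0 invr1 scale1r big1 ?addr0 // => k _.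
  by rewrite expr0n scaler0.
have nz m : (\sum_(1 <= i < m.+1) a i *: 'X^i)`_0 = 0 :> R.
  by rewrite (coef_size_gf m a 0).
rewrite big_nat_recr //= [X in exp_trunc _ X]big_nat_recr //=.
move=> i iN; rewrite exp_truncD //; last by rewrite coefZ coefXn mulr0.
apply: eqmodX_mul iN => // j _; congr (nth 0 (polyseq _) j); apply: eq_bigr => k _.
by rewrite exprZn scalerA -exprM /poisson_weight mulrC.
Qed.

Lemma partition_function_exp (R : realType) (a : nat -> R) n N : (n <= N)%N ->
  partition_function a n = (exp_trunc N (size_gf N a))`_n.
Proof.
move=> nN; rewrite /partition_function /weight (sum_Omega n (poisson_weight a)).
rewrite weight_poly_exp //; apply/esym/exp_trunc_stable => //.
  by rewrite coef_size_gf.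
move=> i iN; rewrite !coef_size_gf iN (leq_trans iN nN) //.
Qed.

Lemma weight_poly_partition_function (R : realType) (a : nat -> R) n N :
  (n <= N)%N -> (weight_poly N (poisson_weight a))`_n = partition_function a n.
Proof. by move=> nN; rewrite weight_poly_exp // -partition_function_exp. Qed.

(** Removing [m] groups of size [p] is multiplication by ['X^(p * m)] on
    generating functions. *)
Lemma weight_poly_shift (R : numFieldType) N (g g' : nat -> nat -> R) p m c n :
  (0 < p <= N)%N -> (n <= N)%N ->
  (forall i k, i != p -> g' i k = g i k) ->
  (forall k, g' p k = if (k < m)%N then 0 else c * g p (k - m)%N) ->
  (weight_poly N g')`_n =
  if (n < p * m)%N then 0 else c * (weight_poly N g)`_(n - p * m).
Proof.
move=> /andP[p0 pN] nN hg hp.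
have pin : p \in index_iota 1 N.+1 by rewrite mem_index_iota p0 ltnS.
rewrite /weight_poly !(bigD1_seq p) ?iota_uniq //=.
set G := \sum_(k < N.+1) g p k *: _; set G' := \sum_(k < N.+1) g' p k *: _.
set P' := \prod_(_ <- _ | _) _; set P := \prod_(_ <- _ | _) _.
have -> : P' = P.
  by apply: eq_bigr => i ip; apply: eq_bigr => k _; rewrite hg.
have GG : eqmodX N G' ((c *: G) * 'X^(p * m)).
  move=> i iN; rewrite coefMXn coefZ !coef_sum.
  transitivity (\sum_(0 <= k < N.+1 | (p * k == i)%N) g' p k).
    rewrite [RHS]big_mkcond big_mkord; apply: eq_bigr => k _.
    by rewrite coefZ coefXn eq_sym; case: eqP; rewrite ?mulr1 ?mulr0.
  have -> : \sum_(k < N.+1) (g p k *: 'X^(p * k))`_(i - p * m) =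
      \sum_(0 <= k < N.+1 | (p * k == i - p * m)%N) g p k.
    rewrite [RHS]big_mkcond big_mkord; apply: eq_bigr => k _.
    by rewrite coefZ coefXn eq_sym; case: eqP; rewrite ?mulr1 ?mulr0.
  have [ipm|pmi] := ltnP i (p * m).
    rewrite big1 // => k /eqP ki; rewrite hp ifT //.
    by rewrite -(ltn_pmul2l p0) ki.
  have [/dvdnP[q iq]|ndv] := boolP (p %| i)%N; last first.
    rewrite big_pred0 => [|k]; last first.
      by apply: contraNF ndv => /eqP <-; apply: dvdn_mulr.
    rewrite big_pred0 ?mulr0 // => k.
    apply: contraNF ndv => /eqP e; rewrite -(subnK pmi) -e.
    by rewrite dvdn_add // dvdn_mulr.
  have mq : (m <= q)%N by rewrite -(leq_pmul2l p0) (mulnC p q) -iq.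
  have qN : (q <= N)%N by apply: leq_trans iN; rewrite iq leq_pmulr.
  have E1 k : (p * k == i)%N = (k == q) by rewrite iq mulnC eqn_pmul2r.
  have E2 k : (p * k == i - p * m)%N = (k == q - m)%N.
    by rewrite iq (mulnC p m) -mulnBl mulnC eqn_pmul2r.
  rewrite (eq_bigl _ _ E1) (eq_bigl _ _ E2) !big_nat1_eq /= !ltnS qN.
  by rewrite (leq_trans (leq_subr _ _) qN) hp ltnNge mq.
rewrite (eqmodX_mul GG (fun i _ => erefl P`_i)) //.
by rewrite -mulrA [_ * P]mulrC mulrA coefMXn -scalerAl coefZ.
Qed.
(** * Moments of the group counts *)

Lemma weight_ge0 (R : realType) (a : nat -> R) n (eta : Omega n) :
  (forall i, 0 <= a i) -> 0 <= weight a eta.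
Proof.
move=> a0; apply: prodr_ge0 => i _.
by rewrite divr_ge0 ?exprn_ge0 ?ler0n.
Qed.

Lemma partition_function_ge0 (R : realType) (a : nat -> R) n :
  (forall i, 0 <= a i) -> 0 <= partition_function a n.
Proof. by move=> a0; apply: sumr_ge0 => eta _; apply: weight_ge0. Qed.

(** Choosing [m] groups of size [p] and removing them:
    ['C(k, m) * (x ^ k / k!) = (x ^ m / m!) * (x ^ (k - m) / (k - m)!)]. *)
Lemma factorial_moment (R : realType) (a : nat -> R) n p m :
  (0 < p <= n)%N ->
  \sum_(eta : Omega n) 'C(K p eta, m)%:R * weight a eta =
  if (n < p * m)%N then 0
  else a p ^+ m / m`!%:R * partition_function a (n - p * m).
Proof.
move=> /andP[p0 pn].
pose g i k := if i == p then 'C(k, m)%:R * poisson_weight a i k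
              else poisson_weight a i k.
transitivity (\sum_(eta : Omega n) \prod_(1 <= i < n.+1) g i (K i eta)).
  apply: eq_bigr => eta _; rewrite /weight.
  have pin : p \in index_iota 1 n.+1 by rewrite mem_index_iota p0 ltnS.
  rewrite !(bigD1_seq p) ?iota_uniq //= mulrA {1}/g eqxx; congr (_ * _).
  by apply: eq_bigr => i /negbTE ip; rewrite /g ip.
rewrite sum_Omega.
rewrite (@weight_poly_shift _ n (poisson_weight a) g p m (a p ^+ m / m`!%:R)) ?p0 //.
- by case: ltnP => // pmn; rewrite weight_poly_partition_function ?leq_subr.
- by move=> i k /negbTE ip; rewrite /g ip.
move=> k; rewrite /g eqxx; case: ltnP => [km|mk]; first by rewrite bin_small ?mul0r.
have fn0 x : (x`!%:R : R) != 0 by rewrite pnatr_eq0 -lt0n fact_gt0.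
have := bin_fact mk => /(congr1 (fun x : nat => x%:R : R)); rewrite !natrM => e.
rewrite /poisson_weight -e.
have -> : a p ^+ k = a p ^+ m * a p ^+ (k - m) by rewrite -exprD subnKC.
have b0 : ('C(k, m)%:R : R) != 0 by rewrite pnatr_eq0 -lt0n bin_gt0.
by field; rewrite !fn0 b0.
Qed.

Lemma mean_count (R : realType) (a : nat -> R) n p : (0 < p <= n)%N ->
  \sum_(eta : Omega n) (K p eta)%:R * weight a eta =
  a p * partition_function a (n - p).
Proof.
move=> pn; have /andP[_ pn'] := pn.
have := factorial_moment a 1 pn; rewrite muln1 ltnNge pn' /=.
rewrite expr1 (_ : 1`! = 1%N) // divr1 => <-; apply: eq_bigr => eta _; by rewrite bin1.
Qed.

(** Both sides are the mean of the sum of all sizes, which is [n]. *)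
Lemma partition_function_rec (R : realType) (a : nat -> R) n :
  n%:R * partition_function a n =
  \sum_(1 <= j < n.+1) j%:R * a j * partition_function a (n - j).
Proof.
rewrite mulr_sumr.
transitivity (\sum_(eta : Omega n) \sum_(1 <= j < n.+1)
    j%:R * ((K j eta)%:R * weight a eta)).
  apply: eq_bigr => eta _; rewrite -{1}(sum_sizes eta) natr_sum mulr_suml.
  by apply: eq_bigr => j _; rewrite natrM mulrA.
rewrite exchange_big /=; apply: eq_big_nat => j /andP[j0 jn].
by rewrite -mulr_sumr mean_count ?j0 // mulrA.
Qed.

(** * Exponential bounds and random walks *)

Definition nneg_poly (R : numDomainType) (p : {poly R}) := forall i, 0 <= p`_i.

Lemma nneg_polyM (R : numDomainType) (p q : {poly R}) :
  nneg_poly p -> nneg_poly q -> nneg_poly (p * q).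
Proof. by move=> hp hq i; rewrite coefM sumr_ge0 // => j _; rewrite mulr_ge0. Qed.

Lemma nneg_polyX (R : numDomainType) (p : {poly R}) k :
  nneg_poly p -> nneg_poly (p ^+ k).
Proof.
move=> hp; elim: k => [|k IH]; last by rewrite exprS; apply: nneg_polyM.
by move=> i; rewrite expr0 coef1 ler0n.
Qed.

Lemma nneg_size_gf (R : numFieldType) N (a : nat -> R) :
  (forall i, 0 <= a i) -> nneg_poly (size_gf N a).
Proof. by move=> a0 i; rewrite coef_size_gf; case: ifP. Qed.

Lemma nneg_exp_trunc (R : numFieldType) N (f : {poly R}) :
  nneg_poly f -> nneg_poly (exp_trunc N f).
Proof.
move=> hf i; rewrite coef_sum sumr_ge0 // => k _.
by rewrite coefZ mulr_ge0 ?invr_ge0 ?ler0n //; apply: nneg_polyX.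
Qed.

Lemma horner_nneg (R : numDomainType) (p : {poly R}) x :
  nneg_poly p -> 0 <= x -> 0 <= p.[x].
Proof.
by move=> hp x0; rewrite horner_coef sumr_ge0 // => i _; rewrite mulr_ge0 ?exprn_ge0.
Qed.

(** Markov's inequality for the measure with mass [p`_i] at [i]: the
    function [c * (P i)] lies below [x ^+ i]. *)
Lemma chernoff_poly (R : numDomainType) (p : {poly R}) x c N (P : pred nat) :
  nneg_poly p -> 0 <= x -> (forall i, (i < N)%N -> P i -> c <= x ^+ i) ->
  c * \sum_(0 <= i < N | P i) p`_i <= p.[x].
Proof.
move=> hp x0 hc; pose S := maxn N (size p).
rewrite (@horner_coef_wide _ S) ?leq_maxr // -(big_mkord xpredT (fun i => p`_i * x ^+ i)).
rewrite [leRHS](big_cat_nat (n := N)) ?leq_maxl //= -[leLHS]addr0 lerD //; last first.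
  by apply: sumr_ge0 => i _; rewrite mulr_ge0 ?exprn_ge0.
rewrite mulr_sumr big_mkcond; apply: ler_sum_nat => i /andP[_ iN].
case: ifP => [Pi|_]; last by rewrite mulr_ge0 ?exprn_ge0.
by rewrite mulrC ler_wpM2l ?hc.
Qed.

Lemma horner_exp_trunc (R : realType) N (f : {poly R}) x :
  (exp_trunc N f).[x] = series (exp_coeff f.[x]) N.+1.
Proof.
rewrite /exp_trunc /series /= horner_sum big_mkord; apply: eq_bigr => k _.
by rewrite hornerZ horner_exp /exp_coeff /= mulrC.
Qed.

Lemma exp_trunc_le (R : realType) N (f : {poly R}) x :
  0 <= f.[x] -> (exp_trunc N f).[x] <= expR f.[x].
Proof.
move=> f0; rewrite horner_exp_trunc; apply: nondecreasing_cvgn_le.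
  by apply/nondecreasing_series => i _ _; apply: exp_coeff_ge0.
exact: is_cvg_series_exp_coeff.
Qed.

Lemma exp_trunc_ge (R : realType) (f : {poly R}) x c n : c < expR f.[x] ->
  exists2 N, (n <= N)%N & c <= (exp_trunc N f).[x].
Proof.
move=> hc.
have : series (exp_coeff f.[x]) m @[m --> \oo] --> expR f.[x].
  exact: is_cvg_series_exp_coeff.
move=> /(cvgr_gt _)/(_ _ hc) [N _ hN]; exists (maxn n N); first exact: leq_maxl.
by rewrite horner_exp_trunc ltW //; apply: hN => /=; rewrite leqW // leq_maxr.
Qed.

(** The coefficient of index [y] of [\sum_k w ^+ k] is the expected number of
    visits to [y] of a random walk with step law [w].  A walk with steps of
    length at most [l] cannot jump over a window of length [l], hence the lower
    bound 1.  In the proof [T x] decomposes the certain event according to the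
    last position that is at most [x]. *)
Lemma renewal_window (R : realFieldType) (w : {poly R}) n l x :
  nneg_poly w -> w`_0 = 0 -> w.[1] = 1 -> (forall j, (l < j)%N -> w`_j = 0) ->
  (x <= n)%N ->
  1 <= \sum_(0 <= y < x.+1 | (x < y + l)%N) (\sum_(k < n.+1) w ^+ k)`_y.
Proof.
move=> w_ge0 w0 w1 wl xn.
set V := \sum_(k < n.+1) w ^+ k.
pose W t := \sum_(t.+1 <= j < l.+1) w`_j.
pose T x := \sum_(0 <= y < x.+1) V`_y * W (x - y)%N.
have sumw : \sum_(1 <= j < l.+1) w`_j = 1.
  have sw : (size w <= l.+1)%N by apply/leq_sizeP => j; apply: wl.
  rewrite -w1 (horner_coef_wide _ sw) -(big_mkord xpredT (fun i => w`_i * 1 ^+ i)).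
  rewrite big_ltn // w0 mul0r add0r; apply: eq_bigr => j _; by rewrite expr1n mulr1.
have W_ge0 t : 0 <= W t by apply: sumr_ge0.
have W_le1 t : W t <= 1.
  rewrite -sumw; case: (leqP t l) => tl; last by rewrite /W big_geq ?sumr_ge0 // ltnW.
  by rewrite (big_cat_nat (n := t.+1) (m := 1)) //= lerDr sumr_ge0.
have W_S t : W t.+1 = W t - w`_t.+1.
  rewrite /W; case: (ltnP t l) => tl; last by rewrite !big_geq ?wl ?subrr // ltnW.
  by rewrite [in RHS]big_ltn // addrC addKr.
have V_ge0 y : 0 <= V`_y by rewrite coef_sum sumr_ge0 // => k _; apply: nneg_polyX.
have V0 : V`_0 = 1.
  rewrite coef_sum big_ord_recl expr0 coef1 eqxx big1 ?addr0 // => k _.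
  by rewrite coef_exp_low.
have V_rec y : (y < n)%N -> V`_y.+1 = \sum_(0 <= i < y.+1) V`_i * w`_(y.+1 - i).
  move=> yn.
  have e : V * w = V + w ^+ n.+1 - 1.
    rewrite {1}/V mulr_suml [X in X + _ - 1]big_ord_recl expr0.
    rewrite [LHS]big_ord_recr /= -exprSr [1 + _]addrC addrAC addrK.
    by congr (_ + _); apply: eq_bigr => i _; rewrite -exprSr.
  have := congr1 (fun q : {poly R} => q`_y.+1) e.
  rewrite coefB coefD coef_exp_low ?addr0 ?ltnS // coef1 subr0 => <-.
  rewrite coefM -(big_mkord xpredT (fun j => V`_j * w`_(y.+1 - j))).
  by rewrite big_nat_recr //= subnn w0 mulr0 addr0.
have T1 : forall y, (y <= n)%N -> T y = 1.
  elim=> [|y IH] yn; first by rewrite /T big_nat1 V0 mul1r /W sumw.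
  rewrite /T big_nat_recr //= subnn {2}/W sumw mulr1 V_rec //.
  rewrite -big_split /= -(IH (ltnW yn)); apply: eq_big_nat => i /andP[_ iy].
  by rewrite subSn // W_S -mulrDr subrK.
rewrite -(T1 x xn) /T [leRHS]big_mkcond; apply: ler_sum_nat => y /andP[_ yx].
case: ltnP => h; first by rewrite ler_piMr.
by rewrite /W big_geq ?mulr0 //; lia.
Qed.
Lemma expRN_le_quad (R : realType) (x : R) : 0 <= x ->
  expR (- x) <= 1 - x + x ^+ 2.
Proof.
move=> x0; rewrite expRN -[leLHS]mul1r ler_pdivrMr ?expR_gt0 //.
apply: (@le_trans _ _ ((1 - x + x ^+ 2) * (1 + x))); last first.
  by rewrite ler_wpM2l ?expR_ge1Dx //; nra.
have : 0 <= x ^+ 3 by rewrite exprn_ge0.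
by nra.
Qed.

Lemma expR_le_quad (R : realType) (x : R) : 0 <= x ->
  expR x <= 1 + x + x ^+ 2 * expR x.
Proof.
move=> x0; have : expR x * (1 - x) <= 1.
  by rewrite -[leRHS](expRxMexpNx_1 x) ler_wpM2l ?expR_ge0 // expR_ge1Dx.
by move: (expR x) => e h; nra.
Qed.

(** Second order bounds on the logarithmic moment generating function of the
    compound Poisson law with exponent [size_gf n b], at [- t] and at [t]. *)
Lemma size_gf_expRN (R : realType) (b : nat -> R) n (t v : R) :
  (forall j, 0 <= b j) -> 0 <= t ->
  \sum_(1 <= j < n.+1) j%:R * b j = v ->
  t ^+ 2 * (\sum_(1 <= j < n.+1) j%:R ^+ 2 * b j * expR (t * j%:R)) <= 1 ->
  (size_gf n b).[expR (- t)] <= (size_gf n b).[1] - t * v + 1.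
Proof.
move=> b0 t0 <- hB; apply: (le_trans _ (lerD (lexx _) hB)).
rewrite !horner_size_gf !mulr_sumr -sumrB -big_split /=; apply: ler_sum => j _.
rewrite expr1n mulr1 -expRM_natr mulNr.
have tj : 0 <= t * j%:R by rewrite mulr_ge0.
have := expRN_le_quad tj => /(ler_wpM2l (b0 j)) /le_trans; apply.
rewrite (_ : b j * _ = b j - t * (j%:R * b j) + t ^+ 2 * (j%:R ^+ 2 * b j)); last by ring.
rewrite lerD2l ler_wpM2l ?exprn_ge0 // ler_peMr ?mulr_ge0 ?exprn_ge0 //.
by rewrite -[leLHS](expR0 R) ler_expR.
Qed.

Lemma size_gf_expR (R : realType) (b : nat -> R) n (t v : R) :
  (forall j, 0 <= b j) -> 0 <= t ->
  \sum_(1 <= j < n.+1) j%:R * b j = v ->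
  t ^+ 2 * (\sum_(1 <= j < n.+1) j%:R ^+ 2 * b j * expR (t * j%:R)) <= 1 ->
  (size_gf n b).[expR t] <= (size_gf n b).[1] + t * v + 1.
Proof.
move=> b0 t0 <- hB; apply: (le_trans _ (lerD (lexx _) hB)).
rewrite !horner_size_gf !mulr_sumr -!big_split /=; apply: ler_sum => j _.
rewrite expr1n mulr1 -expRM_natr.
have tj : 0 <= t * j%:R by rewrite mulr_ge0.
have := expR_le_quad tj => /(ler_wpM2l (b0 j)) /le_trans; apply.
by rewrite le_eqVlt; apply/orP; left; apply/eqP; ring.
Qed.
(** A walk whose starting point is at most [m], with unnormalized law [H],
    visits the window of length [l] that ends at [m]. *)
Lemma window_conv (R : realFieldType) (V H : {poly R}) m l :
  nneg_poly H ->
  (forall x, (x <= m)%N -> 1 <= \sum_(0 <= y < x.+1 | (x < y + l)%N) V`_y) ->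
  \sum_(0 <= z < m.+1) H`_z <= \sum_(0 <= i < m.+1 | (m < i + l)%N) (V * H)`_i.
Proof.
move=> H_nn hV.
have -> : \sum_(0 <= i < m.+1 | (m < i + l)%N) (V * H)`_i =
    \sum_(0 <= i < m.+1 | (m < i + l)%N) \sum_(0 <= z < m.+1 | (z <= i)%N) H`_z * V`_(i - z).
  rewrite big_nat_cond [RHS]big_nat_cond; apply: eq_bigr => i /andP[/andP[_ im] _].
  rewrite mulrC coefM -(big_mkord xpredT (fun z => H`_z * V`_(i - z))).
  by rewrite (big_nat_widen _ _ m.+1) //; apply: eq_bigl => z; rewrite ltnS.
rewrite (exchange_big_dep_nat xpredT) //=; apply: ler_sum_nat => z /andP[_ zm].
rewrite -mulr_sumr -[leLHS]mulr1 ler_wpM2l //; apply: le_trans (hV _ (leq_subr z m)) _.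
rewrite (_ : \sum_(0 <= i < m.+1 | _) _ =
  \sum_(0 + z <= i < m.+1 | (m < i + l)%N) V`_(i - z)); last first.
  by rewrite add0n [RHS](big_nat_widenl _ 0).
rewrite big_addn subSn // le_eqVlt; apply/orP; left; apply/eqP.
by apply: eq_big => y; rewrite ?addnK //; lia.
Qed.

(** The window is hit with probability at least [omega / 2].  Split the
    exponent into the part [g] of the sizes in [[M, 2M)] and the rest [h].  In
    [exp (g + h) = \sum_k (g ^+ k / k!) * exp h] each term with [k] within [Q] of
    the mean [A] dominates [omega * expR A] times [(g / A) ^+ k * exp h].
    Without the weights [omega] the sum over all [k] is handled by the renewal
    bound, and Chernoff's bound at [t] and [- t] shows that the terms with [k]
    far from [A] contribute little to the window. *)
Lemma window_lower (R : realType) (b : nat -> R) n M (t Q omega : R) :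
  let A := \sum_(1 <= j < n.+1 | (M <= j < M.*2)%N) b j in
  let S := \sum_(1 <= j < n.+1) b j in
  (forall j, 0 <= b j) -> (0 < M)%N -> (4 * M <= n)%N ->
  0 <= t -> t * M%:R <= 2^-1 ->
  \sum_(1 <= j < n.+1) j%:R * b j = n%:R ->
  t ^+ 2 * (\sum_(1 <= j < n.+1) j%:R ^+ 2 * b j * expR (t * j%:R)) <= 1 ->
  0 < A -> 0 <= Q <= A -> n.+2%:R * expR (3 - Q * (t * M%:R) / 2) <= 4^-1 ->
  0 <= omega ->
  (forall k, (k <= n)%N -> `|k%:R - A| <= Q -> omega <= expR (- A) * (A ^+ k / k`!%:R)) ->
  omega * expR S / 2 <=
    \sum_(0 <= i < (n - 2 * M).+1 | (n - 4 * M < i)%N) partition_function b i.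
Proof.
move=> A S b0 M0 Mn t0 tM mean var A0 /andP[Q0 QA] small om0 hom.
have Mn2 : (2 * M <= n)%N by apply: leq_trans Mn; rewrite leq_mul2r orbT.
have winE i : (n - 2 * M < i + 2 * M)%N = (n - 4 * M < i)%N by lia.
pose J j := (M <= j < M.*2)%N.
have JM j : (2 * M < j)%N -> J j = false.
  by rewrite /J mul2n => jM; rewrite [(j < _)%N]ltnNge (ltnW jM) andbF.
pose g := size_gf n (fun j => if J j then b j else 0).
pose h := size_gf n (fun j => if J j then 0 else b j).
pose f := size_gf n b.
have fgh : f = g + h.
  apply/polyP => i; rewrite coefD !coef_size_gf.
  by case: ifP; rewrite ?addr0 //; case: ifP; rewrite ?addr0 ?add0r.
have g_nn : nneg_poly g by apply: nneg_size_gf => i; case: ifP.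
have h_nn : nneg_poly h by apply: nneg_size_gf => i; case: ifP.
have g0 : g`_0 = 0 by rewrite coef_size_gf.
have h0 : h`_0 = 0 by rewrite coef_size_gf.
have hornerg x : g.[x] = \sum_(1 <= j < n.+1 | J j) b j * x ^+ j.
  rewrite horner_size_gf [RHS]big_mkcond; apply: eq_bigr => j _.
  by case: ifP; rewrite ?mul0r.
have g1 : g.[1] = A.
  by rewrite hornerg; apply: eq_bigr => j _; rewrite expr1n mulr1.
have f1 : f.[1] = S.
  by rewrite horner_size_gf; apply: eq_bigr => j _; rewrite expr1n mulr1.
have h1 : h.[1] = S - A by rewrite -f1 -g1 fgh hornerD addrAC subrr add0r.
pose w := A^-1 *: g.
have w_nn : nneg_poly w by move=> i; rewrite coefZ mulr_ge0 ?invr_ge0 // ltW.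
have w0 : w`_0 = 0 by rewrite coefZ g0 mulr0.
have w1 : w.[1] = 1 by rewrite hornerZ g1 mulVf // gt_eqF.
have hornerw x : g.[x] = A * w.[x] by rewrite hornerZ mulrA mulfV ?mul1r // gt_eqF.
have wl j : (2 * M < j)%N -> w`_j = 0.
  by move=> jM; rewrite coefZ coef_size_gf JM // if_same mulr0.
have tM0 : 0 <= t * M%:R by rewrite mulr_ge0.
have wN : w.[expR (- t)] <= 1 - t * M%:R / 2.
  rewrite -(ler_pM2l A0) -hornerw hornerg /A mulr_suml.
  apply: ler_sum => j /andP[Mj _]; rewrite ler_wpM2l // -expRM_natr.
  apply: (@le_trans _ _ (expR (- (t * M%:R)))).
    by rewrite ler_expR mulNr lerN2 ler_wpM2l // ler_nat.
  by apply: le_trans (expRN_le_quad tM0) _; nra.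
have wP : 1 + t * M%:R <= w.[expR t].
  rewrite -(ler_pM2l A0) -hornerw hornerg /A mulr_suml.
  apply: ler_sum => j /andP[Mj _]; rewrite ler_wpM2l // -expRM_natr.
  apply: le_trans (expR_ge1Dx _) _.
  by rewrite ler_expR ler_wpM2l // ler_nat.
(* The terms above [n] of the exponential of [h] do not affect the window, but
   they make its total mass close to [expR h.[1]]. *)
have [N nN H78] : exists2 N, (n <= N)%N &
    7 / 8 * expR h.[1] <= (exp_trunc N h).[1].
  by apply: exp_trunc_ge; have := expR_gt0 h.[1]; lra.
pose H := exp_trunc N h.
have H_nn : nneg_poly H by apply: nneg_exp_trunc.
have HE x : 0 <= x -> H.[x] <= expR h.[x].
  by move=> x0; apply: exp_trunc_le; apply: horner_nneg.
pose B := expR h.[1] * expR (3 - Q * (t * M%:R) / 2).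
have QtM : 0 <= Q * (t * M%:R) by rewrite mulr_ge0.
have fN := size_gf_expRN b0 t0 mean var; rewrite -/f f1 in fN.
have fP := size_gf_expR b0 t0 mean var; rewrite -/f f1 in fP.
have fghx x : f.[x] = g.[x] + h.[x] by rewrite fgh hornerD.
pose I (p : {poly R}) := \sum_(0 <= i < (n - 2 * M).+1 | (n - 4 * M < i)%N) p`_i.
have n4M : ((n - 4 * M)%:R : R) = n%:R - 4 * M%:R.
  by rewrite natrB // natrM.
have n2M : ((n - 2 * M)%:R : R) = n%:R - 2 * M%:R.
  by rewrite natrB // natrM.
have wk x k : 0 <= x -> w.[x] ^+ k <= expR (k%:R * (w.[x] - 1)).
  move=> x0; rewrite expRM_natl; apply: lerXn2r.
  - by rewrite nnegrE horner_nneg.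
  - by rewrite nnegrE expR_ge0.
  - by have := expR_ge1Dx (w.[x] - 1); rewrite addrC subrK.
(* Numbers of steps that are too large need a sum that is too small. *)
have bad_up k : A + Q < k%:R -> I (w ^+ k * H) <= B.
  move=> hk; have p_nn : nneg_poly (w ^+ k * H).
    by apply: nneg_polyM => //; apply: nneg_polyX.
  have hc i : (i < (n - 2 * M).+1)%N -> (n - 4 * M < i)%N ->
      expR (- t * n%:R) <= expR (- t) ^+ i.
    rewrite ltnS => iN _; rewrite -expRM_natr ler_expR !mulNr lerN2.
    by rewrite ler_wpM2l // ler_nat (leq_trans iN) ?leq_subr.
  have := chernoff_poly p_nn (expR_ge0 (- t)) hc.
  rewrite hornerM horner_exp => le1.
  rewrite -(ler_pM2l (expR_gt0 (- t * n%:R))); apply: le_trans le1 _.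
  apply: (@le_trans _ _ (expR (k%:R * (w.[expR (- t)] - 1)) * expR h.[expR (- t)])).
    by apply: ler_pM; rewrite ?exprn_ge0 ?horner_nneg ?expR_ge0 ?wk ?HE ?expR_ge0.
  rewrite /B -!expRD ler_expR h1.
  have := fghx (expR (- t)); rewrite hornerw => e.
  have : k%:R * (w.[expR (- t)] - 1) <= (A + Q) * (w.[expR (- t)] - 1).
    by rewrite ler_wnM2r ?(ltW hk) // subr_le0; move: wN tM0; lra.
  have : Q * (w.[expR (- t)] - 1) <= Q * (- (t * M%:R / 2)).
    by rewrite ler_wpM2l //; move: wN; lra.
  move: e fN; move: (w.[_]) (h.[_]) (f.[_]) (t * M%:R) => W X F tM'; lra.
(* Here only the lower end [n - 4 * M] of the window matters. *)
have bad_down k : k%:R < A - Q -> I (w ^+ k * H) <= B.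
  move=> hk; have p_nn : nneg_poly (w ^+ k * H).
    by apply: nneg_polyM => //; apply: nneg_polyX.
  have hc i : (i < (n - 2 * M).+1)%N -> (n - 4 * M < i)%N ->
      expR (t * (n - 4 * M)%:R) <= expR t ^+ i.
    by move=> _ iN; rewrite -expRM_natr ler_expR ler_wpM2l // ler_nat ltnW.
  have := chernoff_poly p_nn (expR_ge0 t) hc.
  rewrite hornerM horner_exp => le1.
  rewrite -(ler_pM2l (expR_gt0 (t * (n - 4 * M)%:R))); apply: le_trans le1 _.
  apply: (@le_trans _ _ (expR (k%:R * (w.[expR t] - 1)) * expR h.[expR t])).
    by apply: ler_pM; rewrite ?exprn_ge0 ?horner_nneg ?expR_ge0 ?wk ?HE ?expR_ge0.
  rewrite /B -!expRD ler_expR h1 n4M.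
  have := fghx (expR t); rewrite hornerw => e.
  have : k%:R * (w.[expR t] - 1) <= (A - Q) * (w.[expR t] - 1).
    by rewrite ler_wpM2r ?(ltW hk) // subr_ge0; move: wP tM0; lra.
  have : Q * (t * M%:R) <= Q * (w.[expR t] - 1).
    by rewrite ler_wpM2l //; move: wP; lra.
  rewrite (_ : t * (n%:R - 4 * M%:R) = t * n%:R - 4 * (t * M%:R)); last by ring.
  move: e fP tM QtM; move: (w.[_]) (h.[_]) (f.[_]) (t * M%:R).
  by move=> W X F tM'; lra.
(* No step at all: the case [k = 0] of the previous bound, up to the end of
   the window. *)
have tail : 7 / 8 * expR h.[1] - B <= \sum_(0 <= z < (n - 2 * M).+1) H`_z.
  pose m := maxn (size H) (n - 2 * M).+1.
  have : H.[1] = \sum_(0 <= z < (n - 2 * M).+1) H`_z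
      + \sum_(0 <= z < m | (n - 2 * M < z)%N) H`_z.
    rewrite (@horner_coef_wide _ m) ?leq_maxl //.
    rewrite -(big_mkord xpredT (fun i => H`_i * 1 ^+ i)).
    rewrite (big_cat_nat (n := (n - 2 * M).+1)) ?leq_maxr //=.
    congr (_ + _); first by apply: eq_bigr => i _; rewrite expr1n mulr1.
    rewrite (big_nat_widenl _ 0) //=; apply: eq_bigr => i _; by rewrite expr1n mulr1.
  have hc i : (i < m)%N -> (n - 2 * M < i)%N ->
      expR (t * (n - 2 * M)%:R) <= expR t ^+ i.
    by move=> _ iN; rewrite -expRM_natr ler_expR ler_wpM2l // ler_nat ltnW.
  have := chernoff_poly H_nn (expR_ge0 t) hc; rewrite mulrC => le1.
  suff : \sum_(0 <= z < m | (n - 2 * M < z)%N) H`_z <= B.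
    by move: H78; rewrite -/H; lra.
  rewrite -(ler_pM2r (expR_gt0 (t * (n - 2 * M)%:R))); apply: le_trans le1 _.
  apply: le_trans (HE _ (expR_ge0 _)) _.
  rewrite /B -!expRD ler_expR h1 n2M.
  have := fghx (expR t); rewrite hornerw => e.
  have : A * (t * M%:R) <= A * (w.[expR t] - 1).
    by rewrite ler_wpM2l ?(ltW A0) //; move: wP; lra.
  have : Q * (t * M%:R) <= A * (t * M%:R) by rewrite ler_wpM2r.
  rewrite (_ : t * (n%:R - 2 * M%:R) = t * n%:R - 2 * (t * M%:R)); last by ring.
  move: e fP tM QtM; move: (w.[_]) (h.[_]) (f.[_]) (t * M%:R).
  by move=> W X F tM'; lra.
pose V := \sum_(k < n.+1) w ^+ k.
have window : \sum_(0 <= z < (n - 2 * M).+1) H`_z <= I (V * H).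
  have := @window_conv _ V H (n - 2 * M) (2 * M) H_nn.
  rewrite (eq_bigl _ _ winE).
  by apply => x xn; apply: renewal_window => //; apply: leq_trans xn (leq_subr _ _).
have I_ge0 p : nneg_poly p -> 0 <= I p by move=> hp; apply: sumr_ge0.
have IZ c p : I (c *: p) = c * I p.
  by rewrite /I mulr_sumr; apply: eq_bigr => i _; rewrite coefZ.
have good k : (k <= n)%N -> `|k%:R - A| <= Q ->
    omega * expR A * I (w ^+ k * H) <= I ((k`!%:R^-1 *: g ^+ k) * H).
  move=> kn kA; have -> : w ^+ k * H = A^-1 ^+ k *: (g ^+ k * H) by rewrite exprZn -scalerAl.
  rewrite -[X in _ <= I X]scalerAl !IZ mulrA ler_wpM2r //.
    by apply: I_ge0; apply: nneg_polyM => //; apply: nneg_polyX.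
  rewrite exprVn ler_pdivrMr ?exprn_gt0 // -(ler_pM2r (expR_gt0 (- A))).
  rewrite -mulrA expRxMexpNx_1 mulr1; apply: le_trans (hom k kn kA) _.
  by rewrite le_eqVlt; apply/orP; left; apply/eqP; ring.
have total : \sum_(k < n.+1) I ((k`!%:R^-1 *: g ^+ k) * H) =
    \sum_(0 <= i < (n - 2 * M).+1 | (n - 4 * M < i)%N) partition_function b i.
  rewrite /I exchange_big big_nat_cond [RHS]big_nat_cond; apply: eq_bigr => i.
  move=> /andP[/andP[_ iM] _]; have iN : (i <= n)%N.
    by apply: leq_trans (leq_subr (2 * M) n); rewrite -ltnS.
  rewrite (partition_function_exp b iN) -/f fgh exp_truncD //.
  rewrite -coef_sum -mulr_suml; apply: eqmodX_mul iN => // j jn.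
  exact: exp_trunc_stable.
have bad k : ~~ (`|k%:R - A| <= Q) -> I (w ^+ k * H) <= B.
  rewrite -ltNge ltr_normr => /orP[kA|kA]; first by apply: bad_up; move: kA; lra.
  by apply: bad_down; move: kA; lra.
have omE : 0 <= omega * expR A by rewrite mulr_ge0 ?expR_ge0.
have IVH : omega * expR A * I (V * H) <=
    \sum_(k < n.+1) (I ((k`!%:R^-1 *: g ^+ k) * H) + omega * expR A * B).
  have -> : I (V * H) = \sum_(k < n.+1) I (w ^+ k * H).
    rewrite /I exchange_big; apply: eq_bigr => i _.
    by rewrite -coef_sum /V mulr_suml.
  rewrite mulr_sumr; apply: ler_sum => k _.
  have B0 : 0 <= B by rewrite mulr_ge0 ?expR_ge0.
  have [kA|kA] := boolP (`|k%:R - A| <= Q).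
    rewrite -[leLHS]addr0 lerD ?good ?mulr_ge0 //; by rewrite -ltnS.
  rewrite -[leLHS]add0r lerD ?ler_wpM2l ?bad //.
  apply: I_ge0; apply: nneg_polyM => // i.
  by rewrite coefZ mulr_ge0 ?invr_ge0 ?ler0n //; apply: nneg_polyX.
rewrite big_split /= total sumr_const card_ord in IVH.
have eS : expR A * expR h.[1] = expR S by rewrite -expRD h1 addrC subrK.
have BS : omega * expR A * B *+ n.+2 <= 4^-1 * (omega * expR S).
  rewrite /B -eS -mulr_natl.
  have := ler_wpM2l (mulr_ge0 (mulr_ge0 om0 (expR_ge0 A)) (expR_ge0 h.[1])) small.
  set E := expR (3 - _) => small'.
  rewrite [leLHS](_ : _ = omega * expR A * expR h.[1] * (n.+2%:R * E)); last by ring.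
  apply: le_trans small' _.
  by rewrite le_eqVlt; apply/orP; left; apply/eqP; ring.
have le1 := ler_wpM2l omE window; have := ler_wpM2l omE tail.
rewrite mulrSr in BS.
rewrite [leLHS](_ : _ = 7 / 8 * (omega * expR S) - omega * expR A * B); last first.
  by rewrite -eS; ring.
have : 0 <= omega * expR S by rewrite mulr_ge0 ?expR_ge0.
move: le1 IVH BS; set Y := omega * expR S; set Z := _ *+ n.+1.
set U := omega * expR A * B; set s1 := _ * \sum_(_ <= _ < _) _; set s2 := _ * I _.
by move: Y Z U s1 s2 => Y Z U s1 s2; set s3 := \sum_(_ <= _ < _ | _) _; move: s3 => s3; lra.
Qed.
(** * A lower bound for partition functions *)

(** The weak form of Stirling's formula [k! <= e * k * (k / e) ^ k]. *)
Lemma fact_upper (R : realType) k : (0 < k)%N ->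
  k`!%:R * expR k%:R <= expR 1 * k%:R ^+ k.+1 :> R.
Proof.
case: k => // k _; elim: k => [|k IH].
  by rewrite (_ : 1`! = 1%N) // expr1n mul1r mulr1.
rewrite factS natrM -[in expR _](natr1 k.+1) expRD.
apply: (@le_trans _ _ (k.+2%:R * expR 1 * (expR 1 * k.+1%:R ^+ k.+2))).
  rewrite (_ : _ * _ * (_ * _) = k.+2%:R * expR 1 * (k.+1`!%:R * expR k.+1%:R)); last by ring.
  by rewrite ler_wpM2l // mulr_ge0 ?expR_ge0.
have h : k.+1%:R / k.+2%:R <= expR (- k.+2%:R^-1) :> R.
  apply: le_trans (expR_ge1Dx _).
  by rewrite -[k.+1%:R](addrK 1) natr1 mulrBl divff ?pnatr_eq0 // mul1r.
have : (k.+1%:R / k.+2%:R) ^+ k.+2 <= expR (- k.+2%:R^-1) ^+ k.+2 :> R.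
  by rewrite lerXn2r // nnegrE ?expR_ge0 // divr_ge0.
rewrite -expRM_natr mulNr mulVf ?pnatr_eq0 // expRN.
rewrite expr_div_n ler_pdivrMr ?exprn_gt0 // ler_pdivlMl ?expR_gt0 // => h2.
rewrite [in leRHS]exprS [leLHS](_ : _ = expR 1 * (k.+2%:R * (expR 1 * k.+1%:R ^+ k.+2))); last by ring.
by rewrite ler_wpM2l ?expR_ge0 // ler_wpM2l.
Qed.

(** By [k! <= e * k * (k / e) ^ k] and [ln (k / A) <= k / A - 1] the exponent
    [k - A - k * ln (k / A)] of a Poisson weight is at least
    [- (k - A) ^ 2 / A]. *)
Lemma poisson_lower (R : realType) (A : R) k : 0 < A ->
  expR (- ((k%:R - A) ^+ 2 / A)) <=
  expR 1 * k.+1%:R * (expR (- A) * (A ^+ k / k`!%:R)).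
Proof.
move=> A0; have fk j : 0 < j`!%:R :> R by rewrite ltr0n fact_gt0.
case: k => [|k].
  rewrite (_ : 0`! = 1%N) // expr0 invr1 !mulr1 sub0r sqrrN expr2 mulfK ?gt_eqF //.
  by rewrite ler_peMl ?expR_ge0 // -[leLHS](expR0 R) ler_expR.
set x := k.+1%:R; have x0 : 0 < x :> R by rewrite ltr0n.
have ex y : expR (x * y) = expR y ^+ k.+1 by rewrite /x mulrC expRM_natr.
have h : (x / A) ^+ k.+1 <= expR (x * (x / A - 1)).
  rewrite ex lerXn2r // ?nnegrE ?expR_ge0 ?divr_ge0 ?(ltW A0) ?(ltW x0) //.
  by have := expR_ge1Dx (x / A - 1); rewrite addrC subrK.
have f := @fact_upper R k.+1 isT.
have -> : - ((x - A) ^+ 2 / A) = - (x * (x / A - 1)) + (x - A).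
  by field; rewrite gt_eqF.
rewrite expRD (expRN (x * _)) [leLHS]mulrC ler_pdivrMr ?expR_gt0 //.
rewrite expRB expRN.
have g : expR 1 * x * (A ^+ k.+1 / k.+1`!%:R) * (x / A) ^+ k.+1 >= expR x.
  rewrite expr_div_n [leRHS](_ : _ = expR 1 * x ^+ k.+2 / k.+1`!%:R); last first.
    rewrite [in RHS]exprS; field; rewrite !gt_eqF ?exprn_gt0 //.
  by rewrite ler_pdivlMr // mulrC.
have : expR x / expR A <= expR 1 * x * (A ^+ k.+1 / k.+1`!%:R) * expR (x * (x / A - 1)) / expR A.
  rewrite ler_wpM2r ?invr_ge0 ?expR_ge0 //; apply: le_trans g _.
  by rewrite ler_wpM2l // !mulr_ge0 ?expR_ge0 ?invr_ge0 ?exprn_ge0 ?ltW.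
move=> /le_trans; apply.
apply: (@le_trans _ _ (expR 1 * k.+2%:R * (A ^+ k.+1 / k.+1`!%:R) * expR (x * (x / A - 1)) / expR A)).
  rewrite !ler_wpM2r ?invr_ge0 ?expR_ge0 ?mulr_ge0 ?invr_ge0 ?exprn_ge0 ?(ltW A0) //.
  by rewrite ler_wpM2l ?expR_ge0 // ler_nat.
by rewrite le_eqVlt; apply/orP; left; apply/eqP; ring.
Qed.

(** The terms of the recursion with a group of size in [[2M, 4M)] are those
    in which the remaining sum lies in the window of [window_lower]. *)
Lemma partition_function_lower (R : realType) (b : nat -> R) n M (t Q : R) :
  let A := \sum_(1 <= j < n.+1 | (M <= j < M.*2)%N) b j in
  let S := \sum_(1 <= j < n.+1) b j in
  (forall j, 0 <= b j) -> (0 < M)%N -> (4 * M <= n)%N ->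
  0 <= t -> t * M%:R <= 2^-1 ->
  \sum_(1 <= j < n.+1) j%:R * b j = n%:R ->
  t ^+ 2 * (\sum_(1 <= j < n.+1) j%:R ^+ 2 * b j * expR (t * j%:R)) <= 1 ->
  0 < A -> 0 <= Q <= A -> n.+2%:R * expR (3 - Q * (t * M%:R) / 2) <= 4^-1 ->
  (forall j, (2 * M <= j < 4 * M)%N -> 1 <= j%:R * b j) ->
  expR (S - Q ^+ 2 / A) <= 2 * n%:R * expR 1 * n.+1%:R * partition_function b n.
Proof.
move=> A S b0 M0 Mn t0 tM mean var A0 QA small hb.
pose omega := expR (- (Q ^+ 2 / A)) / (expR 1 * n.+1%:R).
have en0 : 0 < expR 1 * n.+1%:R :> R by rewrite mulr_gt0 ?expR_gt0.
have om0 : 0 <= omega by rewrite divr_ge0 ?expR_ge0 // ltW.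
have hom k : (k <= n)%N -> `|k%:R - A| <= Q ->
    omega <= expR (- A) * (A ^+ k / k`!%:R).
  move=> kn kA; rewrite ler_pdivrMr // [leRHS]mulrC.
  apply: (@le_trans _ _ (expR (- ((k%:R - A) ^+ 2 / A)))).
    rewrite ler_expR lerN2 ler_wpM2r ?invr_ge0 ?(ltW A0) //.
    by rewrite -(real_normK (num_real (k%:R - A))) lerXn2r // nnegrE ?normr_ge0 //; case/andP: QA.
  apply: le_trans (poisson_lower k A0) _.
  rewrite ler_wpM2r ?mulr_ge0 ?expR_ge0 ?invr_ge0 ?exprn_ge0 ?(ltW A0) //.
  by rewrite ler_wpM2l ?expR_ge0 // ler_nat.
have := window_lower b0 M0 Mn t0 tM mean var A0 QA small om0 hom.
have c0 i : 0 <= partition_function b i by apply: partition_function_ge0.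
have : \sum_(0 <= i < (n - 2 * M).+1 | (n - 4 * M < i)%N) partition_function b i
    <= n%:R * partition_function b n.
  rewrite partition_function_rec (big_nat_widen _ _ n.+1); last by rewrite ltnS leq_subr.
  have -> : \sum_(1 <= j < n.+1) j%:R * b j * partition_function b (n - j) =
      \sum_(0 <= i < n.+1) (n - i)%:R * b (n - i)%N * partition_function b i.
    rewrite [RHS]big_nat_rev /= add0n [RHS]big_ltn // subSS subn0 subnn !mul0r add0r.
    by apply: eq_big_nat => j /andP[_ jn]; rewrite subSS subKn.
  rewrite big_mkcond; apply: ler_sum_nat => i /andP[_ iN].
  case: ifP => [/andP[i1 i2]|_]; last by rewrite !mulr_ge0.
  by rewrite ler_peMl // hb //; lia.
rewrite -/S => h1 h2; have := le_trans h2 h1; rewrite expRD /omega.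
rewrite -mulrA mulrAC mulrA ler_pdivrMr // ler_pdivrMr // [leLHS]mulrC => h3.
by apply: le_trans h3 _; rewrite le_eqVlt; apply/orP; left; apply/eqP; ring.
Qed.
(** * Comparison of powers and exponentials *)

Lemma powRD_nat (R : realType) n (x y : R) : (0 < n)%N ->
  (n%:R `^ (x + y) = n%:R `^ x * n%:R `^ y :> R).
Proof. by move=> n0; rewrite powRD // pnatr_eq0 -lt0n n0 implybT. Qed.

Lemma powRVN (R : realType) n (x : R) : (0 < n)%N ->
  n%:R `^ (- x) * n%:R `^ x = 1 :> R.
Proof. by move=> n0; rewrite -powRD_nat // addNr powRr0. Qed.

Lemma near_le_powR (R : realType) (C e : R) : 0 < e ->
  \forall n \near \oo, C <= n%:R `^ e.
Proof.
move=> e0; pose D := Num.max C 1.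
have D0 : 0 < D by rewrite lt_max ltr01 orbT.
near=> n; apply: (@le_trans _ _ D); first by rewrite le_max lexx.
have -> : D = (D `^ e^-1) `^ e.
  by rewrite -powRrM mulVf ?gt_eqF // powRr1 // ltW.
rewrite ge0_ler_powR ?nnegrE ?powR_ge0 ?(ltW e0) //.
near: n; exact: nbhs_infty_ger.
Unshelve. all: by end_near. Qed.

Lemma near_powR_le (R : realType) (C x y : R) : x < y ->
  \forall n \near \oo, C * n%:R `^ x <= n%:R `^ y.
Proof.
move=> xy; near=> n.
have n0 : (0 < n)%N by near: n; exact: nbhs_infty_gt.
rewrite -(subrK x y) powRD_nat // ler_wpM2r ?powR_ge0 //.
by near: n; apply: near_le_powR; rewrite subr_gt0.
Unshelve. all: by end_near. Qed.

Lemma near_powR_expR (R : realType) (C x c e : R) : 0 < c -> 0 < e ->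
  \forall n \near \oo, C * n%:R `^ x * expR (- (c * n%:R `^ e)) <= 1.
Proof.
move=> c0 e0.
pose k := Num.truncn (`|x| / e + 1).
have hk : x < e * k.+1%:R.
  have := truncnS_gt (`|x| / e + 1); rewrite -/k => h.
  apply: (@le_lt_trans _ _ (e * (`|x| / e + 1))).
    rewrite mulrDr mulrCA mulfV ?gt_eqF // !mulr1.
    by rewrite (le_trans (ler_norm x)) // lerDl ltW.
  by rewrite ltr_pM2l.
have fk : (k.+1`!%:R : R) != 0 by rewrite pnatr_eq0 -lt0n fact_gt0.
near=> n.
have n0 : (0 < n)%N by near: n; exact: nbhs_infty_gt.
rewrite expRN ler_pdivrMr ?expR_gt0 // mul1r.
apply: (@le_trans _ _ ((c * n%:R `^ e) ^+ k.+1 / k.+1`!%:R)); last first.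
  apply: le_trans (@expR_ge1Dxn R _ k _); first by rewrite lerDr.
  by rewrite mulr_ge0 ?powR_ge0 ?(ltW c0).
rewrite exprMn -[(n%:R `^ e) ^+ _]powR_mulrn ?powR_ge0 // -powRrM mulrAC.
rewrite -ler_pdivrMl ?mulrA; last first.
  by rewrite divr_gt0 ?exprn_gt0 // ltr0n fact_gt0.
near: n; exact: near_powR_le.
Unshelve. all: by end_near. Qed.

(** Integer parts of powers of [n] serve as block lengths. *)
Lemma truncn_powR (R : realType) n (e : R) : (0 < n)%N -> 0 <= e ->
  n%:R `^ e / 2 <= ((Num.truncn (n%:R `^ e : R))%:R : R) <= n%:R `^ e.
Proof.
move=> n0 e0; set x := n%:R `^ e.
have x1 : 1 <= x by rewrite -[leLHS](powRr0 n%:R) ler_powR // ler1n.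
have x0 : 0 <= x by apply: le_trans x1.
have /andP[h1 h2] := truncn_itv x0; rewrite h1 andbT.
have : (1 <= Num.truncn x)%N by rewrite truncn_gt0.
by rewrite -(ler_nat R) => h3; move: h2; rewrite -natr1; lra.
Qed.
(** * Sums of parameters with power growth *)

(** The growth [a n = n ^ (l - 1 + o(1))]. *)
Definition power_growth (R : realType) (l : R) (a : nat -> R) :=
  forall s : R, 0 < s ->
  \forall n \near \oo, n%:R `^ (l - 1 - s) <= a n <= n%:R `^ (l - 1 + s).

Lemma growth_lower (R : realType) (l s : R) (a : nat -> R) :
  power_growth l a -> 0 < s ->
  exists J, forall j, (J <= j)%N -> j%:R `^ (l - s) <= j%:R * a j.
Proof.
move=> ga /ga [J _ hJ]; exists J.+1 => j Jj; have j0 : (0 < j)%N by apply: leq_trans Jj.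
have /andP[h _] := hJ j (ltnW Jj).
rewrite [l - s](_ : _ = 1 + (l - 1 - s)); last by ring.
by rewrite powRD_nat // powRr1 // ler_wpM2l.
Qed.

Lemma growth_upper (R : realType) (l s : R) (a : nat -> R) :
  power_growth l a -> 0 < s -> 0 <= l -> (forall j, 0 <= a j) ->
  exists2 C, 0 < C & forall j, (0 < j)%N -> j%:R * a j <= C * j%:R `^ (l + s).
Proof.
move=> ga s0 l0 a0; have [J _ hJ] := ga _ s0.
pose C := 1 + \sum_(0 <= j < J) j%:R * a j.
have C1 : 1 <= C by rewrite lerDl sumr_ge0 // => j _; rewrite mulr_ge0.
exists C => [|j j0]; first by apply: lt_le_trans C1.
have j1 : 1 <= j%:R `^ (l + s) :> R.
  by rewrite -[leLHS](powRr0 j%:R) ler_powR ?ler1n // addr_ge0 // ltW.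
have [jJ|Jj] := ltnP j J.
  apply: (@le_trans _ _ C); last by rewrite ler_peMr // (le_trans _ C1).
  rewrite /C (bigD1_seq j) ?iota_uniq ?mem_index_iota //= addrCA lerDl.
  by rewrite addr_ge0 // sumr_ge0 // => i _; rewrite mulr_ge0.
have /andP[_ h] := hJ j Jj.
apply: (@le_trans _ _ (j%:R `^ (l + s))); last by rewrite ler_peMl ?powR_ge0.
rewrite [l + s](_ : _ = 1 + (l - 1 + s)); last by ring.
by rewrite powRD_nat // powRr1 // ler_wpM2l.
Qed.

Lemma sum_block_ge (R : numDomainType) (F : nat -> R) N n c :
  (forall j, 0 <= F j) -> (0 < N)%N -> (2 * N <= n)%N ->
  (forall j, (N <= j < 2 * N)%N -> c <= F j) ->
  N%:R * c <= \sum_(1 <= j < n.+1 | (N <= j < N.*2)%N) F j.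
Proof.
move=> F0 N0 Nn hF.
have -> : \sum_(1 <= j < n.+1 | (N <= j < N.*2)%N) F j = \sum_(N <= j < 2 * N) F j.
  rewrite [RHS](big_nat_widenl N 1) // [RHS](big_nat_widen _ _ n.+1); last first.
    by apply: leq_trans Nn _.
  by apply: eq_bigl => j /=; rewrite mul2n.
rewrite -[N in N%:R](_ : 2 * N - N = N)%N; last by rewrite mul2n -addnn addnK.
rewrite mulr_natl -sumr_const_nat; apply: ler_sum_nat => j; exact: hF.
Qed.

(** Sizes below [1 / d] lose at most a factor [e] by the tilt [d]. *)
Lemma block_mass (R : realType) (l s d : R) (a : nat -> R) J M n :
  (forall j, (J <= j)%N -> j%:R `^ (l - s) <= j%:R * a j) ->
  (forall j, 0 <= a j) -> 0 <= l - s -> (J < M)%N -> (2 * M <= n)%N ->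
  d * (2 * M%:R) <= 1 ->
  M%:R `^ (l - s) / (2 * expR 1) <=
  \sum_(1 <= j < n.+1 | (M <= j < M.*2)%N) a j * expR (- (d * j%:R)).
Proof.
move=> hJ a0 ls0 JM Mn dM; have M0 : (0 < M)%N by apply: leq_trans JM.
have b0 j : 0 <= a j * expR (- (d * j%:R)) by rewrite mulr_ge0 ?expR_ge0.
apply: le_trans (sum_block_ge (c := M%:R `^ (l - s) / (2 * M%:R) * expR (- 1)) b0 M0 Mn _).
  rewrite le_eqVlt; apply/orP; left; apply/eqP; rewrite expRN; field.
  by rewrite gt_eqF ?expR_gt0 //= pnatr_eq0 -lt0n M0.
move=> j /andP[Mj jM]; rewrite ler_pM ?divr_ge0 ?mulr_ge0 ?powR_ge0 ?expR_ge0 //.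
  have j0 : 0 < j%:R :> R by rewrite ltr0n (leq_trans M0).
  rewrite ler_pdivrMr ?mulr_gt0 ?ltr0n //.
  apply: (@le_trans _ _ (j%:R `^ (l - s))); first by rewrite ge0_ler_powR ?nnegrE ?ler_nat.
  apply: le_trans (hJ j _) _; first exact: leq_trans (ltnW JM) Mj.
  by rewrite mulrC ler_wpM2l // -natrM ler_nat ltnW.
rewrite ler_expR lerN2.
have [dn|dp] := lerP d 0; first by rewrite (@le_trans _ _ 0) // mulr_le0_ge0.
by apply: le_trans dM; rewrite ler_wpM2l ?(ltW dp) // -natrM ler_nat ltnW.
Qed.

Lemma sum_cond_le (R : numDomainType) (F : nat -> R) m n (P : pred nat) :
  (forall j, 0 <= F j) -> \sum_(m <= j < n | P j) F j <= \sum_(m <= j < n) F j.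
Proof. by move=> F0; rewrite big_mkcond; apply: ler_sum => j _; case: ifP. Qed.

Lemma count_le (R : realDomainType) n (T : R) : 0 <= T ->
  \sum_(1 <= j < n.+1 | j%:R <= T) (1 : R) <= T.
Proof.
move=> T0; elim: n => [|n IH]; first by rewrite big_geq.
have [nT|Tn] := lerP n.+1%:R T.
  apply: le_trans nT; apply: le_trans (sum_cond_le _ _ _ (fun=> ler01)) _.
  by rewrite sumr_const_nat subn1.
by rewrite big_mkcond big_nat_recr //= [n.+1%:R <= T]lt_geF // addr0 -big_mkcond.
Qed.

(** Below [T] the power is at most [T `^ k], above [T] the exponential is at
    most [expR (- (y * T))]. *)
Lemma sum_powR_expR (R : realType) (k y T : R) n : 0 <= k -> 0 <= y -> 0 < T ->
  \sum_(1 <= j < n.+1) j%:R `^ k * expR (- (y * j%:R)) <=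
  T `^ (k + 1) + n%:R `^ (k + 1) * expR (- (y * T)).
Proof.
move=> k0 y0 T0.
apply: (@le_trans _ _ (\sum_(1 <= j < n.+1)
   ((if j%:R <= T then T `^ k * 1 else 0) + n%:R `^ k * expR (- (y * T))))).
  apply: ler_sum_nat => j /andP[j0 jn].
  have kj : j%:R `^ k <= n%:R `^ k by rewrite ge0_ler_powR // ?nnegrE // ler_nat.
  have [jT|jT] := lerP (j%:R : R) T.
    apply: (@le_trans _ _ (T `^ k * 1)).
      2: by rewrite lerDl mulr_ge0 ?powR_ge0 ?expR_ge0.
    rewrite ler_pM ?powR_ge0 ?expR_ge0 //.
      by rewrite ge0_ler_powR ?nnegrE // ltW.
    by rewrite -[leRHS](expR0 R) ler_expR oppr_le0 mulr_ge0.
  rewrite add0r ler_pM ?powR_ge0 ?expR_ge0 //.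
  by rewrite ler_expR lerN2 ler_wpM2l // ltW.
rewrite big_split /= sumr_const_nat subn1 /= -big_mkcond -mulr_sumr.
have pD (x : R) : 0 <= x -> x `^ (k + 1) = x `^ k * x.
  move=> x0; rewrite powRD ?powRr1 //.
  by rewrite gt_eqF // ltr_wpDl.
rewrite !pD ?(ltW T0) //.
apply: lerD; first by rewrite ler_wpM2l ?powR_ge0 // count_le // ltW.
by rewrite -[leLHS]mulr_natr [leRHS]mulrAC.
Qed.
Lemma truncn_powR_pow (R : realType) n (e f : R) : (0 < n)%N -> 0 <= e -> 0 <= f ->
  n%:R `^ (e * f) <= 2 `^ f * (Num.truncn (n%:R `^ e : R))%:R `^ f :> R.
Proof.
move=> n0 e0 f0; have /andP[h _] := truncn_powR n0 e0.
rewrite powRrM -powRM // ge0_ler_powR // ?nnegrE ?powR_ge0 ?mulr_ge0 //.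
by rewrite -ler_pdivrMl // mulrC.
Qed.

(** A tilt of order smaller than [n ^ (- g)], where [g = 1 / (l + 1)], leaves a
    mean larger than [n]: the sizes between [n ^ (g + 3 s)] and twice this
    contribute [n ^ ((g + 3 s) (l + 1 - s))], and [g (l + 1) = 1]. *)
Lemma tilted_mean_gt (R : realType) (l s g : R) (a : nat -> R) :
  power_growth l a -> (forall j, 0 <= a j) ->
  g * (l + 1) = 1 -> 0 < g -> 0 < s -> s < l -> g + 3 * s < 1 ->
  \forall n \near \oo, forall d : R, d <= n%:R `^ (- g - 4 * s) ->
    n%:R < \sum_(1 <= j < n.+1) j%:R * (a j * expR (- (d * j%:R))).
Proof.
move=> ga a0 gl g0 s0 sl gs; have [J hJ] := growth_lower ga s0.
near=> n => d hd.
have n0 : (0 < n)%N by near: n; exact: nbhs_infty_gt.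
pose N := Num.truncn (n%:R `^ (g + 3 * s)).
have e0 : 0 <= g + 3 * s by lra.
have /andP[N1 N2] := truncn_powR n0 e0; rewrite -/N in N1 N2.
have JN : (J.+1 <= N)%N.
  rewrite -(ler_nat R); apply: le_trans N1; rewrite ler_pdivlMr //.
  by near: n; apply: near_le_powR; lra.
have N0 : (0 < N)%N := leq_trans (ltn0Sn J) JN.
have h1 : 2 * n%:R `^ (g + 3 * s) <= n%:R.
  by rewrite -[leRHS]powRr1 //; near: n; apply: near_powR_le.
have Nn : (2 * N <= n)%N.
  by rewrite -(ler_nat R) natrM; apply: le_trans h1; rewrite ler_wpM2l.
have dN : d * (2 * N%:R) <= 1.
  have [dn|dp] := lerP d 0; first by rewrite (@le_trans _ _ 0) // mulr_le0_ge0 ?mulr_ge0.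
  apply: (@le_trans _ _ (n%:R `^ (- g - 4 * s) * (2 * n%:R `^ (g + 3 * s)))).
    by rewrite ler_pM ?ler_wpM2l ?mulr_ge0 // ltW.
  rewrite mulrCA -powRD_nat // (_ : - g - 4 * s + (g + 3 * s) = - s); last by ring.
  by rewrite -[leRHS](powRr0 n%:R); near: n; apply: near_powR_le; lra.
have F0 j : 0 <= j%:R * (a j * expR (- (d * j%:R))) by rewrite !mulr_ge0 ?expR_ge0.
apply: lt_le_trans (sum_cond_le _ _ _ F0).
apply: (lt_le_trans _ (@sum_block_ge _ _ N n (N%:R `^ (l - s) * expR (- 1)) F0 _ Nn _)).
- have Nl : N%:R * (N%:R `^ (l - s) * expR (- 1)) = N%:R `^ (1 + l - s) * expR (- 1) :> R.
    by rewrite -addrA (powRD_nat 1 (l - s) N0) powRr1 // mulrA.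
  rewrite Nl expRN ltr_pdivlMr ?expR_gt0 //.
  have := @truncn_powR_pow R n (g + 3 * s) (1 + l - s) n0 e0; rewrite -/N => h.
  have f0 : 0 <= 1 + l - s by lra.
  have p2 : 0 < 2 `^ (1 + l - s) :> R by rewrite powR_gt0.
  rewrite -(ltr_pM2l p2); apply: lt_le_trans (h f0).
  apply: (@lt_le_trans _ _ (2 `^ (1 + l - s) * (2 * expR 1) * n%:R `^ 1)).
    rewrite powRr1 // -mulrA ltr_pM2l // mulrC [2 * _]mulrC -mulrA ltr_pM2l ?expR_gt0 //.
    by rewrite ltr_pMl ?ltr0n // ltr1n.
  by near: n; apply: near_powR_le; nra.
- exact: N0.
move=> j /andP[Nj jN]; rewrite mulrA ler_pM ?powR_ge0 ?expR_ge0 //.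
  apply: le_trans (hJ j _); last by apply: leq_trans Nj; apply: ltnW.
  by rewrite ge0_ler_powR ?nnegrE ?ler_nat //; lra.
rewrite ler_expR lerN2.
have [dn|dp] := lerP d 0; first by rewrite (@le_trans _ _ 0) // mulr_le0_ge0.
apply: le_trans dN; rewrite ler_wpM2l ?(ltW dp) // -natrM ler_nat; exact: ltnW.
Unshelve. all: by end_near. Qed.

(** A tilt of order larger than [n ^ (- g)] cuts the mean at the sizes near
    [n ^ (g - 3 s)], which gives less than [n]. *)
Lemma tilted_mean_lt (R : realType) (l s g : R) (a : nat -> R) :
  power_growth l a -> (forall j, 0 <= a j) ->
  g * (l + 1) = 1 -> 0 < g -> g < 1 -> 0 < s -> 0 < l ->
  \forall n \near \oo, forall d : R, n%:R `^ (- g + 4 * s) <= d ->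
    \sum_(1 <= j < n.+1) j%:R * (a j * expR (- (d * j%:R))) < n%:R.
Proof.
move=> ga a0 gl g0 g1 s0 l0.
have [C C0 hC] := growth_upper ga s0 (ltW l0) a0.
near=> n => d hd.
have n0 : (0 < n)%N by near: n; exact: nbhs_infty_gt.
pose y := n%:R `^ (- g + 4 * s) : R; pose T := n%:R `^ (g - 3 * s) : R.
have y0 : 0 <= y by apply: powR_ge0.
have yT : y * T = n%:R `^ s by rewrite -powRD_nat //; congr (_ `^ _); ring.
apply: (@le_lt_trans _ _ (C * (T `^ (l + s + 1) + n%:R `^ (l + s + 1) * expR (- (y * T))))).
  apply: (@le_trans _ _ (C * \sum_(1 <= j < n.+1) j%:R `^ (l + s) * expR (- (y * j%:R)))).
    rewrite mulr_sumr; apply: ler_sum_nat => j /andP[j0 jn].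
    rewrite !mulrA ler_pM ?mulr_ge0 ?expR_ge0 ?hC //.
    by rewrite ler_expR lerN2 ler_wpM2r.
  rewrite ler_wpM2l ?(ltW C0) //; apply: sum_powR_expR => //; first by lra.
  by rewrite powR_gt0 // ltr0n.
have hT : 4 * C * n%:R `^ ((g - 3 * s) * (l + s + 1)) <= n%:R `^ 1.
  by near: n; apply: near_powR_le; nra.
rewrite powRrM powRr1 // in hT.
have hE : C * n%:R `^ (l + s + 1) * expR (- (1 * n%:R `^ s)) <= 1.
  by near: n; apply: near_powR_expR.
rewrite mul1r -yT in hE.
have n4 : 4 <= n%:R :> R by near: n; exact: nbhs_infty_ger.
by move: hT hE; rewrite -/T mulrDr mulrA; move: (_ `^ _) => X; lra.
Unshelve. all: by end_near. Qed.

(** The exponent exceeds that of [d ^ (- (l + 2))] by a multiple of [s] only.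
    Half of the tilt is kept in reserve for the factor [expR (t * j)] of the
    Chernoff bounds. *)
Lemma tilted_var_le (R : realType) (l s g : R) (a : nat -> R) :
  power_growth l a -> (forall j, 0 <= a j) ->
  0 < g -> g < 1 -> 0 < s -> s <= 1 -> 0 < l ->
  \forall n \near \oo, forall d : R, n%:R `^ (- g - 4 * s) <= d ->
    \sum_(1 <= j < n.+1) j%:R ^+ 2 * (a j * expR (- (d / 2 * j%:R))) <=
      n%:R `^ (g * (l + 2) + (5 * l + 17) * s).
Proof.
move=> ga a0 g0 g1 s0 s1 l0.
have [C C0 hC] := growth_upper ga s0 (ltW l0) a0.
near=> n => d hd.
have n0 : (0 < n)%N by near: n; exact: nbhs_infty_gt.
pose y := n%:R `^ (- g - 4 * s) / 2 : R; pose T := n%:R `^ (g + 5 * s) : R.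
have y0 : 0 <= y by rewrite divr_ge0 ?powR_ge0.
have yT : y * T = 2^-1 * n%:R `^ s.
  by rewrite mulrAC mulrC -powRD_nat //; congr (_ * _ `^ _); ring.
apply: (@le_trans _ _ (C * (T `^ (l + s + 1 + 1) + n%:R `^ (l + s + 1 + 1) * expR (- (y * T))))).
  apply: (@le_trans _ _ (C * \sum_(1 <= j < n.+1) j%:R `^ (l + s + 1) * expR (- (y * j%:R)))).
    rewrite mulr_sumr; apply: ler_sum_nat => j /andP[j0 jn].
    rewrite powRD_nat // powRr1 // !mulrA ler_pM ?mulr_ge0 ?exprn_ge0 ?expR_ge0 //.
      by rewrite expr2 -mulrA mulrC ler_wpM2r // hC.
    by rewrite ler_expR lerN2 !ler_wpM2r.
  rewrite ler_wpM2l ?(ltW C0) //; apply: sum_powR_expR => //; first by lra.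
  by rewrite powR_gt0 // ltr0n.
have hT : 2 * C * n%:R `^ ((g + 5 * s) * (l + s + 1 + 1)) <=
    n%:R `^ (g * (l + 2) + (5 * l + 17) * s).
  by near: n; apply: near_powR_le; nra.
rewrite powRrM in hT.
have hE : C * n%:R `^ (l + s + 1 + 1) * expR (- (2^-1 * n%:R `^ s)) <= 1.
  by near: n; apply: near_powR_expR.
rewrite -yT in hE.
have n4 : 2 <= n%:R `^ (g * (l + 2) + (5 * l + 17) * s) :> R.
  by near: n; apply: near_le_powR; nra.
by move: hT hE n4; rewrite -/T [X in _ -> _ -> _ -> X <= _]mulrDr [X in _ -> _ -> _ -> _ + X <= _]mulrA; move: (_ `^ _) (n%:R `^ (_ * _ + _)) => X Y; lra.
Unshelve. all: by end_near. Qed.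
(** * Partition functions at the saddle point *)

(** The tilts [e ^ (- d j)] multiply to [e ^ (- d n)] over a partition of [n]. *)
Lemma partition_function_tilt (R : realType) (a : nat -> R) (d : R) n :
  partition_function (fun j => a j * expR (- (d * j%:R))) n =
  expR (- (d * n%:R)) * partition_function a n.
Proof.
rewrite /partition_function mulr_sumr; apply: eq_bigr => eta _.
have -> : expR (- (d * n%:R)) =
    \prod_(1 <= i < n.+1) expR (- (d * i%:R)) ^+ K i eta.
  rewrite -{1}(sum_sizes eta) natr_sum mulr_sumr -sumrN expR_sum.
  by apply: eq_bigr => i _; rewrite natrM mulrA -mulNr expRM_natr.
rewrite /weight -big_split /=; apply: eq_bigr => i _.
by rewrite exprMn mulrAC mulrC.
Qed.

(** With [r = e ^ (- d)] the mean is a polynomial in [r], to which the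
    intermediate value theorem applies on [[0, 1]]. *)
Lemma tilt_exists (R : realType) (a : nat -> R) n :
  (0 < n)%N -> n%:R <= \sum_(1 <= j < n.+1) j%:R * a j ->
  exists d : R, \sum_(1 <= j < n.+1) j%:R * (a j * expR (- (d * j%:R))) = n%:R.
Proof.
move=> n0 hn; pose q := size_gf n (fun j => j%:R * a j) - n%:R%:P.
have q0 : q.[0] = - n%:R.
  rewrite hornerD hornerN hornerC horner_coef0.
  by rewrite (coef_size_gf n (fun j => j%:R * a j) 0) add0r.
have [||r /andP[r0 r1] rq] := @poly_ivt R q 0 1; rewrite ?ler01 //.
  rewrite q0 oppr_le0 ler0n /= hornerD hornerN hornerC subr_ge0 horner_size_gf.
  by under eq_bigr do rewrite expr1n mulr1.
have {}r0 : 0 < r.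
  rewrite lt_neqAle r0 andbT; apply/eqP => r00.
  move: rq; rewrite -r00 /root q0 oppr_eq0 pnatr_eq0 => /eqP nn0; by rewrite nn0 in n0.
exists (- ln r).
move: rq; rewrite /root hornerD hornerN hornerC subr_eq0 horner_size_gf => /eqP <-.
by apply: eq_bigr => j _; rewrite mulNr opprK expRM_natr lnK ?posrE // mulrA.
Qed.

(** The choice of the parameters of [partition_function_lower], with a slack
    [s] in every exponent.  Up to this slack, with [g = 1 / (l + 1)], the tilt is
    [n ^ (- g)], the block is at [M = n ^ g], the standard deviation of the sum
    is [1 / t = n ^ (g (l + 2) / 2)], and both the number [A] of groups of the
    block and the square of the deviation [Q] are [n ^ (g l)].  The multiples of
    [s] make [Q * t * M] a positive power of [n] while [Q ^+ 2 / A], which is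
    the logarithm of the loss, remains [n ^ O(s)]. *)
Lemma saddle_lower_aux (R : realType) (l s g : R) (a : nat -> R) :
  power_growth l a -> (forall j, 0 <= a j) ->
  g * (l + 1) = 1 -> 0 < g -> g < 1 -> 0 < l ->
  0 < s -> s <= 1 -> s < l -> g + 3 * s < 1 -> 5 * s < g ->
  (8 * l + 17) * s <= g * l / 2 ->
  \forall n \near \oo, exists2 d : R,
    n%:R `^ (- g - 4 * s) <= d <= n%:R `^ (- g + 4 * s) &
    expR (d * n%:R + \sum_(1 <= j < n.+1) a j * expR (- (d * j%:R))
          - n%:R `^ ((10 * l + 32) * s)) <= partition_function a n.
Proof.
move=> ga a0 gl g0 g1 l0 s0 s1 sl gs gs5 hs.
have [J hJ] := growth_lower ga s0.
pose v := g * (l + 2) + (5 * l + 17) * s.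
pose e1 := g * l - (5 * l + 2) * s.
pose q := g * l / 2 + (5 / 2 * l + 29 / 2) * s.
pose rho := (10 * l + 31) * s.
have e1_0 : 0 < e1 by rewrite /e1; nra.
have ls0 : 0 <= l - s by lra.
have qe1 : q <= e1 by rewrite /q /e1; nra.
have qve : q + - (v / 2) + (g - 5 * s) = s by rewrite /q /v; field.
have rhoe : q + q <= rho + e1 by rewrite /q /rho /e1; nra.
near=> n.
have n0 : (0 < n)%N by near: n; exact: nbhs_infty_gt.
have hgt : forall d : R, d <= n%:R `^ (- g - 4 * s) ->
    n%:R < \sum_(1 <= j < n.+1) j%:R * (a j * expR (- (d * j%:R))).
  by near: n; apply: (@tilted_mean_gt _ l).
have hlt : forall d : R, n%:R `^ (- g + 4 * s) <= d ->
    \sum_(1 <= j < n.+1) j%:R * (a j * expR (- (d * j%:R))) < n%:R.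
  by near: n; apply: (@tilted_mean_lt _ l).
have hvar : forall d : R, n%:R `^ (- g - 4 * s) <= d ->
    \sum_(1 <= j < n.+1) j%:R ^+ 2 * (a j * expR (- (d / 2 * j%:R))) <= n%:R `^ v.
  by near: n; apply: tilted_var_le.
have [d mean] : exists d : R,
    \sum_(1 <= j < n.+1) j%:R * (a j * expR (- (d * j%:R))) = n%:R.
  apply: tilt_exists => //; apply: le_trans (ltW (hgt 0 (powR_ge0 _ _))) _.
  by under eq_bigr do rewrite mul0r oppr0 expR0 mulr1.
have dlo : n%:R `^ (- g - 4 * s) <= d.
  by rewrite leNgt; apply/negP => /ltW /hgt; rewrite mean ltxx.
have dhi : d <= n%:R `^ (- g + 4 * s).
  by rewrite leNgt; apply/negP => /ltW /hlt; rewrite mean ltxx.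
exists d; first by rewrite dlo.
have d0 : 0 <= d by apply: le_trans dlo; apply: powR_ge0.
pose b j := a j * expR (- (d * j%:R)).
have b0 j : 0 <= b j by rewrite mulr_ge0 ?expR_ge0.
pose M := Num.truncn (n%:R `^ (g - 5 * s)).
have eM : 0 <= g - 5 * s by lra.
have /andP[M1 M2] := truncn_powR n0 eM; rewrite -/M in M1 M2.
have JM : (J.+1 <= M)%N.
  rewrite -(ler_nat R); apply: le_trans M1; rewrite ler_pdivlMr //.
  by near: n; apply: near_le_powR; lra.
have M0 : (0 < M)%N := leq_trans (ltn0Sn J) JM.
have Mn : (4 * M <= n)%N.
  rewrite -(ler_nat R) natrM; apply: (@le_trans _ _ (4 * n%:R `^ (g - 5 * s))).
    by rewrite ler_wpM2l.
  by rewrite -[leRHS]powRr1 //; near: n; apply: near_powR_le; lra.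
have ns4 : 4 * n%:R `^ (- s) <= 1 :> R.
  by rewrite -[leRHS](powRr0 n%:R); near: n; apply: near_powR_le; lra.
have dM : d * M%:R <= n%:R `^ (- s).
  apply: (@le_trans _ _ (n%:R `^ (- g + 4 * s) * n%:R `^ (g - 5 * s))).
    by rewrite ler_pM.
  by rewrite -powRD_nat // (_ : - g + 4 * s + (g - 5 * s) = - s) //; ring.
have dM4 j : (j < 4 * M)%N -> expR (- 1) <= expR (- (d * j%:R)).
  move=> jM; rewrite ler_expR lerN2; apply: le_trans ns4.
  apply: (@le_trans _ _ (4 * (d * M%:R))); last by rewrite ler_wpM2l.
  by rewrite mulrCA ler_wpM2l // -natrM ler_nat ltnW.
have ja j : (M <= j)%N -> M%:R `^ (l - s) <= j%:R * a j.
  move=> Mj; apply: le_trans (hJ j _); last by apply: leq_trans Mj; apply: ltnW.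
  by rewrite ge0_ler_powR ?nnegrE ?ler_nat.
have MA : 2 * expR 1 * n%:R `^ e1 <= M%:R `^ (l - s).
  have := truncn_powR_pow n0 eM ls0; rewrite -/M => h.
  have p2 : 0 < 2 `^ (l - s) :> R by rewrite powR_gt0.
  rewrite -(ler_pM2l p2); apply: le_trans h; rewrite mulrA.
  by near: n; apply: near_powR_le; rewrite /e1; nra.
have ne1 : 1 <= n%:R `^ e1 :> R by near: n; apply: near_le_powR.
have jb j : (2 * M <= j < 4 * M)%N -> 1 <= j%:R * b j.
  move=> /andP[j1 j2]; rewrite mulrA.
  apply: (@le_trans _ _ (M%:R `^ (l - s) * expR (- 1))); last first.
    by rewrite ler_pM ?powR_ge0 ?expR_ge0 ?dM4 // ja // (leq_trans _ j1) // leq_pmull.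
  rewrite expRN ler_pdivlMr ?expR_gt0 // mul1r; apply: le_trans MA.
  have := expR_gt0 (1 : R); move: ne1; move: (_ `^ e1) (expR 1) ; clear; intros; nra.
pose A := \sum_(1 <= j < n.+1 | (M <= j < M.*2)%N) b j.
have hA : n%:R `^ e1 <= A.
  have Mn2 : (2 * M <= n)%N by apply: leq_trans Mn; rewrite leq_mul2r orbT.
  have dM2 : d * (2 * M%:R) <= 1.
    apply: le_trans ns4; rewrite mulrCA; apply: (@le_trans _ _ (4 * (d * M%:R))).
      by rewrite ler_wpM2r ?mulr_ge0 // ler_nat.
    by rewrite ler_wpM2l.
  apply: le_trans (block_mass hJ a0 ls0 JM Mn2 dM2).
  by rewrite ler_pdivlMr ?mulr_gt0 ?expR_gt0 // mulrC.
have A0 : 0 < A by apply: lt_le_trans hA; apply: lt_le_trans ne1.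
pose t := n%:R `^ (- (v / 2)) : R.
have t0 : 0 <= t by apply: powR_ge0.
have td : 2 * t <= d.
  by apply: le_trans dlo; rewrite /t; near: n; apply: near_powR_le; rewrite /v; nra.
have tM : t * M%:R <= 2^-1.
  have : 2 * (t * M%:R) <= 1.
    rewrite mulrA; apply: (@le_trans _ _ (d * M%:R)); first by rewrite ler_wpM2r.
    apply: le_trans dM _; apply: le_trans ns4.
    by have := powR_ge0 (n%:R : R) (- s); move: (_ `^ _); clear; intros; lra.
  by move: (t * _); clear; intros; lra.
have var : t ^+ 2 * (\sum_(1 <= j < n.+1) j%:R ^+ 2 * b j * expR (t * j%:R)) <= 1.
  have t2 : t ^+ 2 = n%:R `^ (- v).
    by rewrite expr2 -powRD_nat //; congr (_ `^ _); field.
  rewrite t2 -[leRHS](@powRVN R n v n0) ler_wpM2l ?powR_ge0 //.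
  apply: le_trans (hvar d dlo); apply: ler_sum => j _.
  rewrite -mulrA ler_wpM2l ?exprn_ge0 // /b -mulrA -expRD ler_wpM2l // ler_expR.
  by rewrite -!mulNr -mulrDl ler_wpM2r //; move: td; clear; intros; lra.
pose Q := n%:R `^ q : R.
have QA : 0 <= Q <= A.
  by rewrite powR_ge0 /=; apply: le_trans hA; rewrite ler_powR ?ler1n.
have QtM : n%:R `^ s / 2 <= Q * (t * M%:R).
  apply: (@le_trans _ _ (Q * (t * (n%:R `^ (g - 5 * s) / 2)))); last first.
    by rewrite !ler_wpM2l // ?powR_ge0.
  by rewrite !mulrA -!powRD_nat // qve.
have small : n.+2%:R * expR (3 - Q * (t * M%:R) / 2) <= 4^-1.
  have h : 12 * expR 3 * n%:R `^ 1 * expR (- (4^-1 * n%:R `^ s)) <= 1.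
    by near: n; apply: near_powR_expR => //; lra.
  have n3 : n.+2%:R <= 3 * n%:R `^ 1 :> R.
    by rewrite powRr1 // -natrM ler_nat; move: n0; clear; intros; lia.
  apply: (@le_trans _ _ (3 * n%:R `^ 1 * (expR 3 * expR (- (4^-1 * n%:R `^ s))))).
    rewrite ler_pM ?expR_ge0 // -expRD ler_expR lerD2l lerN2.
    by move: QtM; move: (Q * (t * M%:R)) (n%:R `^ s); clear; intros; lra.
  by move: h; move: (expR 3) (_ `^ 1) (expR (- _)); clear; intros; lra.
have low := partition_function_lower b0 M0 Mn t0 tM mean var A0 QA small jb.
rewrite -/A partition_function_tilt in low.
have Q2A : Q ^+ 2 / A <= n%:R `^ rho.
  rewrite ler_pdivrMr //; apply: (@le_trans _ _ (n%:R `^ rho * n%:R `^ e1)).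
    by rewrite expr2 -!powRD_nat // ler_powR ?ler1n.
  by rewrite ler_wpM2l ?powR_ge0.
have h2 : 2 * n%:R `^ rho <= n%:R `^ ((10 * l + 32) * s).
  by near: n; apply: near_powR_le; rewrite /rho; lra.
have h3 : 4 * expR 1 * n%:R `^ 2 * expR (- (2^-1 * n%:R `^ ((10 * l + 32) * s))) <= 1.
  by near: n; apply: near_powR_expR => //; rewrite mulr_gt0 // addr_gt0 // mulr_gt0.
rewrite -(ler_pM2l (expR_gt0 (- (d * n%:R)))) -expRD.
set S := \sum_(1 <= j < n.+1) a j * _.
rewrite (_ : - (d * n%:R) + _ = S - n%:R `^ ((10 * l + 32) * s)); last by ring.
rewrite -[\sum_(1 <= j < n.+1) b j]/S in low.
set P := _ * partition_function a n in low *.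
have P0 : 0 <= P by rewrite mulr_ge0 ?expR_ge0 // partition_function_ge0.
have low2 : 2 * n%:R * expR 1 * n.+1%:R <= 4 * expR 1 * n%:R `^ 2 :> R.
  have -> : n%:R `^ 2 = n%:R * n%:R :> R by rewrite powR_mulrn // expr2.
  rewrite (_ : 2 * n%:R * expR 1 * n.+1%:R = 2 * expR 1 * (n%:R * n.+1%:R)); last by ring.
  rewrite (_ : 4 * _ * _ = 2 * expR 1 * (n%:R * (2 * n%:R))); last by ring.
  rewrite ler_wpM2l ?mulr_ge0 ?expR_ge0 // ler_wpM2l // -natrM ler_nat.
  by move: n0; clear; intros; lia.
set U := n%:R `^ ((10 * l + 32) * s) in h2 h3 *.
apply: (@le_trans _ _ (expR (S - Q ^+ 2 / A) * expR (- (2^-1 * U)))).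
  rewrite -expRD ler_expR -addrA lerD2l; move: h2 Q2A.
  by move: (Q ^+ 2 / A) (_ `^ rho) (U) => /=; clear; intros; lra.
apply: (@le_trans _ _ (4 * expR 1 * n%:R `^ 2 * P * expR (- (2^-1 * U)))).
  rewrite ler_wpM2r ?expR_ge0 //; apply: le_trans low _.
  by rewrite ler_wpM2r.
by rewrite mulrAC -[leRHS]mul1r ler_wpM2r.
Unshelve. all: by end_near. Qed.
Lemma saddle_lower (R : realType) (l s : R) (a : nat -> R) :
  power_growth l a -> (forall j, 0 <= a j) -> 0 < l -> 0 < s ->
  \forall n \near \oo, exists2 d : R,
    n%:R `^ (- (l + 1)^-1 - s) <= d <= n%:R `^ (- (l + 1)^-1 + s) &
    expR (d * n%:R + \sum_(1 <= j < n.+1) a j * expR (- (d * j%:R)) - n%:R `^ s)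
      <= partition_function a n.
Proof.
move=> ga a0 l0 s0; set g := (l + 1)^-1.
have l10 : 0 < l + 1 by rewrite addr_gt0.
have gl : g * (l + 1) = 1 by rewrite mulVf // gt_eqF.
have g0 : 0 < g by rewrite invr_gt0.
have g1 : g < 1 by rewrite invf_lt1 // ltrDr.
pose m := Num.min s 1.
have m0 : 0 < m by rewrite lt_min s0 ltr01.
have ms : m <= s by rewrite ge_min lexx.
have m1 : m <= 1 by rewrite ge_min lexx orbT.
(* Small enough for all the linear constraints on the slack; the largest
   coefficient is 34, in the comparison of [Q] and [A]. *)
pose sg := m * (g * l) / (40 * (l + 1)).
have gl1 : g * l <= 1 by move: gl; rewrite mulrDr mulr1; lra.
have gl0 : 0 < g * l by rewrite mulr_gt0.
have sg0 : 0 < sg by rewrite divr_gt0 ?mulr_gt0.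
have sgE : 40 * ((l + 1) * sg) = m * (g * l).
  by rewrite /sg; field; rewrite gt_eqF.
have mgl : m * (g * l) <= g * l by rewrite ler_piMl // ltW.
have mgl' : m * (g * l) <= m by rewrite ler_piMr // ltW.
have lsg : 0 < l * sg by rewrite mulr_gt0.
have lgl : g * l <= l by rewrite ler_piMl // ltW.
have h : \forall n \near \oo, exists2 d : R,
    n%:R `^ (- g - 4 * sg) <= d <= n%:R `^ (- g + 4 * sg) &
    expR (d * n%:R + \sum_(1 <= j < n.+1) a j * expR (- (d * j%:R))
          - n%:R `^ ((10 * l + 32) * sg)) <= partition_function a n.
  apply: (@saddle_lower_aux R l sg g) => //.
  - by lra.
  - by lra.
  - by move: gl; rewrite mulrDr mulr1; lra.
  - suff : 40 * sg < g by lra.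
    rewrite -(ltr_pM2r l10) gl; move: gl; rewrite mulrDr mulr1; lra.
  - by lra.
near=> n.
have n0 : (0 < n)%N by near: n; exact: nbhs_infty_gt.
have [d /andP[d1 d2] d3] : exists2 d : R,
    n%:R `^ (- g - 4 * sg) <= d <= n%:R `^ (- g + 4 * sg) &
    expR (d * n%:R + \sum_(1 <= j < n.+1) a j * expR (- (d * j%:R))
          - n%:R `^ ((10 * l + 32) * sg)) <= partition_function a n.
  by near: n.
exists d.
  apply/andP; split; [apply: le_trans d1 | apply: le_trans d2 _];
  by rewrite ler_powR ?ler1n //; lra.
apply: le_trans d3; rewrite ler_expR lerD2l lerN2 ler_powR ?ler1n //; lra.
Unshelve. all: by end_near. Qed.

Lemma near_partition_function_gt0 (R : realType) (l : R) (a : nat -> R) :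
  power_growth l a -> (forall j, 0 <= a j) -> 0 < l ->
  \forall n \near \oo, 0 < partition_function a n.
Proof.
move=> ga a0 l0; near=> n.
have [d _ h] : exists2 d : R, n%:R `^ (- (l + 1)^-1 - 1) <= d <= n%:R `^ (- (l + 1)^-1 + 1) &
    expR (d * n%:R + \sum_(1 <= j < n.+1) a j * expR (- (d * j%:R)) - n%:R `^ 1)
      <= partition_function a n by near: n; apply: saddle_lower.
by apply: lt_le_trans h; apply: expR_gt0.
Unshelve. all: by end_near. Qed.

(** A coefficient of a generating function is at most its value at [e ^ (- d)]
    divided by [e ^ (- d m)]. *)
Lemma partition_function_upper (R : realType) (a : nat -> R) (d : R) m n :
  (forall j, 0 <= a j) -> (m <= n)%N ->
  partition_function a m <=
  expR (d * m%:R + \sum_(1 <= j < n.+1) a j * expR (- (d * j%:R))).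
Proof.
move=> a0 mn; rewrite expRD -ler_pdivrMl ?expR_gt0 // -expRN.
rewrite -partition_function_tilt (partition_function_exp _ mn).
set f := size_gf n _.
have f_nn : nneg_poly f by apply: nneg_size_gf => i; rewrite mulr_ge0 ?expR_ge0.
have f1 : f.[1] = \sum_(1 <= j < n.+1) a j * expR (- (d * j%:R)).
  by rewrite horner_size_gf; apply: eq_bigr => j _; rewrite expr1n mulr1.
rewrite -f1; apply: le_trans (@exp_trunc_le _ n f 1 _); last exact: horner_nneg.
have := @chernoff_poly _ (exp_trunc n f) 1 1 m.+1 (pred1 m) (nneg_exp_trunc n f_nn) ler01.
rewrite mul1r big_nat1_eq ltnSn /=; apply => i _ _; by rewrite expr1n.
Qed.

(** The upper bound at [n - j] against the lower bound at [n], with the same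
    tilt. *)
Lemma partition_function_shift_le (R : realType) (a : nat -> R) (d y : R) n j :
  (forall j, 0 <= a j) -> (j <= n)%N ->
  expR (d * n%:R + \sum_(1 <= j < n.+1) a j * expR (- (d * j%:R)) - y)
    <= partition_function a n ->
  partition_function a (n - j) <= partition_function a n * expR (y - d * j%:R).
Proof.
move=> a0 jn h; apply: le_trans (partition_function_upper d a0 (leq_subr j n)) _.
apply: le_trans (ler_wpM2r (expR_ge0 _) h); rewrite -expRD ler_expR natrB //.
by rewrite le_eqVlt; apply/orP; left; apply/eqP; ring.
Qed.

(** Jensen's inequality for the exponential and the statistic
    [\sum_j f j * K j] under [mu]: the right-hand side is its exponential
    moment, and [partition_function a (n - j) / partition_function a n] comes
    from the mean of [K j]. *)
Lemma partition_function_jensen (R : realType) (a f : nat -> R) n :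
  (forall j, 0 <= a j) -> 0 < partition_function a n ->
  expR ((\sum_(1 <= j < n.+1) f j * a j * partition_function a (n - j))
        / partition_function a n) * partition_function a n <=
  partition_function (fun j => a j * expR (f j)) n.
Proof.
move=> a0 c0; set E := _ / _.
pose F (eta : Omega n) := \sum_(1 <= j < n.+1) f j * (K j eta)%:R.
have -> : partition_function (fun j => a j * expR (f j)) n =
    \sum_(eta : Omega n) expR (F eta) * weight a eta.
  apply: eq_bigr => eta _; rewrite /F expR_sum /weight -big_split /=.
  by apply: eq_bigr => i _; rewrite expRM_natr exprMn mulrAC mulrC.
have mean : \sum_(eta : Omega n) F eta * weight a eta = E * partition_function a n.
  rewrite /E divfK ?gt_eqF //.
  under eq_bigr do rewrite /F mulr_suml.
  rewrite exchange_big /=; apply: eq_big_nat => j /andP[j0 jn].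
  rewrite -mulrA -mean_count ?j0 // mulr_sumr; apply: eq_bigr => eta _.
  by rewrite mulrA.
have -> : expR E * partition_function a n =
    \sum_(eta : Omega n) expR E * (1 + (F eta - E)) * weight a eta.
  under [RHS]eq_bigr do rewrite -mulrA mulrDl mul1r mulrBl.
  rewrite -mulr_sumr big_split /= sumrB mean -mulr_sumr subrr addr0.
  by [].
apply: ler_sum => eta _; rewrite ler_wpM2r ?weight_ge0 //.
rewrite -[in leRHS](subrK E (F eta)) [_ - E + E]addrC expRD.
by rewrite ler_wpM2l ?expR_ge0 // expR_ge1Dx.
Qed.

(** The conditional mean of a statistic exceeds the logarithm of its
    unconditional exponential moment by at most [y], which bounds the logarithm
    of the inverse probability of the condition. *)
Lemma mean_le_cumulant (R : realType) (a f : nat -> R) (d y : R) n :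
  (forall j, 0 <= a j) ->
  expR (d * n%:R + \sum_(1 <= j < n.+1) a j * expR (- (d * j%:R)) - y)
    <= partition_function a n ->
  \sum_(1 <= j < n.+1) f j * a j * partition_function a (n - j) <=
  partition_function a n *
    (y + \sum_(1 <= j < n.+1) a j * expR (- (d * j%:R)) * (expR (f j) - 1)).
Proof.
move=> a0 h; have c0 : 0 < partition_function a n by apply: lt_le_trans h; apply: expR_gt0.
rewrite [leRHS]mulrC -ler_pdivrMr // -ler_expR.
rewrite -(ler_pM2r c0); apply: le_trans (partition_function_jensen f a0 c0) _.
have b0 j : 0 <= a j * expR (f j) by rewrite mulr_ge0 ?expR_ge0.
apply: le_trans (partition_function_upper d b0 (leqnn n)) _.
apply: le_trans (ler_wpM2l (expR_ge0 _) h); rewrite -expRD ler_expR.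
have -> : \sum_(1 <= j < n.+1) a j * expR (f j) * expR (- (d * j%:R)) =
   \sum_(1 <= j < n.+1) a j * expR (- (d * j%:R)) * (expR (f j) - 1)
   + \sum_(1 <= j < n.+1) a j * expR (- (d * j%:R)).
  by rewrite -big_split /=; apply: eq_bigr => j _; ring.
set X := \sum_(_ <= _ < _) _ * (_ - 1); set S := \sum_(_ <= _ < _) a _ * _.
by move: X S (d * _) => *; lra.
Qed.
(** * The largest group *)

Lemma PrE (R : realType) (a : nat -> R) n (E : pred (Omega n)) :
  Pr a E = (\sum_(eta : Omega n | E eta) weight a eta) / partition_function a n.
Proof. by rewrite mulr_suml. Qed.

Lemma mu_ge0 (R : realType) (a : nat -> R) n (eta : Omega n) :
  (forall j, 0 <= a j) -> 0 <= mu a eta.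
Proof. by move=> a0; rewrite divr_ge0 ?weight_ge0 ?partition_function_ge0. Qed.

Lemma Pr_ge0 (R : realType) (a : nat -> R) n (E : pred (Omega n)) :
  (forall j, 0 <= a j) -> 0 <= Pr a E.
Proof. by move=> a0; rewrite sumr_ge0 // => eta _; apply: mu_ge0. Qed.

Lemma Pr_le (R : realType) (a : nat -> R) n (E F : pred (Omega n)) :
  (forall j, 0 <= a j) -> (forall eta, E eta -> F eta) -> Pr a E <= Pr a F.
Proof.
move=> a0 EF; rewrite /Pr big_mkcond [leRHS]big_mkcond; apply: ler_sum => eta _.
have := EF eta; case: (E eta) => [->//|_]; case: (F eta) => //; exact: mu_ge0.
Qed.

Lemma Pr_le_mean (R : realType) (a : nat -> R) n (E : pred (Omega n))
    (X : Omega n -> R) :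
  (forall j, 0 <= a j) -> (forall eta, 0 <= X eta) ->
  (forall eta, E eta -> 1 <= X eta) ->
  Pr a E <= (\sum_(eta : Omega n) X eta * weight a eta) / partition_function a n.
Proof.
move=> a0 X0 EX; rewrite PrE ler_wpM2r ?invr_ge0 ?partition_function_ge0 //.
rewrite big_mkcond; apply: ler_sum => eta _; case: ifP => [/EX h|_].
  by rewrite ler_peMl ?weight_ge0.
by rewrite mulr_ge0 ?weight_ge0.
Qed.

Lemma Pr_predC (R : realType) (a : nat -> R) n (E : pred (Omega n)) :
  partition_function a n != 0 -> Pr a E = 1 - Pr a (predC E).
Proof.
move=> c0; apply/eqP; rewrite eq_sym subr_eq eq_sym; apply/eqP.
transitivity (\sum_(eta : Omega n) mu a eta); last by rewrite -mulr_suml mulfV.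
by rewrite [RHS](bigID E).
Qed.

Lemma cvg_to0 (R : realType) (u : nat -> R) :
  (forall n, 0 <= u n) -> (forall e, 0 < e -> \forall n \near \oo, u n <= e) ->
  u n @[n --> \oo] --> (0 : R).
Proof.
move=> u0 h; apply/cvgrPdist_le => e e0; near=> n.
by rewrite sub0r normrN ger0_norm //; near: n; apply: h.
Unshelve. all: by end_near. Qed.

Lemma qbar_gt (n : nat) (eta : Omega n) (R : realDomainType) (x : R) j :
  (0 < j <= n)%N -> (0 < K j eta)%N -> x < j%:R -> x < (qbar eta)%:R.
Proof.
move=> /andP[j0 jn] Kj xj; apply: lt_le_trans xj _; rewrite ler_nat /qbar.
by rewrite big_mkcond (bigD1_seq j) ?iota_uniq ?mem_index_iota ?j0 ?ltnS //= Kj leq_maxl.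
Qed.

Lemma qbar_lt (n : nat) (eta : Omega n) (R : realDomainType) (x : R) :
  0 < x -> (forall j, (0 < j <= n)%N -> x <= j%:R -> K j eta = 0%N) ->
  (qbar eta)%:R < x.
Proof.
move=> x0 h; rewrite /qbar big_nat_cond.
elim/big_ind: _ => // [u v ux vx|j]; first by rewrite /maxn; case: ifP.
move=> /andP[/andP[j1 jn] Kj]; rewrite ltNge; apply/negP => /h hj.
by rewrite hj // j1 in Kj.
Qed.

(** Forbidding the sizes in [[M, 2M)] removes their mass from the exponent
    [\sum_j a j * expR (- (d * j))]. *)
Lemma Pr_no_block (R : realType) (a : nat -> R) (d y : R) n M :
  (forall j, 0 <= a j) ->
  expR (d * n%:R + \sum_(1 <= j < n.+1) a j * expR (- (d * j%:R)) - y)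
    <= partition_function a n ->
  Pr a (fun eta : Omega n => [forall j : 'I_n, (M <= j.+1 < M.*2)%N ==> (K j.+1 eta == 0%N)])
  <= expR (y - \sum_(1 <= j < n.+1 | (M <= j < M.*2)%N) a j * expR (- (d * j%:R))).
Proof.
move=> a0 h; set A := \sum_(_ <= _ < _ | _) _.
have c0 : 0 < partition_function a n by apply: lt_le_trans h; apply: expR_gt0.
pose J j := (M <= j < M.*2)%N.
pose a' j := if J j then 0 else a j.
have a'0 j : 0 <= a' j by rewrite /a'; case: ifP.
rewrite PrE ler_pdivrMr //.
apply: (@le_trans _ _ (partition_function a' n)).
  rewrite big_mkcond; apply: ler_sum => eta _.
  case: ifP => [/forallP E|_]; last exact: weight_ge0.
  rewrite le_eqVlt; apply/orP; left; apply/eqP; rewrite /weight.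
  apply: eq_big_nat => i /andP[i1 iN]; rewrite /a'; case: ifP => // Ji.
  have i' : (i.-1 < n)%N by rewrite prednK.
  have := E (Ordinal i'); rewrite /= prednK // -/(J i) Ji /= => /eqP ->.
  by rewrite !expr0.
apply: le_trans (partition_function_upper d a'0 (leqnn n)) _.
apply: le_trans (ler_wpM2l (expR_ge0 _) h); rewrite -expRD ler_expR.
have -> : \sum_(1 <= j < n.+1) a j * expR (- (d * j%:R)) =
    A + \sum_(1 <= j < n.+1) a' j * expR (- (d * j%:R)).
  rewrite [A]big_mkcond -big_split /=; apply: eq_bigr => j _.
  by rewrite /a' -/(J j); case: ifP => _; rewrite ?mul0r ?addr0 ?add0r.
by move: A (\sum_(_ <= _ < _) _) (d * _) => *; lra.
Qed.

(** If all groups were smaller than [n ^ e] no size near [n ^ f], with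
    [e < f < 1 / (l + 1)], would occur, although the mass of these sizes is a
    positive power of [n]. *)
Lemma Pr_qbar_low (R : realType) (l e : R) (a : nat -> R) :
  power_growth l a -> (forall j, 0 <= a j) -> 0 < l -> e < (l + 1)^-1 ->
  Pr a (fun eta : Omega n => (qbar eta)%:R <= n%:R `^ e) @[n --> \oo] --> (0 : R).
Proof.
move=> ga a0 l0 eg; set g := (l + 1)^-1 in eg.
have g0 : 0 < g by rewrite invr_gt0 addr_gt0.
(* [e] may be negative, but the sizes of the block must tend to infinity. *)
pose f := (Num.max e 0 + g) / 2.
have me : e <= Num.max e 0 by rewrite le_max lexx.
have m0e : 0 <= Num.max e 0 by rewrite le_max lexx orbT.
have fe : e < f by rewrite /f; lra.
have f0 : 0 < f by rewrite /f; lra.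
have fg : f < g by have : Num.max e 0 < g; [rewrite gt_max eg|rewrite /f; lra].
pose s := Num.min (g - f) (Num.min l (f * l / 2)) / 4.
have : 0 < Num.min (g - f) (Num.min l (f * l / 2)).
  by rewrite !lt_min subr_gt0 fg l0 /= divr_gt0 // mulr_gt0.
have : Num.min (g - f) (Num.min l (f * l / 2)) <= g - f by rewrite ge_min lexx.
have : Num.min (g - f) (Num.min l (f * l / 2)) <= l by rewrite !ge_min lexx orbT.
have : Num.min (g - f) (Num.min l (f * l / 2)) <= f * l / 2 by rewrite !ge_min lexx !orbT.
set m := Num.min _ _ in s * => m1 m2 m3 m0.
have s0 : 0 < s by rewrite /s; lra.
have sl : 0 <= l - s by rewrite /s; lra.
have sgf : - g + s + f < 0 by rewrite /s; lra.
have sfl : s < f * (l - s).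
  have : f * s <= f * (l / 4) by rewrite ler_pM2l // /s; lra.
  by rewrite mulrBr /s; lra.
have [J hJ] := growth_lower ga s0.
apply: cvg_to0 => [n|eps eps0]; first exact: Pr_ge0.
near=> n.
have n0 : (0 < n)%N by near: n; exact: nbhs_infty_gt.
have [d /andP[d1 d2] low] : exists2 d : R, n%:R `^ (- g - s) <= d <= n%:R `^ (- g + s) &
    expR (d * n%:R + \sum_(1 <= j < n.+1) a j * expR (- (d * j%:R)) - n%:R `^ s)
      <= partition_function a n.
  by near: n; apply: saddle_lower.
pose M := Num.truncn (n%:R `^ f : R).
have /andP[M1 M2] := truncn_powR n0 (ltW f0); rewrite -/M in M1 M2.
have JM : (J < M)%N.
  rewrite -(ler_nat R); apply: le_trans M1; rewrite ler_pdivlMr //.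
  by near: n; apply: near_le_powR; lra.
have Mn : (2 * M <= n)%N.
  rewrite -(ler_nat R) natrM; apply: (@le_trans _ _ (2 * n%:R `^ f)).
    by rewrite ler_wpM2l.
  rewrite -[leRHS]powRr1 //; near: n; apply: near_powR_le.
  by rewrite (lt_trans fg) // invf_lt1 ?ltrDr ?addr_gt0.
have dM : d * (2 * M%:R) <= 1.
  have d0 : 0 <= d by apply: le_trans d1; apply: powR_ge0.
  apply: (@le_trans _ _ (n%:R `^ (- g + s) * (2 * n%:R `^ f))).
    by rewrite ler_pM ?mulr_ge0 ?ler_wpM2l.
  rewrite mulrCA -powRD_nat // -[leRHS](powRr0 n%:R); near: n; exact: near_powR_le.
have Me : n%:R `^ e < M%:R.
  apply: lt_le_trans M1; rewrite ltr_pdivlMr // mulrC.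
  apply: (@lt_le_trans _ _ (3 * n%:R `^ e)); last by near: n; apply: near_powR_le.
  by rewrite ltr_pM2r ?powR_gt0 ?ltr0n // ltr_nat.
have := block_mass hJ a0 sl JM Mn dM => mass.
apply: (@le_trans _ _ (expR (n%:R `^ s - M%:R `^ (l - s) / (2 * expR 1)))).
  apply: le_trans (_ : _ <= expR (n%:R `^ s - \sum_(1 <= j < n.+1 | (M <= j < M.*2)%N)
       a j * expR (- (d * j%:R)))) _; last by rewrite ler_expR lerD2l lerN2.
  apply: le_trans (Pr_no_block M a0 low); apply: Pr_le => // eta hq.
  apply/forallP => j; apply/implyP => /andP[j1 j2]; rewrite -leqn0 leqNgt.
  apply/negP => Kj; move: hq; apply/negP; rewrite -ltNge.
  by apply: (qbar_gt _ Kj); rewrite ?ltn_ord // (lt_le_trans Me) // ler_nat.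
have big : 2 * n%:R `^ s <= M%:R `^ (l - s) / (2 * expR 1).
  have := truncn_powR_pow n0 (ltW f0) sl; rewrite -/M => h.
  have p2 : 0 < 2 `^ (l - s) :> R by rewrite powR_gt0.
  rewrite ler_pdivlMr ?mulr_gt0 ?expR_gt0 // -(ler_pM2l p2); apply: le_trans h.
  rewrite [leLHS](_ : _ = 2 `^ (l - s) * (4 * expR 1) * n%:R `^ s); last by ring.
  by near: n; apply: near_powR_le.
apply: (@le_trans _ _ (expR (- (1 * n%:R `^ s)))); first by rewrite ler_expR; lra.
have : eps^-1 * n%:R `^ 0 * expR (- (1 * n%:R `^ s)) <= 1.
  by near: n; apply: near_powR_expR.
by rewrite powRr0 mulr1 ler_pdivrMl // mulr1.
Unshelve. all: by end_near. Qed.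

(** The mean number of groups larger than [n ^ e] is at most a power of [n]
    times [expR (n ^ s - d * n ^ e)], and [d * n ^ e] is a positive power of
    [n]. *)
Lemma Pr_qbar_high (R : realType) (l e : R) (a : nat -> R) :
  power_growth l a -> (forall j, 0 <= a j) -> 0 < l -> (l + 1)^-1 < e ->
  Pr a (fun eta : Omega n => n%:R `^ e <= (qbar eta)%:R) @[n --> \oo] --> (0 : R).
Proof.
move=> ga a0 l0 eg; set g := (l + 1)^-1 in eg.
have g0 : 0 < g by rewrite invr_gt0 addr_gt0.
pose s := (e - g) / 4; have s0 : 0 < s by rewrite /s; lra.
have [C C0 hC] := growth_upper ga s0 (ltW l0) a0.
apply: cvg_to0 => [n|eps eps0]; first exact: Pr_ge0.
near=> n.
have n0 : (0 < n)%N by near: n; exact: nbhs_infty_gt.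
have [d /andP[d1 d2] low] : exists2 d : R, n%:R `^ (- g - s) <= d <= n%:R `^ (- g + s) &
    expR (d * n%:R + \sum_(1 <= j < n.+1) a j * expR (- (d * j%:R)) - n%:R `^ s)
      <= partition_function a n.
  by near: n; apply: saddle_lower.
have c0 : 0 < partition_function a n by apply: lt_le_trans low; apply: expR_gt0.
have d0 : 0 <= d by apply: le_trans d1; apply: powR_ge0.
pose X (eta : Omega n) := \sum_(1 <= j < n.+1 | n%:R `^ e <= j%:R) (K j eta)%:R : R.
apply: le_trans (Pr_le_mean (X := X) a0 _ _) _.
- by move=> eta; apply: sumr_ge0.
- move=> eta; apply: contraTT; rewrite -!ltNge => X1.
  apply: qbar_lt; first by rewrite powR_gt0 ?ltr0n.
  move=> j /andP[j0 jn] ej; apply/eqP; rewrite -leqn0 leqNgt; apply/negP => Kj.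
  move: X1; apply/negP; rewrite -leNgt /X big_mkcond.
  rewrite (bigD1_seq j) ?iota_uniq ?mem_index_iota ?j0 ?ltnS //= ej.
  rewrite -[leLHS]addr0 lerD ?ler1n //; apply: sumr_ge0 => i _; by case: ifP.
rewrite ler_pdivrMr //.
have -> : \sum_eta X eta * weight a eta =
    \sum_(1 <= j < n.+1 | n%:R `^ e <= j%:R) a j * partition_function a (n - j).
  under eq_bigr do rewrite /X mulr_suml.
  rewrite exchange_big /= big_nat_cond [RHS]big_nat_cond.
  by apply: eq_bigr => j /andP[/andP[j0 jn] _]; rewrite mean_count ?j0.
pose B := C * n%:R `^ (l + s) * expR (- (1 * n%:R `^ s)).
have ns : 2 * n%:R `^ s <= d * n%:R `^ e.
  apply: (@le_trans _ _ (n%:R `^ (- g - s) * n%:R `^ e)); last first.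
    by rewrite ler_wpM2r ?powR_ge0.
  by rewrite -powRD_nat //; near: n; apply: near_powR_le; rewrite /s; lra.
apply: (@le_trans _ _ (\sum_(1 <= j < n.+1) B * partition_function a n)).
  rewrite big_mkcond; apply: ler_sum_nat => j /andP[j0 jn].
  have Bc : 0 <= B * partition_function a n.
    by rewrite !mulr_ge0 ?powR_ge0 ?expR_ge0 ?(ltW C0) ?(ltW c0).
  case: ifP => // ej.
  rewrite /B -[leRHS]mulrA; apply: ler_pM; rewrite ?partition_function_ge0 //.
    apply: (@le_trans _ _ (j%:R * a j)); first by rewrite ler_peMl // ler1n.
    apply: le_trans (hC j j0) _; rewrite ler_wpM2l ?(ltW C0) //.
    by rewrite ge0_ler_powR ?nnegrE ?ler_nat // addr_ge0 ?ltW.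
  rewrite mulrC; apply: le_trans (partition_function_shift_le a0 _ low) _ => //.
  rewrite ler_wpM2l ?(ltW c0) // ler_expR.
  have : d * n%:R `^ e <= d * j%:R by rewrite ler_wpM2l.
  by move: ns; move: (d * _) (d * _) (n%:R `^ s) => *; lra.
rewrite sumr_const_nat subn1 /= -mulr_natl mulrA ler_wpM2r ?(ltW c0) //.
have : eps^-1 * C * n%:R `^ (1 + (l + s)) * expR (- (1 * n%:R `^ s)) <= 1.
  by near: n; apply: near_powR_expR.
rewrite powRD_nat // powRr1 // -!mulrA ler_pdivrMl // mulr1 => h.
by apply: le_trans h; rewrite /B; rewrite le_eqVlt; apply/orP; left; apply/eqP; ring.
Unshelve. all: by end_near. Qed.
(** * Ratios of partition functions *)

Lemma expRB1_le (R : realType) (x : R) : `|x| <= 2^-1 ->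
  expR x - 1 <= x + 2 * x ^+ 2.
Proof.
rewrite ler_norml => /andP[x1 x2]; have [x0|x0] := lerP 0 x.
  have := expR_le_quad x0; have : expR x <= 2.
    have : expR x * (1 - x) <= 1.
      by rewrite -[leRHS](expRxMexpNx_1 x) ler_wpM2l ?expR_ge0 // expR_ge1Dx.
    by have := expR_ge0 x; nra.
  move=> /(ler_wpM2l (sqr_ge0 x)); move: (expR x) (x ^+ 2) => *; lra.
have := @expRN_le_quad _ (- x); rewrite opprK oppr_ge0 sqrrN => /(_ (ltW x0)).
by have := sqr_ge0 x; move: (expR x) (x ^+ 2) => *; lra.
Qed.

Lemma sum_interval (R : nmodType) (F : nat -> R) n m p :
  (0 < m)%N -> (p <= n.+1)%N ->
  \sum_(1 <= j < n.+1 | (m <= j < p)%N) F j = \sum_(m <= j < p) F j.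
Proof.
by move=> m0 pn; rewrite [RHS](big_nat_widenl m 1) // [RHS](big_nat_widen _ _ n.+1).
Qed.

(** [mean_le_cumulant] for the statistics with coefficients [t / a j] and
    [- t / a j] on the interval: these coefficients turn the mean of the
    statistic into the plain sum of the [partition_function a (n - j)].  The
    choice [t = th / al] keeps the coefficients below [th], so the exponential
    moments are linear up to a relative error [th]. *)
Lemma interval_mean (R : realType) (a : nat -> R) (d y al th : R) n m M :
  (forall j, 0 <= a j) -> 0 <= d ->
  expR (d * n%:R + \sum_(1 <= j < n.+1) a j * expR (- (d * j%:R)) - y)
    <= partition_function a n ->
  (0 < m)%N -> (m + M <= n.+1)%N ->
  (forall j, (m <= j < m + M)%N -> 0 < a j /\ (a j)^-1 <= al) ->
  0 < al -> 0 < th <= 2^-1 -> y * al <= th ^+ 2 * M%:R -> d * (m + M)%:R <= th ->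
  `|\sum_(m <= j < m + M) partition_function a (n - j) - M%:R * partition_function a n|
    <= 4 * th * (M%:R * partition_function a n).
Proof.
move=> a0 d0 low m0 mMn aJ al0 /andP[th0 th2] hy hd.
have c0 : 0 < partition_function a n by apply: lt_le_trans low; apply: expR_gt0.
set c := partition_function a n in low c0 *.
set S := \sum_(m <= j < m + M) _.
pose t := th / al; have t0 : 0 < t by rewrite divr_gt0.
have tal : t * al = th by rewrite divfK // gt_eqF.
have yt : y <= th * t * M%:R.
  rewrite -(ler_pM2r al0); apply: le_trans hy _.
  rewrite (_ : th * t * M%:R * al = th * (t * al) * M%:R); last by ring.
  by rewrite tal expr2.
pose J j := (m <= j < m + M)%N.
have key (e : R) (w : R) : `|e| = 1 ->
    (forall j, J j -> a j * expR (- (d * j%:R)) * (expR (e * t / a j) - 1) <= t * w) ->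
    e * t * S <= c * (y + M%:R * (t * w)).
  move=> e1 hw; pose f j := if J j then e * t / a j else 0.
  have := mean_le_cumulant f a0 low.
  have -> : \sum_(1 <= j < n.+1) f j * a j * partition_function a (n - j) = e * t * S.
    rewrite /S -(sum_interval _ m0 mMn) mulr_sumr [RHS]big_mkcond.
    apply: eq_bigr => j _; rewrite /f -/(J j); case: ifP => [/aJ[aj _]|_].
      by rewrite divfK // gt_eqF.
    by rewrite !mul0r.
  move=> /le_trans; apply; rewrite ler_wpM2l ?(ltW c0) // lerD2l.
  apply: (@le_trans _ _ (\sum_(1 <= j < n.+1 | (m <= j < m + M)%N) t * w)); last first.
    by rewrite sum_interval // sumr_const_nat addKn mulr_natl.
  rewrite [leRHS]big_mkcond; apply: ler_sum => j _.
  rewrite /f -/(J j); case: ifP => [|_]; first exact: hw.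
  by rewrite expR0 subrr mulr0.
have small e j : `|e| = 1 -> J j -> `|e * t / a j| <= 2^-1.
  move=> e1 /aJ[aj aja]; rewrite -mulrA normrM e1 mul1r ger0_norm; last first.
    by rewrite divr_ge0 ?ltW.
  by apply: le_trans th2; rewrite -tal ler_wpM2l // ltW.
have quad e j : `|e| = 1 -> J j ->
    a j * (expR (e * t / a j) - 1) <= e * t + 2 * (t * th).
  move=> e1 jJ; have [aj aja] := aJ j jJ.
  apply: (@le_trans _ _ (a j * (e * t / a j + 2 * (e * t / a j) ^+ 2))).
    by rewrite ler_wpM2l ?(ltW aj) // expRB1_le // small.
  have e2 : e ^+ 2 = 1 by rewrite -(real_normK (num_real e)) e1 expr1n.
  rewrite (_ : a j * _ = e * t + 2 * (e ^+ 2 * (t * (t * (a j)^-1)))); last first.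
    by field; rewrite gt_eqF.
  by rewrite e2 mul1r lerD2l !ler_wpM2l ?(ltW t0) // -tal ler_wpM2l // ltW.
have dj j : J j -> d * j%:R <= th.
  by move=> /andP[_ jm]; apply: le_trans hd; rewrite ler_wpM2l // ler_nat ltnW.
have E1 j : expR (- (d * j%:R)) <= 1.
  by rewrite -[leRHS]expR0 ler_expR oppr_le0 mulr_ge0.
have E2 j : J j -> 1 - th <= expR (- (d * j%:R)).
  by move=> /dj h; apply: le_trans (expR_ge1Dx _); lra.
have up : S <= c * (M%:R * (1 + 3 * th)).
  have : 1 * t * S <= c * (y + M%:R * (t * (1 + 2 * th))).
    apply: key => [|j jJ]; first by rewrite normr1.
    rewrite mulrAC; apply: le_trans (_ : _ <= a j * (expR (1 * t / a j) - 1)) _.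
      rewrite ler_piMr ?E1 // mulr_ge0 // subr_ge0 -[leLHS](expR0 R) ler_expR.
      by rewrite mul1r divr_ge0 // ltW.
    by apply: le_trans (quad 1 j (normr1 _) jJ) _; lra.
  rewrite mul1r => h; rewrite -(ler_pM2l t0); apply: le_trans h _.
  rewrite [leRHS]mulrCA ler_wpM2l ?(ltW c0) //.
  by move: yt; clear; lra.
have lo : c * (M%:R * (1 - 4 * th)) <= S.
  have : -1 * t * S <= c * (y + M%:R * (t * (3 * th - 1))).
    apply: key => [|j jJ]; first by rewrite normrN1.
    rewrite mulrAC; have := quad (-1) j (normrN1 _) jJ.
    set X := a j * _ => hX; have := E2 j jJ; have := E1 j; move: (expR (- _)) => E E1' E2'.
    have E0 : 0 <= E by lra.
    apply: le_trans (ler_wpM2r E0 hX) _.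
    have : t * (1 - th) <= t * E by rewrite ler_pM2l.
    have : t * th * E <= t * th by rewrite ler_piMr // mulr_ge0 ?ltW.
    by clear => *; lra.
  rewrite mulN1r mulNr => h; rewrite -(ler_pM2l t0) -lerN2; apply: le_trans h _.
  rewrite (mulrCA t c) -mulrN ler_wpM2l ?(ltW c0) //.
  by move: yt; clear; lra.
by rewrite ler_norml; apply/andP; split; move: lo up; clear; lra.
Qed.

(** The inverse parameters are at most [n ^ e2 / M ^ (l - s)], so the condition
    on [y * al] of [interval_mean] reads [e2 + s < e1 * (1 + l - s)]. *)
Lemma interval_mean_near (R : realType) (l e1 e2 th : R) (a : nat -> R) :
  power_growth l a -> (forall j, 0 <= a j) -> 0 < l ->
  0 < e1 -> e1 <= 1 -> e2 < (l + 1)^-1 -> e2 < e1 * (1 + l) -> 0 < th <= 1 ->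
  \forall n \near \oo, forall m M : nat,
    n%:R `^ e1 <= M%:R -> (M <= m)%N -> (m + M)%:R <= n%:R `^ e2 ->
    `|\sum_(m <= j < m + M) partition_function a (n - j)
       - M%:R * partition_function a n|
    <= th * (M%:R * partition_function a n).
Proof.
move=> ga a0 l0 e10 e11 e2g e2e1 /andP[th0 th1]; set g := (l + 1)^-1 in e2g.
have g0 : 0 < g by rewrite invr_gt0 addr_gt0.
have g1 : g < 1 by rewrite invf_lt1 ?addr_gt0 // ltrDr.
pose q := Num.min (g - e2) (Num.min l (e1 * (1 + l) - e2)).
have q0 : 0 < q by rewrite !lt_min !subr_gt0 e2g l0 e2e1.
have q1 : q <= g - e2 by rewrite ge_min lexx.
have q2 : q <= l by rewrite !ge_min lexx orbT.
have q3 : q <= e1 * (1 + l) - e2 by rewrite !ge_min lexx !orbT.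
pose s := q / 4; have s0 : 0 < s by rewrite /s; lra.
have qs : q = 4 * s by rewrite /s mulrC divfK.
have se1 : e1 * s <= s by rewrite ler_piMl // ltW.
have ls0 : 0 <= l - s by rewrite /s; lra.
have [J hJ] := growth_lower ga s0.
pose t := th / 4; have t0 : 0 < t by rewrite /t; lra.
near=> n => m M M1 Mm mM.
have n0 : (0 < n)%N by near: n; exact: nbhs_infty_gt.
have [d /andP[d1 d2] low] : exists2 d : R, n%:R `^ (- g - s) <= d <= n%:R `^ (- g + s) &
    expR (d * n%:R + \sum_(1 <= j < n.+1) a j * expR (- (d * j%:R)) - n%:R `^ s)
      <= partition_function a n.
  by near: n; apply: saddle_lower.
have d0 : 0 <= d by apply: le_trans d1; apply: powR_ge0.
have JM : (J < M)%N.
  rewrite -(ltr_nat R); apply: lt_le_trans M1.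
  apply: (@lt_le_trans _ _ J.+1%:R); first by rewrite ltr_nat.
  by near: n; apply: near_le_powR.
have M0 : (0 < M)%N by apply: leq_trans JM.
have Mr0 : 0 < M%:R :> R by rewrite ltr0n.
pose al := n%:R `^ e2 / M%:R `^ (l - s).
have al0 : 0 < al by rewrite divr_gt0 ?powR_gt0 ?ltr0n.
rewrite -[th](_ : 4 * t = th); last by rewrite /t mulrC divfK.
apply: (interval_mean (al := al) a0 d0 low) => //.
- exact: leq_trans Mm.
- rewrite -(ler_nat R) (le_trans mM) //; apply: (@le_trans _ _ n%:R); last by rewrite ler_nat.
  by rewrite -[leRHS]powRr1 // ler_powR ?ler1n //; lra.
- move=> j /andP[mj jm].
  have Mj : (M <= j)%N by apply: leq_trans mj.
  have j0 : (0 < j)%N by apply: leq_trans Mj.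
  have jr : 0 < j%:R :> R by rewrite ltr0n.
  have ja : M%:R `^ (l - s) <= j%:R * a j.
    apply: le_trans (hJ j _); last by apply: leq_trans Mj; apply: ltnW.
    by rewrite ge0_ler_powR ?nnegrE ?ler_nat.
  have Mp : 0 < M%:R `^ (l - s) :> R by rewrite powR_gt0.
  have aj : 0 < a j by rewrite -(pmulr_rgt0 _ jr); apply: lt_le_trans ja.
  split=> //; rewrite /al ler_pdivlMr // mulrC ler_pdivrMr //.
  apply: le_trans ja _; rewrite ler_wpM2r ?(ltW aj) //; apply: le_trans mM.
  by rewrite ler_nat ltnW.
- by rewrite t0 /= /t; lra.
- rewrite /al mulrA ler_pdivrMr ?powR_gt0 //.
  have -> : t ^+ 2 * M%:R * M%:R `^ (l - s) = t ^+ 2 * M%:R `^ (1 + (l - s)).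
    by rewrite (powRD_nat 1 (l - s) M0) powRr1 // mulrA.
  apply: (@le_trans _ _ (t ^+ 2 * n%:R `^ (e1 * (1 + (l - s))))); last first.
    rewrite ler_wpM2l ?sqr_ge0 // powRrM ge0_ler_powR ?nnegrE ?powR_ge0 //.
    by rewrite addr_ge0.
  rewrite -powRD_nat // -ler_pdivrMl ?exprn_gt0 //.
  by near: n; apply: near_powR_le; lra.
apply: (@le_trans _ _ (n%:R `^ (- g + s) * n%:R `^ e2)); first by rewrite ler_pM.
rewrite -powRD_nat // -[leRHS]mulr1 -ler_pdivrMl // -[leRHS](powRr0 n%:R).
by near: n; apply: near_powR_le; rewrite /s; lra.
Unshelve. all: by end_near. Qed.

Lemma ratio_of_averages (R : realFieldType) (c c' t S M th : R) :
  0 < M -> 0 < c -> 0 <= c' -> 0 < t -> t <= 4^-1 -> 4 * t <= th ->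
  `|S - M * c| <= t * (M * c) -> `|S - M * c'| <= t * (M * c') ->
  `|c' / c - 1| <= th.
Proof.
move=> M0 c0 c'0 t0 t4 tth; rewrite !ler_norml => /andP[u1 u2] /andP[v1 v2].
have w1 : (1 - t) * c' <= (1 + t) * c by rewrite -(ler_pM2l M0); lra.
have w2 : (1 - t) * c <= (1 + t) * c' by rewrite -(ler_pM2l M0); lra.
have z1 : c' <= (1 + 4 * t) * c.
  rewrite -(@ler_pM2l _ (1 - t)); last by lra.
  apply: le_trans w1 _; rewrite mulrA ler_wpM2r ?(ltW c0) //.
  by nra.
have z2 : (1 - 4 * t) * c <= c'.
  rewrite -(@ler_pM2l _ (1 + t)); last by lra.
  apply: le_trans w2; rewrite mulrA ler_wpM2r ?(ltW c0) //.
  by nra.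
apply/andP; split.
  rewrite lerBrDr ler_pdivlMr //; apply: le_trans z2.
  by rewrite ler_wpM2r ?(ltW c0) //; lra.
rewrite lerBlDr ler_pdivrMr //; apply: le_trans z1 _.
by rewrite ler_wpM2r ?(ltW c0) //; lra.
Qed.

(** The sums over [[M, 2M)] for [n - p] and over [[M + p, 2M + p)] for [n]
    are the same sum, and both are close to [M] times the corresponding
    partition function. *)
Lemma ratio_limit (R : realType) (l be th : R) (a : nat -> R) :
  power_growth l a -> (forall j, 0 <= a j) -> 0 < l -> be < (l + 1)^-1 -> 0 < th ->
  \forall n \near \oo, 0 < partition_function a n /\
    forall p : nat, p%:R <= n%:R `^ be ->
    `|partition_function a (n - p) / partition_function a n - 1| <= th.
Proof.
move=> ga a0 l0 beg th0; set g := (l + 1)^-1 in beg.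
have g0 : 0 < g by rewrite invr_gt0 addr_gt0.
have gl : g * (l + 1) = 1 by rewrite mulVf // gt_eqF // addr_gt0.
have g1 : g < 1 by rewrite invf_lt1 ?addr_gt0 // ltrDr.
pose q := Num.min (g - be) (g * (g * l)).
have gl0 : 0 < g * l by rewrite mulr_gt0.
have q0 : 0 < q by rewrite !lt_min !subr_gt0 beg mulr_gt0.
have q1 : q <= g - be by rewrite ge_min lexx.
have q2 : q <= g * (g * l) by rewrite !ge_min lexx orbT.
pose k := q / 4.
have qk : q = 4 * k by rewrite /k mulrC divfK.
(* Three exponents between [be] and [g], close enough to [g] for the last
   condition of [interval_mean_near]. *)
pose e1 := g - 3 * k; pose be' := g - 2 * k; pose e2 := g - k.
have k0 : 0 < k by lra.
have gl1 : g * l = 1 - g by move: gl; rewrite mulrDr mulr1 => <-; ring.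
have gg : g * (g * l) <= g * (1 - g) by rewrite gl1.
have e10 : 0 < e1 by rewrite /e1; nra.
have e1e2 : e2 < e1 * (1 + l).
  rewrite /e1 /e2 [1 + l]addrC mulrBl gl.
  have : 3 * k * (l + 1) * 4 <= 3 * (1 - g).
    rewrite (_ : _ * 4 = 3 * (l + 1) * q); last by rewrite qk; ring.
    apply: (@le_trans _ _ (3 * (l + 1) * (g * (g * l)))).
      by rewrite ler_wpM2l // mulr_ge0 // addr_ge0 // ltW.
    rewrite (_ : 3 * (l + 1) * (g * (g * l)) = 3 * (g * (l + 1)) * (g * l)); last by ring.
    by rewrite gl mulr1 gl1.
  by lra.
pose t := Num.min th 1 / 4.
have tm : 0 < Num.min th 1 by rewrite lt_min th0 ltr01.
have tm1 : Num.min th 1 <= 1 by rewrite ge_min lexx orbT.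
have tmth : Num.min th 1 <= th by rewrite ge_min lexx.
have t0 : 0 < t by rewrite /t; lra.
have t4 : t <= 4^-1 by rewrite /t; lra.
have tth : 4 * t <= th by rewrite /t mulrC divfK.
have := @interval_mean_near R l e1 e2 t a ga a0 l0 e10.
move=> /(_ _ _ e1e2) [||| N _ hN].
- by rewrite /e1; lra.
- by rewrite -/g /e2; lra.
- by rewrite t0 /=; lra.
have bebe : be <= be' by rewrite /be'; lra.
have be'e2 : be' < e2 by rewrite /be' /e2; lra.
have e1be : e1 < be' by rewrite /be' /e1; lra.
have be'1 : be' < 1 by rewrite /be'; lra.
have e20 : 0 <= e2 by apply: ltW (lt_trans e10 (lt_trans e1be be'e2)).
have c0 := near_partition_function_gt0 ga a0 l0.
near=> n.
have n0 : (0 < n)%N by near: n; exact: nbhs_infty_gt.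
have cpos : 0 < partition_function a n by near: n.
split=> // p pn.
pose M := Num.truncn (n%:R `^ be' : R).
have be'0 : 0 <= be' := ltW (lt_trans e10 e1be).
have /andP[M1 M2] := truncn_powR n0 be'0; rewrite -/M in M1 M2.
have eM : n%:R `^ e1 <= M%:R.
  apply: le_trans M1; rewrite ler_pdivlMr // mulrC.
  by near: n; apply: near_powR_le.
have pM : p%:R <= n%:R `^ be'.
  by apply: le_trans pn _; rewrite ler_powR ?ler1n.
have p2 : 2 * p%:R <= n%:R :> R.
  apply: (@le_trans _ _ (2 * n%:R `^ be')); first by rewrite ler_wpM2l.
  by rewrite -[leRHS]powRr1 //; near: n; apply: near_powR_le.
have pn' : (2 * p <= n)%N by rewrite -(ler_nat R) natrM.
have pn1 : (p <= n)%N by apply: leq_trans pn'; rewrite leq_pmull.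
have npn : n%:R / 2 <= (n - p)%:R :> R.
  by rewrite natrB //; move: p2; move: (n%:R) (p%:R); clear; move=> *; lra.
have C3 : 3 * n%:R `^ be' <= n%:R `^ e2.
  by near: n; apply: near_powR_le.
have h1 := hN n _ (M + p)%N M eM (leq_addr _ _) _.
have h2 := hN (n - p)%N _ M M _ (leqnn _) _.
have : `|\sum_(M + p <= j < M + p + M) partition_function a (n - j)
    - M%:R * partition_function a n| <= t * (M%:R * partition_function a n).
  apply: h1; first by near: n; exists N.
  apply: le_trans C3; rewrite !natrD; move: M2 pM.
  by move: (n%:R `^ be') (M%:R) (p%:R); clear; move=> *; lra.
have : `|\sum_(M <= j < M + M) partition_function a (n - p - j)
    - M%:R * partition_function a (n - p)| <= t * (M%:R * partition_function a (n - p)).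
  apply: h2.
  - rewrite /= -(ler_nat R); apply: le_trans npn.
    by rewrite ler_pdivlMr //; near: n; exact: nbhs_infty_ger.
  - apply: le_trans eM; rewrite ge0_ler_powR ?nnegrE ?(ltW e10) //.
    by rewrite ler_nat leq_subr.
  - apply: (@le_trans _ _ (2^-1 `^ e2 * n%:R `^ e2)); last first.
      by rewrite -powRM // ge0_ler_powR ?nnegrE ?mulr_ge0 // mulrC.
    have i2 : 0 < 2^-1 `^ e2 :> R by rewrite powR_gt0.
    apply: (@le_trans _ _ (2 * n%:R `^ be')); first by rewrite natrD -mulr2n -[leLHS]mulr_natl ler_wpM2l.
    rewrite -ler_pdivrMl // mulrA.
    by near: n; apply: near_powR_le.
have -> : \sum_(M + p <= j < M + p + M) partition_function a (n - j) =
    \sum_(M <= j < M + M) partition_function a (n - p - j).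
  rewrite big_addn addnAC addnK; apply: eq_bigr => j _.
  by rewrite addnC subnDA.
move=> h3 h4; apply: (ratio_of_averages _ cpos _ t0 t4 tth h4 h3).
  by apply: lt_le_trans eM; rewrite powR_gt0 ?ltr0n.
exact: partition_function_ge0.
Unshelve. all: by end_near. Qed.
(** * A single group count *)

Lemma alternating_binomial (R : comPzRingType) k T :
  \sum_(m < T.+1) (-1) ^+ m * 'C(k.+1, m)%:R = (-1) ^+ T * 'C(k, T)%:R :> R.
Proof.
elim: T => [|T IH]; first by rewrite big_ord_recl big_ord0 !bin0 addr0.
rewrite big_ord_recr /= IH binS natrD exprS; ring.
Qed.

(** The alternating sum stops at [(-1) ^+ T * 'C(k - 1, T)] if [k > 0]. *)
Lemma bonferroni (R : realDomainType) k T :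
  `|(k == 0%N)%:R - \sum_(m < T.+1) (-1) ^+ m * 'C(k, m)%:R| <= 'C(k, T.+1)%:R :> R.
Proof.
case: k => [|k].
  rewrite big_ord_recl /= expr0 bin0 mul1r big1 => [|i _]; last by rewrite bin0n mulr0.
  by rewrite addr0 subrr normr0.
rewrite /= sub0r normrN alternating_binomial normrM normrX normrN1 expr1n mul1r.
by rewrite ger0_norm // ler_nat binS leq_addl.
Qed.

Lemma Pr_bonferroni (R : realType) (a : nat -> R) n p T :
  (forall j, 0 <= a j) -> 0 < partition_function a n -> (0 < p)%N ->
  (p * T.+1 <= n)%N ->
  `|Pr a (fun eta : Omega n => K p eta == 0%N) -
    \sum_(m < T.+1) (- a p) ^+ m / m`!%:R *
       (partition_function a (n - p * m) / partition_function a n)|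
  <= a p ^+ T.+1 / T.+1`!%:R *
       (partition_function a (n - p * T.+1) / partition_function a n).
Proof.
move=> a0 c0 p0 pT; set c := partition_function a n in c0 *.
have pn : (0 < p <= n)%N by rewrite p0 (leq_trans _ pT) // leq_pmulr.
have fm m : (m <= T.+1)%N -> \sum_(eta : Omega n) 'C(K p eta, m)%:R * weight a eta =
    a p ^+ m / m`!%:R * partition_function a (n - p * m).
  move=> mT; rewrite factorial_moment // ltnNge (leq_trans _ pT) //.
  by rewrite leq_mul2l mT orbT.
rewrite [leRHS]mulrA -fm // PrE.
have -> : \sum_(m < T.+1) (- a p) ^+ m / m`!%:R * (partition_function a (n - p * m) / c)
   = (\sum_(eta : Omega n) (\sum_(m < T.+1) (-1) ^+ m * 'C(K p eta, m)%:R) * weight a eta) / c.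
  under [in RHS]eq_bigr do rewrite mulr_suml.
  rewrite exchange_big /= mulr_suml; apply: eq_bigr => m _.
  under [in RHS]eq_bigr do rewrite -mulrA.
  rewrite -mulr_sumr fm; last exact: ltnW.
  by rewrite (exprNn (a p)) !mulrA.
rewrite -mulrBl normrM [`|c^-1|]gtr0_norm ?invr_gt0 // ler_wpM2r ?invr_ge0 ?(ltW c0) //.
rewrite big_mkcond -sumrB; apply: le_trans (ler_norm_sum _ _ _) _.
apply: ler_sum => eta _; rewrite (_ : (if _ then _ else _) = (K p eta == 0%N)%:R * weight a eta); last first.
  by case: ifP; rewrite ?mul1r ?mul0r.
rewrite -mulrBl normrM [`|weight _ _|]ger0_norm ?weight_ge0 //.
by rewrite ler_wpM2r ?weight_ge0 // bonferroni.
Qed.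

Lemma ratio_cvg (R : realType) (l be : R) (a : nat -> R) (p : nat -> nat) m :
  power_growth l a -> (forall j, 0 <= a j) -> 0 < l -> be < (l + 1)^-1 ->
  (\forall n \near \oo, (p n)%:R <= n%:R `^ be) ->
  (partition_function a (n - p n * m) / partition_function a n) @[n --> \oo] --> (1 : R).
Proof.
move=> ga a0 l0 beg hp; set g := (l + 1)^-1 in beg.
pose be' := (be + g) / 2.
have be1 : be < be' by rewrite /be'; lra.
have be2 : be' < g by rewrite /be'; lra.
apply/cvgrPdist_le => e e0.
have := ratio_limit ga a0 l0 be2 e0 => hr.
near=> n.
have [_ h] : 0 < partition_function a n /\ forall p : nat, p%:R <= n%:R `^ be' ->
    `|partition_function a (n - p) / partition_function a n - 1| <= e by near: n.
rewrite distrC; apply: h; rewrite natrM; apply: (@le_trans _ _ (m%:R * n%:R `^ be)).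
  by rewrite mulrC ler_wpM2l //; near: n.
by near: n; apply: near_powR_le.
Unshelve. all: by end_near. Qed.

Lemma near_size_le (R : realType) (be : R) (p : nat -> nat) m :
  be < 1 -> (\forall n \near \oo, (p n)%:R <= (n%:R `^ be : R)) ->
  \forall n \near \oo, (p n * m <= n)%N.
Proof.
move=> be1 hp; near=> n; rewrite -(ler_nat R) natrM.
apply: (@le_trans _ _ (m%:R * n%:R `^ be)); last first.
  by rewrite -[leRHS]powRr1 //; near: n; apply: near_powR_le.
by rewrite mulrC ler_wpM2l //; near: n.
Unshelve. all: by end_near. Qed.

(** For each [T] the Bonferroni bounds converge to partial sums of the
    exponential series; [T] is chosen before [n]. *)
Lemma Pr_count0_cvg (R : realType) (l be b : R) (a : nat -> R) (p : nat -> nat) :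
  power_growth l a -> (forall j, 0 <= a j) -> 0 < l -> be < (l + 1)^-1 ->
  (\forall n \near \oo, (0 < p n)%N) -> (\forall n \near \oo, (p n)%:R <= n%:R `^ be) ->
  a (p n) @[n --> \oo] --> b ->
  Pr a (fun eta : Omega n => K (p n) eta == 0%N) @[n --> \oo] --> expR (- b).
Proof.
move=> ga a0 l0 beg p0 hp ab.
have g1 : (l + 1)^-1 < 1 by rewrite invf_lt1 ?addr_gt0 // ltrDr.
apply/cvgrPdist_le => e e0.
have e4 : 0 < e / 4 by rewrite divr_gt0.
have s1 : series (exp_coeff (- b)) T @[T --> \oo] --> expR (- b).
  exact: is_cvg_series_exp_coeff.
have s2 : exp_coeff b T @[T --> \oo] --> (0 : R).
  by apply: cvg_series_cvg_0; apply: is_cvg_series_exp_coeff.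
have [T [T1 T2]] : exists T, `|expR (- b) - series (exp_coeff (- b)) T.+1| <= e / 4 /\
    `|b ^+ T.+1 / T.+1`!%:R| <= e / 4.
  move/cvgrPdist_le : s2 => /(_ _ e4)[N1 _ h1].
  move/cvgrPdist_le : s1 => /(_ _ e4)[N2 _ h2]; exists (maxn N1 N2); split.
    by apply: h2; rewrite /= leqW // leq_maxr.
  by have := h1 (maxn N1 N2).+1; rewrite sub0r normrN; apply; rewrite /= leqW // leq_maxl.
pose rho n m := partition_function a (n - p n * m) / partition_function a n.
pose U n := \sum_(m < T.+1) (- a (p n)) ^+ m / m`!%:R * rho n m.
have fcvg (x : R) (u : nat -> R) m : u n @[n --> \oo] --> x ->
    (u n ^+ m / m`!%:R * rho n m) @[n --> \oo] --> x ^+ m / m`!%:R.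
  move=> ux; rewrite -[X in _ --> X]mulr1; apply: cvgM; last exact: (ratio_cvg m ga a0 l0 beg hp).
  apply: cvgM; last exact: cvg_cst.
  elim: m => [|m IH]; first by rewrite expr0; exact: cvg_cst.
  rewrite exprS; under eq_fun do rewrite exprS; exact: cvgM.
have hU : U n @[n --> \oo] --> series (exp_coeff (- b)) T.+1.
  rewrite /series /= big_mkord /U.
  elim: T.+1 => [|T' IH]; first by under eq_fun do rewrite big_ord0; rewrite big_ord0; exact: cvg_cst.
  rewrite big_ord_recr /=; under eq_fun do rewrite big_ord_recr /=.
  apply: cvgD => //; rewrite /exp_coeff /=; apply: fcvg; exact: cvgN.
have hV := fcvg b (fun n => a (p n)) T.+1 ab.
move/cvgrPdist_le : hU => /(_ _ e4) hU; move/cvgrPdist_le : hV => /(_ _ e4) hV.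
have c0 := near_partition_function_gt0 ga a0 l0.
have pT := near_size_le T.+1 (lt_trans beg g1) hp.
near=> n.
have b1 : `|Pr a (fun eta : Omega n => K (p n) eta == 0%N) - U n| <=
    a (p n) ^+ T.+1 / T.+1`!%:R * rho n T.+1.
  by apply: Pr_bonferroni => //; near: n.
have b2 : `|series (exp_coeff (- b)) T.+1 - U n| <= e / 4.
  by near: n.
have b3 : `|b ^+ T.+1 / T.+1`!%:R - a (p n) ^+ T.+1 / T.+1`!%:R * rho n T.+1| <= e / 4.
  by near: n.
move: T1 T2 b1 b2 b3; rewrite !ler_norml.
move: (Pr _ _) (U n) (series _ _) (expR _) (b ^+ _ / _) (_ * rho n _) => x1 x2 x3 x4 x5 x6.
clear; move=> /andP[? ?] /andP[? ?] /andP[? ?] /andP[? ?] /andP[? ?].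
by apply/andP; split; lra.
Unshelve. all: by end_near. Qed.

Lemma sqr_binomial k : (k ^ 2 = 2 * 'C(k, 2) + k)%N.
Proof. by elim: k => // k IH; rewrite binS bin1; lia. Qed.

(** The square of [(K - b) / b] with [b = a (p n)] is at least 1 if [K = 0],
    and its mean is [rho_2 - 2 rho_1 + 1 + rho_1 / b], where [rho_m] is the
    quotient of the partition functions at [n - m * p n] and [n], which tends
    to 1. *)
Lemma Pr_count0_cvg0 (R : realType) (l be : R) (a : nat -> R) (p : nat -> nat) :
  power_growth l a -> (forall j, 0 <= a j) -> 0 < l -> be < (l + 1)^-1 ->
  (\forall n \near \oo, (0 < p n)%N) -> (\forall n \near \oo, (p n)%:R <= n%:R `^ be) ->
  (forall B : R, \forall n \near \oo, B <= a (p n)) ->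
  Pr a (fun eta : Omega n => K (p n) eta == 0%N) @[n --> \oo] --> (0 : R).
Proof.
move=> ga a0 l0 beg p0 hp hB.
have g1 : (l + 1)^-1 < 1 by rewrite invf_lt1 ?addr_gt0 // ltrDr.
pose rho m n := partition_function a (n - p n * m) / partition_function a n.
have r1 : rho 1%N n @[n --> \oo] --> (1 : R) by exact: (ratio_cvg _ ga a0 l0 beg hp).
have r2 : rho 2 n @[n --> \oo] --> (1 : R) by exact: (ratio_cvg _ ga a0 l0 beg hp).
have c0 := near_partition_function_gt0 ga a0 l0.
have pT := near_size_le 2 (lt_trans beg g1) hp.
apply: cvg_to0 => [n|e e0]; first exact: Pr_ge0.
have e8 : 0 < e / 8 by rewrite divr_gt0.
move/cvgrPdist_le : r1 => /(_ _ e8) r1; move/cvgrPdist_le : r2 => /(_ _ e8) r2.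
near=> n.
have cn : 0 < partition_function a n by near: n.
have pn2 : (p n * 2 <= n)%N by near: n.
have pn : (0 < p n <= n)%N.
  by rewrite (leq_trans _ pn2) ?leq_pmulr // andbT; near: n.
have h1 : `|1 - rho 1%N n| <= e / 8 by near: n.
have h2 : `|1 - rho 2 n| <= e / 8 by near: n.
have hb : Num.max 1 (4 / e) <= a (p n) by near: n; exact: hB.
have [b1 b2] : 1 <= a (p n) /\ 4 / e <= a (p n).
  by move: hb; rewrite ge_max => /andP.
set b := a (p n) in b1 b2 *; have bp : 0 < b by lra.
pose X (eta : Omega n) := ((K (p n) eta)%:R - b) ^+ 2 / b ^+ 2.
have := @Pr_le_mean R a n (fun eta => K (p n) eta == 0%N) X a0 _ _.
move=> /(_ (fun eta => divr_ge0 (sqr_ge0 _) (sqr_ge0 _))) h.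
apply: le_trans (h _) _.
  by move=> eta /eqP; rewrite /X => ->; rewrite sub0r sqrrN mulfV // sqrf_eq0 gt_eqF.
have -> : \sum_eta X eta * weight a eta =
    \sum_(eta : Omega n) ((2 / b ^+ 2) * ('C(K (p n) eta, 2)%:R * weight a eta)
     + ((1 - 2 * b) / b ^+ 2) * ('C(K (p n) eta, 1)%:R * weight a eta)
     + 'C(K (p n) eta, 0)%:R * weight a eta).
  apply: eq_bigr => eta _; rewrite /X bin0 bin1.
  have sq : (K (p n) eta)%:R ^+ 2 = 2 * 'C(K (p n) eta, 2)%:R + (K (p n) eta)%:R :> R.
    by rewrite -natrX sqr_binomial natrD natrM.
  rewrite sqrrB sq; rewrite -[_ *+ 2]mulr_natl.
  move: ((K _ _)%:R) ('C(_, _)%:R) (weight _ _) (b) (gt_eqF bp) => x y w b' b'0.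
  by field; rewrite b'0.
rewrite !big_split /= -!mulr_sumr !factorial_moment // !muln0 muln1 !ltnNge.
rewrite pn2 (andP pn).2 /= subn0 expr0 expr1 (_ : 0`! = 1%N) // (_ : 1`! = 1%N) // (_ : 2`! = 2%N) //.
rewrite (_ : _ / partition_function a n = rho 2 n + (1 - 2 * b) / b * rho 1%N n + 1); last first.
  rewrite /rho muln1 -/b; move: (b) (gt_eqF bp) (gt_eqF cn) => b' b'0.
  move: (partition_function a n) (partition_function _ _) (partition_function _ _) => x y z x0.
  by field; rewrite x0 b'0.
have b4 : b^-1 <= e / 4 by rewrite -[e / 4]invf_div lef_pV2 ?posrE // divr_gt0.
rewrite (_ : (1 - 2 * b) / b = b^-1 - 2); last by field; rewrite gt_eqF.
have bi : 0 < b^-1 by rewrite invr_gt0.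
have bi1 : b^-1 <= 1 by rewrite invf_le1.
move: h1 h2 b4 bi bi1; move: (rho 1%N n) (rho 2 n) (b^-1) (e) e0 => x y z e' e'0.
clear; rewrite !ler_norml => /andP[? ?] /andP[? ?] ? ? ?.
have : z * x <= z * (1 + e' / 8) by rewrite ler_pM2l //; lra.
have : z * (e' / 8) <= e' / 8 by rewrite ler_piMl //; lra.
by lra.
Unshelve. all: by end_near. Qed.
(** * Joint group counts *)

(** The partition function of [forbid a s] sums the weights of the partitions
    without groups of a size in [s]. *)
Definition forbid (R : nmodType) (a : nat -> R) (s : seq nat) i :=
  if i \in s then 0 else a i.

Lemma forbid_ge0 (R : numDomainType) (a : nat -> R) s :
  (forall j, 0 <= a j) -> forall j, 0 <= forbid a s j.
Proof. by move=> a0 j; rewrite /forbid; case: ifP. Qed.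

Lemma forbid_cons (R : nmodType) (a : nat -> R) p s :
  forbid a (p :: s) = forbid (forbid a s) [:: p].
Proof. by apply/funext => i; rewrite /forbid !inE; case: eqP. Qed.

Lemma power_growth_forbid (R : realType) (l : R) (a : nat -> R) s :
  power_growth l a -> power_growth l (forbid a s).
Proof.
move=> ga e e0; have h := ga e e0; near=> n.
have ns : (\max_(i <- s) i < n)%N by near: n; exact: nbhs_infty_gt.
rewrite /forbid ifF; first by near: n.
by apply/negP => /(leq_bigmax_seq (F := id)) /(_ isT); rewrite leqNgt ns.
Unshelve. all: by end_near. Qed.

Lemma Pr_count0 (R : realType) (a : nat -> R) n p :
  (0 < p <= n)%N ->
  Pr a (fun eta : Omega n => K p eta == 0%N) =
  partition_function (forbid a [:: p]) n / partition_function a n.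
Proof.
move=> pn; have pin : p \in index_iota 1 n.+1 by rewrite mem_index_iota ltnS.
rewrite PrE; congr (_ / _); rewrite big_mkcond; apply: eq_bigr => eta _.
rewrite /weight !(bigD1_seq p) ?iota_uniq //= /forbid inE eqxx expr0n.
case: eqP => [->|_]; last by rewrite !mul0r.
rewrite expr0; congr (_ * _); apply: eq_bigr => i /negbTE ip.
by rewrite inE ip.
Qed.

(** Each newly forbidden size [p] costs the factor [Pr (K p = 0)], computed
    with the parameters that already forbid the other sizes. *)
Lemma forbid_ratio_cvg (R : realType) (l : R) (a : nat -> R) s :
  power_growth l a -> (forall j, 0 <= a j) -> 0 < l ->
  uniq s -> {in s, forall p, (0 < p)%N} ->
  (partition_function (forbid a s) n / partition_function a n) @[n --> \oo] -->
    \prod_(p <- s) expR (- a p).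
Proof.
move=> ga a0 l0; elim: s => [|p s IH] /=.
  move=> _ _; rewrite big_nil.
  have -> : forbid a [::] = a by apply/funext => i.
  apply: (@cvg_trans _ (1 @[n --> \oo])); last exact: cvg_cst.
  apply: near_eq_cvg; near=> n; rewrite divff // gt_eqF //.
  by near: n; apply: near_partition_function_gt0 ga a0 l0.
move=> /andP[ps us] sp.
have gs := power_growth_forbid s ga; have os := forbid_ge0 s a0.
have c0 := near_partition_function_gt0 gs os l0.
rewrite big_cons.
have g0 : 0 < (l + 1)^-1 by rewrite invr_gt0 addr_gt0.
have be : (l + 1)^-1 / 2 < (l + 1)^-1 by lra.
have be0 : 0 < (l + 1)^-1 / 2 by lra.
have p0 : (0 < p)%N by apply: sp; rewrite mem_head.
have h1 : Pr (forbid a s) (fun eta : Omega n => K p eta == 0%N) @[n --> \oo] --> expR (- a p).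
  apply: (@Pr_count0_cvg R l ((l + 1)^-1 / 2) _ _ (fun=> p)) => //.
  - exact: nearW.
  - exact: near_le_powR.
  by rewrite /forbid (negbTE ps); exact: cvg_cst.
have h2 := IH us (fun q qs => sp q (mem_behead (s := p :: s) qs)).
apply: cvg_trans (cvgM h1 h2); apply: near_eq_cvg; near=> n.
have pn : (0 < p <= n)%N by rewrite p0 /=; near: n; exact: nbhs_infty_ge.
rewrite /GRing.mul /= Pr_count0 // -forbid_cons mulrA divfK // gt_eqF //.
by near: n.
Unshelve. all: by end_near. Qed.

(** The constraints [(p, m)] of [s], which prescribe [m] groups of size [p],
    are distributed over the sizes so that the indicator of the joint event is
    a product weight. *)
Definition count_weight (R : numFieldType) (a : nat -> R) (s : seq (nat * nat)) i k : R :=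
  (all (fun q => (q.1 == i) ==> (k == q.2)) s)%:R * poisson_weight a i k.

(** Removing the prescribed groups leaves a partition without groups of these
    sizes. *)
Lemma count_weight_poly (R : numFieldType) (a : nat -> R) (s : seq (nat * nat)) N n :
  uniq (unzip1 s) -> {in unzip1 s, forall p, (0 < p <= N)%N} -> (n <= N)%N ->
  (\sum_(q <- s) q.1 * q.2 <= n)%N ->
  (weight_poly N (count_weight a s))`_n =
  (\prod_(q <- s) poisson_weight a q.1 q.2) *
    (weight_poly N (poisson_weight (forbid a (unzip1 s))))`_(n - \sum_(q <- s) q.1 * q.2).
Proof.
elim: s a n => [|[p m] s IH] a n /=.
  move=> _ _ _ _; rewrite !big_nil mul1r subn0.
  have -> : count_weight a [::] = poisson_weight (forbid a [::]) => //.
  by apply/funext => i; apply/funext => k; rewrite /count_weight /= mul1r.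
move=> /andP[ps us] sN nN; rewrite !big_cons /= => hn.
have pN : (0 < p <= N)%N by apply: sN; rewrite mem_head.
rewrite (@weight_poly_shift _ N (count_weight (forbid a [:: p]) s) _ p m (poisson_weight a p m)) //.
- rewrite ltnNge (leq_trans (leq_addr _ _) hn) /= IH //; last 3 first.
  + by move=> q qs; apply: sN; rewrite inE qs orbT.
  + exact: leq_trans (leq_subr _ _) nN.
  + by rewrite leq_subRL ?(leq_trans (leq_addr _ _) hn).
  rewrite mulrA subnDA; congr (_ * _ * _).
    rewrite big_seq [RHS]big_seq; apply: eq_bigr => q qs; rewrite /poisson_weight /forbid inE.
    case: eqP => // qp; case/negP: ps; rewrite -qp; exact: map_f.
  have -> : forbid (forbid a [:: p]) (unzip1 s) = forbid a (p :: unzip1 s) => //.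
  by apply/funext => i; rewrite /forbid !inE; case: eqP; case: ifP.
- move=> i k ip; rewrite /count_weight /= eq_sym (negbTE ip) /=.
  by rewrite /poisson_weight /forbid inE (negbTE ip).
move=> k; rewrite /count_weight /= eqxx /=.
have allT j : all (fun q => (q.1 == p) ==> (j == q.2)) s = true.
  apply/allP => q qs; apply/implyP => /eqP qp; case/negP: ps; rewrite -qp; exact: map_f.
rewrite !allT andbT mul1r /poisson_weight /forbid inE eqxx.
case: ltnP => [km|mk]; first by rewrite ltn_eqF // mul0r.
case: eqP => [->|/eqP km].
  by rewrite subnn expr0 (_ : 0`! = 1%N) // !mulr1n divr1 mulr1 mul1r.
by rewrite !mul0r expr0n subn_eq0 leqNgt ltn_neqAle eq_sym km mk /= mul0r !mulr0.
Qed.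

Lemma Pr_counts (R : realType) (a : nat -> R) n s (p k : 'I_s -> nat) :
  injective p -> (forall j, (0 < p j <= n)%N) ->
  (\sum_(j < s) p j * k j <= n)%N ->
  Pr a (fun eta : Omega n => [forall j, K (p j) eta == k j]) =
  (\prod_(j < s) (a (p j) ^+ k j / (k j)`!%:R)) *
    (partition_function (forbid a (codom p)) (n - \sum_(j < s) p j * k j) /
     partition_function a n).
Proof.
move=> p_inj pn hn; pose L := [seq (p j, k j) | j <- enum 'I_s].
have L1 : unzip1 L = codom p by rewrite /unzip1 -map_comp.
have Lsum : (\sum_(q <- L) q.1 * q.2 = \sum_(j < s) p j * k j)%N.
  by rewrite big_map big_enum.
have Lprod : \prod_(q <- L) poisson_weight a q.1 q.2 =
    \prod_(j < s) (a (p j) ^+ k j / (k j)`!%:R).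
  by rewrite big_map big_enum.
have := @count_weight_poly R a L n n _ _ (leqnn n).
rewrite Lsum Lprod L1 weight_poly_partition_function ?leq_subr // -sum_Omega.
rewrite PrE mulrA => <- //; last 2 first.
- by rewrite map_inj_uniq ?enum_uniq.
- by move=> q /codomP[j ->].
congr (_ / _); rewrite big_mkcond; apply: eq_bigr => eta _.
pose P i := all (fun q => (q.1 == i) ==> (K i eta == q.2)) L.
have allP' : [forall j, K (p j) eta == k j] = all P (index_iota 1 n.+1).
  apply/forallP/allP => [h i _|h j].
    by apply/allP => q /mapP[j _ ->] /=; apply/implyP => /eqP <-.
  have := h (p j); rewrite mem_index_iota ltnS => /(_ (pn j)) /allP.
  by move=> /(_ (p j, k j) (map_f _ (mem_enum _ j))) /=; rewrite eqxx.
rewrite allP' /count_weight big_split /=.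
have -> : \prod_(1 <= i < n.+1) (P i)%:R = (all P (index_iota 1 n.+1))%:R :> R.
  elim: (index_iota _ _) => [|i r IH] /=; first by rewrite big_nil.
  by rewrite big_cons IH -mulnb natrM.
by case: ifP; rewrite ?mul1r ?mul0r.
Qed.

Lemma Pr_counts_cvg (R : realType) (l : R) (a : nat -> R) s (p k : 'I_s -> nat) :
  power_growth l a -> (forall j, 0 <= a j) -> 0 < l ->
  injective p -> (forall j, (0 < p j)%N) ->
  Pr a (fun eta : Omega n => [forall j, K (p j) eta == k j]) @[n --> \oo] -->
  \prod_(j < s) (a (p j) ^+ k j / (k j)`!%:R * expR (- a (p j))).
Proof.
move=> ga a0 l0 p_inj p0; set Q := (\sum_(j < s) p j * k j)%N.
have gs := power_growth_forbid (codom p) ga; have os := forbid_ge0 (codom p) a0.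
have c0 := near_partition_function_gt0 gs os l0.
have g0 : 0 < (l + 1)^-1 by rewrite invr_gt0 addr_gt0.
have be : (l + 1)^-1 / 2 < (l + 1)^-1 by lra.
have be0 : 0 < (l + 1)^-1 / 2 by lra.
have h1 : (partition_function (forbid a (codom p)) (n - Q * 1) /
    partition_function (forbid a (codom p)) n) @[n --> \oo] --> (1 : R).
  by apply: (@ratio_cvg R l ((l + 1)^-1 / 2) _ (fun=> Q)) => //; exact: near_le_powR.
have h2 := @forbid_ratio_cvg R l a (codom p) ga a0 l0.
have -> : \prod_(j < s) (a (p j) ^+ k j / (k j)`!%:R * expR (- a (p j))) =
    (\prod_(j < s) (a (p j) ^+ k j / (k j)`!%:R)) * (1 * \prod_(q <- codom p) expR (- a q)).
  by rewrite big_split /= mul1r big_map big_enum.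
apply: cvg_trans (cvgM (cvg_cst _) (cvgM h1 (h2 _ _))); last 2 first.
- by rewrite map_inj_uniq ?enum_uniq.
- by move=> q /codomP[j ->].
apply: near_eq_cvg; near=> n.
rewrite /GRing.mul /= muln1 Pr_counts //; last 2 first.
- move=> j; rewrite p0 /=; apply: leq_trans (_ : \max_(i < s) p i <= n)%N.
    exact: (leq_bigmax_cond (F := p)).
  by near: n; exact: nbhs_infty_ge.
- by near: n; exact: nbhs_infty_ge.
congr (_ * _); rewrite mulrA divfK // gt_eqF //; by near: n.
Unshelve. all: by end_near. Qed.
(** * Slowly varying functions *)

Lemma derivable_continuous_at (R : realType) (f : R -> R) x :
  derivable f x 1 -> {for x, continuous f}.
Proof. by move=> /derivable1_diffP/differentiable_continuous. Qed.

(** For [u] in [[1, 2]] the ratio [L (u * x) / L x] eventually stays between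
    1/2 and 2.  The points [u] for which this holds from [i + 1] on form closed
    sets, by continuity of [L], and cover [[1, 2]], so one of them contains an
    interval by Baire's theorem.  Rescaling by a point [u0] of this interval
    moves it to 1. *)
Lemma slow_locally_uniform (R : realType) (L : R -> R) :
  (forall x, 0 < x -> {for x, continuous L}) ->
  (forall u, 0 < u -> L (u * x) / L x @[x --> +oo] --> (1 : R)) ->
  (\forall x \near +oo, 0 < L x) ->
  exists2 h : R, 0 < h & \forall x \near +oo, forall u, 1 <= u <= 1 + h ->
    L (u * x) <= 4 * L x /\ L x <= 4 * L (u * x).
Proof.
move=> Lc Ls Lp.
pose bad i (u : R) := exists2 x : R, i%:R + 1 <= x & 2 * L x < L (u * x) \/ 2 * L (u * x) < L x.
(* Every [F i] contains the points outside [[1, 2]], so its density can only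
   fail inside. *)
pose F i := [set u : R | u < 1 \/ 2 < u \/ (0 < u /\ bad i u)].
have F_open i : open (F i).
  rewrite openE => u [u1|[u2|[u0 [x xi xb]]]]; rewrite /interior /=.
  - by apply: filterS (lt_nbhsl u1) => v; left.
  - by apply: filterS (lt_nbhsr u2) => v; right; left.
  have x0 : 0 < x by apply: lt_le_trans xi; rewrite ltr_wpDl.
  have cu : L (v * x) @[v --> u] --> L (u * x).
    apply: (cvg_comp (fun v => v * x) L); last exact: (Lc _ (mulr_gt0 u0 x0)).
    exact: mulrr_continuous.
  case: xb => [xb|xb].
    have h := cvgr_gt _ cu _ xb; near=> v; right; right; split.
      by near: v; exact: lt_nbhsr.
    by exists x => //; left; near: v; exact: h.
  have h : \forall v \near u, L (v * x) < L x / 2.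
    by apply: cvgr_lt cu _ _; rewrite ltr_pdivlMr // mulrC.
  near=> v; right; right; split; first by near: v; exact: lt_nbhsr.
  exists x => //; right; rewrite mulrC -ltr_pdivlMr //; by near: v.
have [i [u0 [e e0 he]]] : exists i, exists u0 : R, exists2 e : R, 0 < e &
    forall u, `|u0 - u| < e -> ~ F i u.
  have : ~ dense (\bigcap_i F i).
    move=> /(_ ([set u : R | 1 < u] `&` [set u : R | u < 2])) [||u [[/= u1 u2] hF]].
    - by exists (3 / 2); split=> /=; lra.
    - by apply: openI; [exact: open_gt | exact: open_lt].
    have u0 : 0 < u by lra.
    have [N [_ hN]] : \forall x \near +oo,
        0 < L x /\ 2^-1 < L (u * x) / L x /\ L (u * x) / L x < 2.
      have := Ls u u0 => Lu; near=> x; split; first by near: x.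
      by split; near: x; [apply: cvgr_gt Lu _ _ | apply: cvgr_lt Lu _ _]; lra.
    have [h|[h|[_ [x xi xb]]]] := hF (Num.truncn N).+1 I; [lra|lra|].
    have xN : N < x.
      apply: lt_le_trans xi; apply: lt_trans (truncnS_gt N) _.
      by rewrite ltrDl.
    have [Lx [r1 r2]] := hN x xN; case: xb.
      by rewrite ltr_pdivrMr // in r2; rewrite ltNge (ltW r2).
    rewrite ltr_pdivlMr // in r1; move: r1; lra.
  move=> nd; have [i ndi] : exists i, ~ dense (F i).
    apply: contrapT => /forallNP h; apply: nd; apply: Baire => i.
    by split; [exact: F_open | apply: contrapT; exact: h].
  have [W [[u0 Wu0] WF]] := denseNE ndi.
  have /nbhs_ballP[e e0 heW] := open_nbhs_nbhs Wu0.
  exists i, u0, e => // u ue Fu; have : (W `&` F i) u by split=> //; exact: heW.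
  by rewrite WF.
have u01 : 1 <= u0.
  by rewrite leNgt; apply/negP => h; apply: (he u0); [rewrite subrr normr0|left].
have u02 : u0 <= 2.
  by rewrite leNgt; apply/negP => h; apply: (he u0); [rewrite subrr normr0|right; left].
have u0p : 0 < u0 by lra.
have good u x : `|u0 - u| < e -> 0 < u -> i%:R + 1 <= x ->
    L (u * x) <= 2 * L x /\ L x <= 2 * L (u * x).
  move=> ue up xi; split; rewrite leNgt; apply/negP => h; apply: (he u ue);
    right; right; split=> //; exists x => //; [by left|by right].
exists (e / 4); first by rewrite divr_gt0.
near=> x => u /andP[u1 u2].
pose y := x / u0.
have yi : i%:R + 1 <= y.
  rewrite ler_pdivlMr; last exact: u0p.
  apply: (@le_trans _ _ ((i%:R + 1) * 2)).
    by rewrite ler_wpM2l // addr_ge0.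
  by near: x; apply: nbhs_pinfty_ge; rewrite num_real.
have xy : x = u0 * y by rewrite mulrC divfK // gt_eqF.
have ue : `|u0 - u * u0| < e.
  rewrite -{1}[u0]mul1r -mulrBl normrM ler0_norm; last by lra.
  rewrite gtr0_norm // opprB; apply: (@le_lt_trans _ _ (e / 4 * 2)); last by lra.
  by rewrite ler_pM //; lra.
have uu : `|u0 - u0| < e by rewrite subrr normr0.
have [a1 a2] := good u0 y uu u0p yi.
have [b1 b2] := good (u * u0) y ue (mulr_gt0 (lt_le_trans ltr01 u1) u0p) yi.
rewrite -mulrA -xy in b1 b2; rewrite -xy in a1 a2.
by split; lra.
Unshelve. all: by end_near. Qed.

Lemma exprn_unbounded (R : realType) (h B : R) : 0 < h ->
  exists m, B <= (1 + h) ^+ m.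
Proof.
move=> h0; exists (Num.truncn (B / h)).+1; set m := _.+1.
have mB : B <= m%:R * h by rewrite -ler_pdivrMr // ltW // truncnS_gt.
apply: le_trans mB _; elim: m => [|m IH]; first by rewrite mul0r expr0 ler01.
rewrite exprS -natr1 !mulrDl !mul1r.
have : 1 <= (1 + h) ^+ m by rewrite exprn_ege1 // lerDl ltW.
by have := h0; nra.
Qed.

(** Potter's bounds: [L] changes by at most [q ^ s] under multiplication by
    [q = 1 + h], and by at most 4 in between. *)
Lemma slow_potter (R : realType) (L : R -> R) (s : R) :
  (forall x, 0 < x -> {for x, continuous L}) ->
  (forall u, 0 < u -> L (u * x) / L x @[x --> +oo] --> (1 : R)) ->
  (\forall x \near +oo, 0 < L x) -> 0 < s ->
  exists2 C : R, 0 < C & \forall x \near +oo, C^-1 * x `^ (- s) <= L x <= C * x `^ s.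
Proof.
move=> Lc Ls Lp s0.
have [h h0 hu] := slow_locally_uniform Lc Ls Lp.
pose q := 1 + h; have q1 : 1 < q by rewrite ltrDl.
have q0 : 0 < q by lra.
have qs1 : 1 < q `^ s by rewrite /powR gt_eqF // expR_gt1 mulr_gt0 // ln_gt0.
have qs0 : 0 < q `^ s by lra.
have Lq := Ls q q0.
have [X [Xr hX]] : \forall x \near +oo, [/\ 1 <= x, 0 < L x,
    (forall u, 1 <= u <= q -> L (u * x) <= 4 * L x /\ L x <= 4 * L (u * x)),
    (q `^ s)^-1 <= L (q * x) / L x & L (q * x) / L x <= q `^ s].
  near=> x; split; near: x => //.
  - by apply: nbhs_pinfty_ge; rewrite num_real.
  - by apply: cvgr_ge Lq _ _; rewrite invf_lt1.
  - exact: cvgr_le Lq _ _.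
pose x0 := X + 1; have x0X : X < x0 by rewrite ltrDl.
have [x01 Lx0 _ _ _] := hX x0 x0X.
have x00 : 0 < x0 by lra.
have pow_ge1 x : x0 <= x -> 1 <= (x / x0) `^ s.
  by move=> x1; rewrite -[leLHS](powRr0 (x / x0)) ler_powR ?(ltW s0) // ler_pdivlMr // mul1r.
have base x : x0 <= x <= x0 * q ->
    (4 * (x / x0) `^ s)^-1 * L x0 <= L x <= 4 * (x / x0) `^ s * L x0.
  move=> /andP[x1 x2]; have [_ _ hq _ _] := hX x0 x0X.
  have u1 : 1 <= x / x0 by rewrite ler_pdivlMr // mul1r.
  have [|a1 a2] := hq (x / x0).
    by rewrite u1 ler_pdivrMr // mulrC.
  rewrite divfK ?gt_eqF // in a1 a2.
  have v1 := pow_ge1 x x1; have v0 : 0 < (x / x0) `^ s := lt_le_trans ltr01 v1.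
  apply/andP; split.
    rewrite ler_pdivrMl ?mulr_gt0 //; apply: le_trans a2 _.
    have [_ Lx _ _ _] := hX x (lt_le_trans x0X x1).
    by rewrite -mulrA ler_pM2l // ler_peMl // ltW.
  by apply: le_trans a1 _; rewrite -mulrA ler_pM2l // ler_peMl // ltW.
have key m : forall x, x0 <= x <= x0 * q ^+ m.+1 ->
    (4 * (x / x0) `^ s)^-1 * L x0 <= L x <= 4 * (x / x0) `^ s * L x0.
  elim: m => [|m IH] x /andP[x1 x2]; first by apply: base; rewrite x1 -[q]expr1.
  have [xq|xq] := lerP x (x0 * q); first by apply: base; rewrite x1.
  pose y := x / q; have xy : x = q * y by rewrite mulrC divfK // gt_eqF.
  have y1 : x0 <= y by rewrite ler_pdivlMr // ltW.
  have /andP[a1 a2] : (4 * (y / x0) `^ s)^-1 * L x0 <= L y <= 4 * (y / x0) `^ s * L x0.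
    by apply: IH; rewrite y1 ler_pdivrMr // -mulrA -exprSr.
  have [y0 Ly _ r1 r2] := hX y (lt_le_trans x0X y1).
  have -> : (x / x0) `^ s = q `^ s * (y / x0) `^ s.
    by rewrite xy -mulrA powRM ?(ltW q0) // divr_ge0 ?(ltW x00) // (le_trans ler01).
  rewrite -xy ler_pdivlMr // in r1; rewrite -xy ler_pdivrMr // in r2.
  apply/andP; split.
    apply: le_trans r1; rewrite mulrCA invfM -mulrA ler_pM2l ?invr_gt0 //.
  by apply: le_trans r2 _; rewrite mulrCA -mulrA ler_pM2l.
pose C := 4 * L x0 + 4 / L x0.
have C1 : 4 * L x0 <= C by rewrite lerDl divr_ge0 // ltW.
have C2 : 4 / L x0 <= C by rewrite lerDr mulr_ge0 // ltW.
have C0 : 0 < C by apply: lt_le_trans C1; rewrite mulr_gt0.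
exists C => //; near=> x.
have x1 : x0 <= x by near: x; apply: nbhs_pinfty_ge; rewrite num_real.
have xp : 0 < x := lt_le_trans x00 x1.
have [m hm] := exprn_unbounded (x / x0) h0.
have /andP[a1 a2] : (4 * (x / x0) `^ s)^-1 * L x0 <= L x <= 4 * (x / x0) `^ s * L x0.
  apply: (key m); rewrite x1 /= mulrC -ler_pdivrMr //; apply: le_trans hm _.
  by rewrite exprS ler_peMl ?exprn_ge0 ?(ltW q0) ?(ltW q1).
have v1 : (x / x0) `^ s <= x `^ s.
  rewrite ge0_ler_powR ?(ltW s0) // ?nnegrE ?divr_ge0 ?(ltW xp) ?(ltW x00) //.
  by rewrite ler_pdivrMr // ler_peMr // ltW.
have v0 : 0 < (x / x0) `^ s by rewrite powR_gt0 // divr_gt0.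
have w0 : 0 < x `^ s by rewrite powR_gt0.
apply/andP; split.
  apply: le_trans a1; rewrite powRN.
  rewrite [leRHS](_ : _ = (4 / L x0)^-1 * ((x / x0) `^ s)^-1); last first.
    by field; rewrite !gt_eqF.
  have L4 : 0 < 4 / L x0 by rewrite divr_gt0.
  by rewrite ler_pM ?invr_ge0 ?(ltW C0) ?(ltW w0) // lef_pV2 ?posrE.
apply: le_trans a2 _; rewrite mulrAC; apply: ler_pM => //; last exact: ltW.
by rewrite mulr_ge0 // ltW.
Unshelve. all: by end_near. Qed.
Lemma near_nat (R : realType) (P : R -> Prop) :
  (\forall x \near +oo, P x) -> \forall n \near \oo, P n%:R.
Proof. by move=> h; have := @cvgr_idn R; apply. Qed.

Lemma equiv_near (R : realType) (u v : nat -> R) e : u ~_\oo v -> 0 < e ->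
  \forall n \near \oo, `|u n - v n| <= e * `|v n|.
Proof. by move=> /eqaddoP h e0; apply: h. Qed.

Lemma in_F_growth (R : realType) (l : R) (a : nat -> R) (L : R -> R) d :
  in_F l a L d -> power_growth l a.
Proof.
case=> _ [Lp Ls] [Ld _] _ _ _ ae s s0.
have Lc x : 0 < x -> {for x, continuous L}.
  by move=> x0; apply/derivable_continuous_at/Ld.
have s2 : 0 < s / 2 by rewrite divr_gt0.
have [C C0 hC] := slow_potter Lc Ls Lp s2.
have hC' := near_nat hC; have Lp' := near_nat Lp.
have he := equiv_near ae (_ : 0 < 2^-1).
near=> n.
have n0 : (0 < n)%N by near: n; exact: nbhs_infty_gt.
have /andP[L1 L2] : C^-1 * n%:R `^ (- (s / 2)) <= L n%:R <= C * n%:R `^ (s / 2) by near: n.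
have L0 : 0 < L n%:R by near: n.
have b0 : 0 < n%:R `^ (l - 1) * L n%:R by rewrite mulr_gt0 // powR_gt0 // ltr0n.
have : `|a n - n%:R `^ (l - 1) * L n%:R| <= 2^-1 * `|n%:R `^ (l - 1) * L n%:R|.
  by near: n; apply: he; rewrite invr_gt0.
rewrite (gtr0_norm b0) ler_norml => /andP[a1 a2].
have p0 : 0 <= n%:R `^ (l - 1) :> R by apply: powR_ge0.
apply/andP; split.
  have : 2 * C * n%:R `^ (l - 1 - s) <= n%:R `^ (l - 1 - s / 2).
    by near: n; apply: near_powR_le; lra.
  rewrite [in leRHS]powRD_nat // => h.
  have h1 := ler_wpM2l p0 L1.
  have h2 : C * (n%:R `^ (l - 1) * (C^-1 * n%:R `^ (- (s / 2)))) =
      n%:R `^ (l - 1) * n%:R `^ (- (s / 2)).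
    by field; rewrite gt_eqF.
  have h3 : 2 * n%:R `^ (l - 1 - s) <= n%:R `^ (l - 1) * L n%:R.
    rewrite -(ler_pM2l C0); apply: le_trans (ler_wpM2l (ltW C0) h1).
    by rewrite h2 mulrA [C * 2]mulrC.
  by move: h3 a1; move: (_ * L _) (_ `^ (l - 1 - s)) => *; lra.
have : 2 * C * n%:R `^ (l - 1 + s / 2) <= n%:R `^ (l - 1 + s).
  by near: n; apply: near_powR_le; lra.
apply: le_trans; rewrite powRD_nat //.
have h1 := ler_wpM2l p0 L2.
rewrite (_ : 2 * C * _ = 2 * (n%:R `^ (l - 1) * (C * n%:R `^ (s / 2)))); last by ring.
by move: h1 a2 b0; move: (_ * (C * _)) (_ * L _) => *; lra.
Unshelve. all: by end_near. Qed.

Lemma near_comp_size (R : realType) (eps : R) (p : nat -> nat) (P : nat -> Prop) :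
  0 < eps -> (\forall n \near \oo, n%:R `^ eps <= (p n)%:R :> R) ->
  (\forall n \near \oo, P n) -> \forall n \near \oo, P (p n).
Proof.
move=> e0 hp [N _ hN]; near=> n; apply: hN => /=; rewrite -(ler_nat R).
apply: (@le_trans _ _ (n%:R `^ eps)); last by near: n.
by near: n; exact: near_le_powR.
Unshelve. all: by end_near. Qed.

Lemma equiv_cvg (R : realType) (u v : nat -> R) (r : R) :
  u ~_\oo v -> v n @[n --> \oo] --> r -> u n @[n --> \oo] --> r.
Proof.
move=> uv vr; apply/cvgrPdist_le => e e0.
have q0 : 0 < e / (2 * (`|r| + e / 2)).
  by rewrite divr_gt0 // mulr_gt0 // ltr_wpDl // divr_gt0.
have h := equiv_near uv q0.
have e2 : 0 < e / 2 by rewrite divr_gt0.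
move/cvgrPdist_le : vr => /(_ _ e2) vr.
near=> n.
have h1 : `|r - v n| <= e / 2 by near: n.
have h2 : `|u n - v n| <= e / (2 * (`|r| + e / 2)) * `|v n| by near: n.
have h3 : `|v n| <= `|r| + e / 2.
  rewrite -[v n](subKr r); apply: le_trans (ler_normB _ _) _; by rewrite lerD2l.
have h4 : `|u n - v n| <= e / 2.
  apply: le_trans h2 _; rewrite -ler_pdivlMl //; apply: le_trans h3 _.
  rewrite invf_div le_eqVlt; apply/orP; left; apply/eqP; field.
  by rewrite !gt_eqF // ltr_wpDl // ?divr_gt0.
rewrite (_ : r - u n = (r - v n) - (u n - v n)); last by ring.
by apply: le_trans (ler_normB _ _) _; lra.
Unshelve. all: by end_near. Qed.

(** * The three limits *)

Lemma weight_forbid0 (R : realType) (a : nat -> R) n (eta : Omega n) :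
  weight (forbid a [:: 0%N]) eta = weight a eta.
Proof.
by apply: eq_big_nat => i /andP[i0 _]; rewrite /forbid inE -(negbK (i == _)) -lt0n i0.
Qed.

(** The measure does not depend on [a 0]; setting it to 0 makes all parameters
    nonnegative. *)
Lemma Pr_forbid0 (R : realType) (a : nat -> R) n (E : pred (Omega n)) :
  Pr (forbid a [:: 0%N]) E = Pr a E.
Proof.
rewrite !PrE /partition_function; congr (_ / _);
by apply: eq_bigr => eta _; rewrite weight_forbid0.
Qed.

Lemma Pr_qbar_cvg (R : realType) (l eps : R) (a : nat -> R) :
  power_growth l a -> (forall j, 0 <= a j) -> 0 < l -> 0 < eps ->
  Pr a (fun eta : Omega n =>
          n%:R `^ ((l + 1)^-1 - eps) < (qbar eta)%:R
            < n%:R `^ ((l + 1)^-1 + eps)) @[n --> \oo] --> (1 : R).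
Proof.
move=> ga a0 l0 e0; set g := (l + 1)^-1.
have lo : Pr a (fun eta : Omega n => (qbar eta)%:R <= n%:R `^ (g - eps)) @[n --> \oo] --> (0 : R).
  by apply: Pr_qbar_low ga a0 l0 _; rewrite /g; lra.
have hi : Pr a (fun eta : Omega n => n%:R `^ (g + eps) <= (qbar eta)%:R) @[n --> \oo] --> (0 : R).
  by apply: Pr_qbar_high ga a0 l0 _; rewrite /g; lra.
have c0 := near_partition_function_gt0 ga a0 l0.
apply/cvgrPdist_le => e e_gt0.
have e2 : 0 < e / 2 by rewrite divr_gt0.
move/cvgrPdist_le : lo => /(_ _ e2) lo; move/cvgrPdist_le : hi => /(_ _ e2) hi.
near=> n.
have cn : partition_function a n != 0 by rewrite gt_eqF //; near: n.
have hA : `|0 - Pr a (fun eta : Omega n => (qbar eta)%:R <= n%:R `^ (g - eps))| <= e / 2.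
  by near: n.
have hB : `|0 - Pr a (fun eta : Omega n => n%:R `^ (g + eps) <= (qbar eta)%:R)| <= e / 2.
  by near: n.
set E := (X in Pr a X).
pose A (eta : Omega n) := (qbar eta)%:R <= n%:R `^ (g - eps).
pose B (eta : Omega n) := n%:R `^ (g + eps) <= (qbar eta)%:R.
rewrite Pr_predC // opprB addrC subrK ger0_norm ?Pr_ge0 //.
move: hA hB; rewrite -/A -/B.
rewrite !sub0r !normrN !ger0_norm ?Pr_ge0 // => hA hB.
apply: (@le_trans _ _ (Pr a A + Pr a B)); last by lra.
rewrite /Pr big_mkcond [X in _ <= X + _]big_mkcond [X in _ <= _ + X]big_mkcond -big_split.
apply: ler_sum => eta _ /=; have m0 := mu_ge0 eta a0.
rewrite /E negb_and -!leNgt -/(A eta) -/(B eta).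
by case: (A eta); case: (B eta); rewrite /= ?addr0 ?add0r // lerDl.
Unshelve. all: by end_near. Qed.

Lemma Pr_count0_trichotomy (R : realType) (l : R) (a : nat -> R) (L : R -> R)
    (d : \bar R) (eps beta : R) (p : nat -> nat) :
  0 < l -> in_F l a L d ->
  0 < eps -> beta < (l + 1)^-1 ->
  (\forall n \near \oo, n%:R `^ eps <= (p n)%:R <= n%:R `^ beta) ->
  (Pr (forbid a [:: 0%N]) (fun eta : Omega n => K (p n) eta == 0%N))%:E
    @[n --> \oo] -->
    (if (l < 1)%R then 1 else if (l == 1)%R then expeR (- d) else 0)%E.
Proof.
move=> l0 ha e0 bg hp; set b := forbid a _.
have gb : power_growth l b by apply/power_growth_forbid/(in_F_growth ha).
have b0 j : 0 <= b j.
  rewrite /b /forbid inE; case: eqP => // /eqP j0; apply/ltW/(F_pos ha); by rewrite lt0n.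
have p1 : \forall n \near \oo, n%:R `^ eps <= (p n)%:R :> R.
  by apply: filterS hp => n /andP[].
have p2 : \forall n \near \oo, (p n)%:R <= n%:R `^ beta :> R.
  by apply: filterS hp => n /andP[].
have p0 : \forall n \near \oo, (0 < p n)%N.
  by apply: (near_comp_size (P := fun m => (0 < m)%N)) e0 p1 _; exact: nbhs_infty_gt.
have pb (P : R -> Prop) : (\forall n \near \oo, P (b n)) -> \forall n \near \oo, P (b (p n)).
  exact: (near_comp_size (P := fun m => P (b m)) e0 p1).
have fin (r : R) : b n @[n --> \oo] --> r ->
    (Pr b (fun eta : Omega n => K (p n) eta == 0%N))%:E @[n --> \oo] --> (expR (- r))%:E.
  move=> br; apply: cvg_EFin; first exact: nearW.
  apply: (Pr_count0_cvg gb b0 l0 bg p0 p2); apply/cvgrPdist_le => e ee.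
  move/cvgrPdist_le : br => /(_ _ ee) br.
  exact: (pb (fun x => `|r - x| <= e)).
have inf : (forall B : R, \forall n \near \oo, B <= b n) ->
    (Pr b (fun eta : Omega n => K (p n) eta == 0%N))%:E @[n --> \oo] --> 0%E.
  move=> hB; apply: cvg_EFin; first exact: nearW.
  apply: (Pr_count0_cvg0 gb b0 l0 bg p0 p2) => B; exact: (pb (fun x => B <= x)).
have [l1|l1|l1] := ltrgtP l 1.
- have -> : 1%E = (expR (- 0))%:E :> \bar R by rewrite oppr0 expR0.
  apply: fin; apply: cvg_to0 => // e ee.
  have s0 : 0 < (1 - l) / 2 by lra.
  have gs := gb _ s0; near=> n.
  have /andP[_ h] : n%:R `^ (l - 1 - (1 - l) / 2) <= b n <= n%:R `^ (l - 1 + (1 - l) / 2).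
    by near: n.
  apply: le_trans h _; rewrite -[leRHS]mulr1 -ler_pdivrMl // -[leRHS](powRr0 n%:R).
  by near: n; apply: near_powR_le; lra.
- apply: inf => B; have s0 : 0 < (l - 1) / 2 by lra.
  have gs := gb _ s0; near=> n.
  have /andP[h _] : n%:R `^ (l - 1 - (l - 1) / 2) <= b n <= n%:R `^ (l - 1 + (l - 1) / 2).
    by near: n.
  by apply: le_trans h; near: n; apply: near_le_powR; lra.
have aL : a ~_\oo (fun n => L n%:R).
  have := F_equiv ha; rewrite l1 subrr.
  by under eq_fun do rewrite powRr0 mul1r.
have ab : \forall n \near \oo, a n = b n.
  near=> n; rewrite /b /forbid inE ifF //; apply/negbTE; rewrite -lt0n.
  by near: n; exact: nbhs_infty_gt.
have dL := F_lim ha.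
case: d ha dL => [r||] ha dL.
- rewrite /=; apply: fin.
  apply: (@cvg_trans _ (a n @[n --> \oo])); first exact: near_eq_cvg.
  by apply: equiv_cvg aL _; have /fine_cvgP[_] := dL.
- apply: inf => B.
  have h := equiv_near aL (_ : 0 < 2^-1).
  move/cvgeyPge : dL => dL; have := dL (Num.max 0 (2 * B)) => dB.
  near=> n.
  have : Num.max 0 (2 * B) <= L n%:R by rewrite -lee_fin; near: n.
  rewrite ge_max => /andP[L0 LB].
  have : `|a n - L n%:R| <= 2^-1 * `|L n%:R| by near: n; apply: h; rewrite invr_gt0.
  rewrite (ger0_norm L0) ler_norml => /andP[h1 _].
  have <- : a n = b n by near: n.
  by move: h1 LB; move: (L _) (a n) => *; lra.
- by have := F_lim_ge0 ha.
Unshelve. all: by end_near. Qed.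

Theorem theorem4 (R : realType) (l : R) (a : nat -> R) (L : R -> R)
    (d : \bar R) (hl : 0 < l) (ha : in_F l a L d) :
  [/\ (forall eps : R, 0 < eps ->
         Pr a (fun eta : Omega n =>
           n%:R `^ ((l + 1)^-1 - eps) < (qbar eta)%:R
             < n%:R `^ ((l + 1)^-1 + eps))
         @[n --> \oo] --> (1 : R)),
      (forall (eps beta : R) (p : nat -> nat),
         0 < eps -> beta < (l + 1)^-1 ->
         (\forall n \near \oo, n%:R `^ eps <= (p n)%:R <= n%:R `^ beta) ->
         (Pr a (fun eta : Omega n => K (p n) eta == 0%N))%:E
         @[n --> \oo] -->
           (if (l < 1)%R then 1 else if (l == 1)%R then expeR (- d) else 0)%E) &
      (forall (s : nat) (p k : 'I_s -> nat),
         injective p -> (forall j, 0 < p j)%N ->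
         Pr a (fun eta : Omega n => [forall j, K (p j) eta == k j])
         @[n --> \oo] -->
           \prod_(j < s) (a (p j) ^+ k j / (k j)`!%:R * expR (- a (p j))))].
Proof.
set b := forbid a [:: 0%N].
have gb : power_growth l b by apply/power_growth_forbid/(in_F_growth ha).
have b0 j : 0 <= b j.
  rewrite /b /forbid inE; case: eqP => // /eqP j0; apply/ltW/(F_pos ha); by rewrite lt0n.
split.
- move=> eps e0; have := Pr_qbar_cvg gb b0 hl e0.
  by under eq_fun do rewrite Pr_forbid0.
- move=> eps beta p e0 bg hp; have := Pr_count0_trichotomy hl ha e0 bg hp.
  by under eq_fun do rewrite Pr_forbid0.
- move=> s p k p_inj p0; have := @Pr_counts_cvg R l b s p k gb b0 hl p_inj p0.
  under eq_fun do rewrite Pr_forbid0.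
  under eq_bigr => j _ do rewrite /b /forbid inE -(negbK (p j == _)) -lt0n p0 /=.
  by [].
Qed.
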